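(* Let $\alpha\in(0,1]$ and let $(X_i)_{i\in\mathbb N}$ be a stationary $\mathbb R^d$-valued process with continuous multidimensional distribution function $F$. Assume: (i) for every $f\in\mathcal H_\alpha$ with ${\rm E}f(X_0)=0$ there is $\sigma_f^2<\infty$ with $\frac1{\sqrt n}\sum_{i=1}^nf(X_i)\to N(0,\sigma_f^2)$ in distribution; (ii) there are constants $\beta>0$, $\gamma>1$, $r\ge1$, an integer $p>rd$, $\kappa_1,\dots,\kappa_p>0$, $\lambda>1$, $z_0\in\mathbb R^+$ and an invertible increasing function $\Phi:\mathbb R_0^+\to\mathbb R_0^+$ such that $w_F(y)\le\beta\,\Phi(y^{-\alpha})^{-\gamma}$ for all $y>0$, $\kappa_i<\gamma\big(\frac ir+2(p-i)-d\big)$ for $i=1,\dots,p$, $\Phi(2z)\le\lambda\Phi(z)$ for all $z\ge z_0$, and such that for all $f\in\mathcal H_\alpha$ with $\|f\|_\infty\le1$ and all $n\ge1$ $${\rm E}\Big|\sum_{i=1}^n\big(f(X_i)-{\rm E}f(X_0)\big)\Big|^{2p}\le C\sum_{i=1}^p n^i\,\|f(X_0)-{\rm E}f(X_0)\|_r^i\,\Phi^{\kappa_i}\big(\|f-{\rm E}f(X_0)\|_{\mathcal H_\alpha}\big)$$ for some constant $C>0$. Then there is a centered Gaussian process $(W(t))_{t\in[-\infty,\infty]^d}$ with almost surely continuous sample paths such that $U_n\to W$ in distribution in $\mathbb D([-\infty,\infty]^d)$.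
   Context: $\mathcal H_\alpha$ is the space of bounded functions $f:\mathbb R^d\to\mathbb R$ with finite norm $\|f\|_{\mathcal H_\alpha}=\|f\|_\infty+\sup_{x\ne y}\frac{|f(x)-f(y)|}{\|x-y\|^\alpha}$. $\|\cdot\|_r$ is the $L^r$ norm; $\Phi^{\kappa}(x)=(\Phi(x))^\kappa$. Modulus of continuity: $w_F(\delta)=\sup\{|F(t)-F(s)|:\|t-s\|\le\delta\}$. Inequalities between vectors are componentwise, $F(t)=P(X_0\le t)$. Empirical process $U_n(t)=\frac1{\sqrt n}\sum_{i=1}^n(\mathbf 1\{X_i\le t\}-F(t))$, $t\in[-\infty,\infty]^d$, a random element of $\mathbb D([-\infty,\infty]^d)$ (multidimensional càdlàg functions with the multidimensional Skorokhod metric). *)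

(* Defs.v *)
From HB Require Import structures.
From mathcomp Require Import all_boot all_order all_algebra.
From mathcomp Require Import all_classical all_reals all_analysis.

Set Implicit Arguments.
Unset Strict Implicit.
Unset Printing Implicit Defensive.

Import Order.TTheory GRing.Theory Num.Def Num.Theory.
Import numFieldNormedType.Exports.

Local Open Scope classical_set_scope.
Local Open Scope ring_scope.

Section defs.
Context {R : realType}.

Definition edistR (d : nat) (x y : 'I_d -> R) : R :=
  Num.sqrt (\sum_(k < d) (x k - y k) ^+ 2).

(* metric on [-oo,oo]^d : max over coordinates of |contract s_k - contract t_k|,
   which metrizes the product topology of the extended real line *)
Definition edistE (d : nat) (s t : 'I_d -> \bar R) : R :=
  \big[Num.max/0]_(k < d) `|contract (s k) - contract (t k)|.

Definition sup_norm (d : nat) (f : ('I_d -> R) -> R) : R :=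
  sup [set `|f x| | x in [set: 'I_d -> R]].

Definition holder_seminorm (d : nat) (alpha : R) (f : ('I_d -> R) -> R) : R :=
  sup [set z | exists x y, x <> y /\ z = `|f x - f y| / (edistR x y) `^ alpha].

Definition in_Holder (d : nat) (alpha : R) (f : ('I_d -> R) -> R) : Prop :=
  (exists M : R, forall x, `|f x| <= M) /\
  (exists M : R, forall x y, x <> y -> `|f x - f y| / (edistR x y) `^ alpha <= M).

Definition holder_norm (d : nat) (alpha : R) (f : ('I_d -> R) -> R) : R :=
  sup_norm f + holder_seminorm alpha f.

Definition expectR (dO : measure_display) (O : measurableType dO)
  (P : probability O R) (Y : O -> R) : R :=
  fine (\int[P]_w (Y w)%:E)%E.

Definition Lr_norm (dO : measure_display) (O : measurableType dO)
  (P : probability O R) (r : R) (Y : O -> R) : R :=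
  (fine (\int[P]_w (`|Y w| `^ r)%:E)%E) `^ r^-1.

(* Borel (product) sigma-algebra on (R^d)^m, generated by the coordinates *)
Definition fdd_sets (m d : nat) : set (set ('I_m -> 'I_d -> R)) :=
  <<s [set A | exists (j : 'I_m) (k : 'I_d) (B : set R),
                 measurable B /\ A = (fun y => y j k) @^-1` B] >>.

Definition strictly_stationary (dO : measure_display) (O : measurableType dO)
  (P : probability O R) (d : nat) (X : nat -> O -> 'I_d -> R) : Prop :=
  forall (m k : nat) (A : set ('I_m -> 'I_d -> R)), fdd_sets A ->
    P [set w | A (fun j : 'I_m => X (k + j)%N w)] =
    P [set w | A (fun j : 'I_m => X (nat_of_ord j) w)].

Definition dist_fun (dO : measure_display) (O : measurableType dO)
  (P : probability O R) (d : nat) (X : nat -> O -> 'I_d -> R) (t : 'I_d -> R) : R :=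
  fine (P [set w | forall k, X 0%N w k <= t k]).

Definition dist_funE (dO : measure_display) (O : measurableType dO)
  (P : probability O R) (d : nat) (X : nat -> O -> 'I_d -> R) (t : 'I_d -> \bar R) : R :=
  fine (P [set w | forall k, ((X 0%N w k)%:E <= t k)%E]).

Definition continuous_Rd (d : nat) (F : ('I_d -> R) -> R) : Prop :=
  forall x (e : R), 0 < e -> exists2 delta : R, 0 < delta &
    forall y, edistR x y < delta -> `|F x - F y| < e.

Definition modulus_cont (d : nat) (F : ('I_d -> R) -> R) (delta : R) : R :=
  sup [set z | exists t s, edistR t s <= delta /\ z = `|F t - F s|].

Definition normal_law (v : R) (A : set R) : \bar R :=
  if v == 0 then ((0 : R) \in A)%:R%:E else normal_prob 0 (Num.sqrt v) A.

Definition normal_expect (v : R) (g : R -> R) : R :=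
  if v == 0 then g 0
  else fine (\int[lebesgue_measure]_x (g x * normal_pdf 0 (Num.sqrt v) x)%:E)%E.

Definition cvg_dist_normal (dO : measure_display) (O : measurableType dO)
  (P : probability O R) (Y : nat -> O -> R) (v : R) : Prop :=
  forall g : R -> R, (exists M : R, forall x, `|g x| <= M) -> continuous g ->
    (fun n => expectR P (fun w => g (Y n w))) @ \oo --> normal_expect v g.

Definition quadrant (d : nat) (t : 'I_d -> \bar R) (rho : 'I_d -> bool)
  (s : 'I_d -> \bar R) : Prop :=
  forall k, if rho k then (t k <= s k)%E else (s k < t k)%E.

Definition cadlag (d : nat) (x : ('I_d -> \bar R) -> R) : Prop :=
  forall t,
    (forall rho, exists L : R, forall e : R, 0 < e -> exists2 delta : R, 0 < delta &
       forall s, quadrant t rho s -> edistE s t < delta -> `|x s - L| < e) /\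
    (forall e : R, 0 < e -> exists2 delta : R, 0 < delta &
       forall s, quadrant t (fun _ => true) s -> edistE s t < delta -> `|x s - x t| < e).

Definition time_change (d : nat) (l : 'I_d -> \bar R -> \bar R) : Prop :=
  forall k,
    (forall s t, (s < t)%E -> (l k s < l k t)%E) /\
    (forall u, exists t, l k t = u) /\
    (forall t (e : R), 0 < e -> exists2 delta : R, 0 < delta &
       forall s, `|contract s - contract t| < delta ->
                 `|contract (l k s) - contract (l k t)| < e).

Definition skorokhod_dist (d : nat) (x y : ('I_d -> \bar R) -> R) : R :=
  inf [set e : R | exists l, time_change l /\
        (forall k t, `|contract (l k t) - contract t| <= e) /\
        (forall t, `|x t - y (fun k => l k (t k))| <= e)].

Definition cvg_dist_D (d : nat) (dO : measure_display) (O : measurableType dO)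
  (P : probability O R) (U : nat -> O -> ('I_d -> \bar R) -> R)
  (dO' : measure_display) (O' : measurableType dO') (Q : probability O' R)
  (W : O' -> ('I_d -> \bar R) -> R) : Prop :=
  forall g : (('I_d -> \bar R) -> R) -> R,
    (exists M : R, forall x, `|g x| <= M) ->
    (forall x, cadlag x -> forall e : R, 0 < e -> exists2 delta : R, 0 < delta &
       forall y, cadlag y -> skorokhod_dist x y < delta -> `|g x - g y| < e) ->
    (fun n => expectR P (fun w => g (U n w))) @ \oo --> expectR Q (fun w => g (W w)).

Definition emp_process (dO : measure_display) (O : measurableType dO)
  (P : probability O R) (d : nat) (X : nat -> O -> 'I_d -> R)
  (n : nat) (w : O) (t : 'I_d -> \bar R) : R :=
  (Num.sqrt n%:R)^-1 * \sum_(1 <= i < n.+1)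
     ((if [forall k, ((X i w k)%:E <= t k)%E] then 1 else 0) - dist_funE P X t).

Definition centered_gaussian_process (d : nat) (dO : measure_display)
  (O : measurableType dO) (Q : probability O R) (W : ('I_d -> \bar R) -> O -> R) : Prop :=
  (forall t, measurable_fun setT (W t)) /\
  forall (m : nat) (ts : 'I_m -> 'I_d -> \bar R) (a : 'I_m -> R),
    exists2 v : R, 0 <= v &
      forall A : set R, measurable A ->
        Q [set w | A (\sum_(j < m) a j * W (ts j) w)] = normal_law v A.

Definition as_continuous_paths (d : nat) (dO : measure_display)
  (O : measurableType dO) (Q : probability O R) (W : ('I_d -> \bar R) -> O -> R) : Prop :=
  exists A : set O, [/\ measurable A, Q A = 1%E &
    forall w, A w -> forall t (e : R), 0 < e -> exists2 delta : R, 0 < delta &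
      forall s, edistE s t < delta -> `|W s w - W t w| < e].

End defs.

(* Main.v *)
(* Every quadrant is bracketed, at each dyadic level q, by two products of ramps
   between neighbouring quantiles of the marginals. These functions are Hoelder,
   so the CLT (i) applies to their linear combinations, and (ii), through the
   bound on the modulus of F, makes the tails of the increments of the empirical
   process between consecutive levels summable over the 2^(q d) cells of a level.
   Chaining up to 2^q ~ sqrt n, where the bracket itself costs only a small
   constant, shows that U_n is uniformly close, with high probability, to its
   value on the level-q brackets, uniformly in large n.

   The limits of the finite-dimensional laws on the countable family of brackets
   are realized on [0, 1] through random binary digits, and the same tail bounds
   pass to the limit; by Borel-Cantelli the resulting Gaussian variables converge
   uniformly along q to a process W, which is continuous because nearby points
   lie in neighbouring cells. Finally, a Skorokhod-continuous function is
   approximated from below by functions that are Lipschitz for the uniform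
   distance; on the level-q approximations these depend on finitely many
   brackets only, so their expectations converge. Applied to g and -g, this
   gives U_n -> W. *)
Require Import Defs.
From HB Require Import structures.
From mathcomp Require Import all_boot all_order all_algebra.
From mathcomp Require Import all_classical all_reals all_analysis measurable_realfun.
From mathcomp Require Import ring lra zify.
Set Implicit Arguments.
Unset Strict Implicit.
Unset Printing Implicit Defensive.
Import Order.TTheory GRing.Theory Num.Def Num.Theory.
Import numFieldNormedType.Exports.
Local Open Scope classical_set_scope.
Local Open Scope ring_scope.

(** * Expectations of bounded random variables *)

Section bounded_expectation.
Context {R : realType} {dO : measure_display} {O : measurableType dO}.
Variable P : probability O R.
Implicit Types (Y Z : O -> R) (M e : R).

(** The condition on [kappa] balances several powers. A difference of two brackets of level l has an
    L^r norm of order 2^(-l/r) and a Hoelder constant B with Phi(B) of order 2^(l/gamma), so term i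
    of the 2p-th moment of its normalized sum is of order n^(i-p) 2^(l(kappa_i/gamma - i/r)). There
    are about 2^(ld) such differences, and n is at least of order 4^l along the chaining; the union
    bound therefore decays in l as soon as kappa_i/gamma - i/r + d - 2(p-i) < 0. Quantiles give all
    marginal cells the same probability; the modulus of F then bounds the distance between two
    quantiles from below, hence the steepness of the ramps from above. Along an ultrafilter all
    bounded sequences converge, so the limit law is built before any convergence is known.
    Cramer-Wold, proved by trigonometric approximation, then gives limits along all n, which must
    agree with those along the ultrafilter. The functional g need not be measurable, and its
    continuity concerns cadlag paths only; the expectation of g(U_n) is therefore squeezed between
    expectations of measurable functions. *)

Definition bmeas Y := measurable_fun setT Y /\ exists M, forall w, `|Y w| <= M.

Lemma bmeas_integrable Y : bmeas Y -> P.-integrable setT (EFin \o Y).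
Proof.
move=> [mY [M YM]].
apply: (le_integrable measurableT (g := EFin \o cst M)).
- exact/measurable_EFinP.
- move=> w _ /=; rewrite lee_fin; apply: le_trans (YM w) _.
  exact: ler_norm.
- exact: finite_measure_integrable_cst.
Qed.

Lemma bmeas_cst M : bmeas (fun=> M).
Proof. by split; [exact: measurable_cst|exists `|M|]. Qed.

Lemma bmeasD Y Z : bmeas Y -> bmeas Z -> bmeas (fun w => Y w + Z w).
Proof.
move=> [mY [M YM]] [mZ [N ZN]]; split; first exact: measurable_funD.
by exists (M + N) => w; rewrite (le_trans (ler_normD _ _))// lerD.
Qed.

Lemma bmeasM Y Z : bmeas Y -> bmeas Z -> bmeas (fun w => Y w * Z w).
Proof.
move=> [mY [M YM]] [mZ [N ZN]]; split; first exact: measurable_funM.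
by exists (M * N) => w; rewrite normrM ler_pM.
Qed.

Lemma bmeasZ M Y : bmeas Y -> bmeas (fun w => M * Y w).
Proof. by move=> bY; apply: bmeasM => //; exact: bmeas_cst. Qed.

Lemma bmeasN Y : bmeas Y -> bmeas (fun w => - Y w).
Proof.
move=> [mY [M YM]]; split; first exact: measurableT_comp.
by exists M => w; rewrite normrN.
Qed.

Lemma bmeasB Y Z : bmeas Y -> bmeas Z -> bmeas (fun w => Y w - Z w).
Proof. by move=> bY bZ; apply: bmeasD => //; exact: bmeasN. Qed.

Lemma bmeas_norm Y : bmeas Y -> bmeas (fun w => `|Y w|).
Proof.
move=> [mY [M YM]]; split; first exact: measurableT_comp.
by exists M => w; rewrite normr_id.
Qed.

Lemma bmeas_indic (A : set O) : measurable A -> bmeas (\1_A : O -> R).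
Proof.
move=> mA; split; first exact: measurable_indic.
by exists 1 => w; rewrite indicE; case: (_ \in _); rewrite ?normr1 ?normr0.
Qed.

Lemma bmeas_sum (I : Type) (s : seq I) (Y : I -> O -> R) :
  (forall i, bmeas (Y i)) -> bmeas (fun w => \sum_(i <- s) Y i w).
Proof.
move=> bY; elim: s => [|i s IH].
  by under eq_fun do rewrite big_nil; exact: bmeas_cst.
by under eq_fun do rewrite big_cons; exact: bmeasD.
Qed.

Lemma expectR_cst M : expectR P (fun=> M) = M.
Proof. by rewrite /expectR integral_cst//= probability_setT mule1. Qed.

Lemma expectRD Y Z : bmeas Y -> bmeas Z ->
  expectR P (fun w => Y w + Z w) = expectR P Y + expectR P Z.
Proof. by move=> bY bZ; apply: RintegralD => //; exact: bmeas_integrable. Qed.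

Lemma expectRB Y Z : bmeas Y -> bmeas Z ->
  expectR P (fun w => Y w - Z w) = expectR P Y - expectR P Z.
Proof. by move=> bY bZ; apply: RintegralB => //; exact: bmeas_integrable. Qed.

Lemma expectRZ M Y : bmeas Y -> expectR P (fun w => M * Y w) = M * expectR P Y.
Proof. by move=> bY; apply: RintegralZl => //; exact: bmeas_integrable. Qed.

Lemma expectRN Y : bmeas Y -> expectR P (fun w => - Y w) = - expectR P Y.
Proof.
move=> bY; rewrite -mulN1r -expectRZ//; congr expectR; apply/funext => w.
by rewrite mulN1r.
Qed.

Lemma expectR_sum (I : Type) (s : seq I) (Y : I -> O -> R) :
  (forall i, bmeas (Y i)) ->
  expectR P (fun w => \sum_(i <- s) Y i w) = \sum_(i <- s) expectR P (Y i).
Proof.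
move=> bY; elim: s => [|i s IH].
  by under eq_fun do rewrite big_nil; rewrite expectR_cst big_nil.
under eq_fun do rewrite big_cons.
by rewrite expectRD ?IH ?big_cons//; exact: bmeas_sum.
Qed.

Lemma expectR_indic (A : set O) : measurable A ->
  expectR P (\1_A : O -> R) = fine (P A).
Proof. by move=> mA; rewrite /expectR integral_indic// setIT. Qed.

Lemma le_expectR Y Z : bmeas Y -> bmeas Z -> (forall w, Y w <= Z w) ->
  expectR P Y <= expectR P Z.
Proof.
move=> bY bZ YZ.
by apply: le_Rintegral => //; exact: bmeas_integrable.
Qed.

Lemma expectR_ge0 Y : (forall w, 0 <= Y w) -> 0 <= expectR P Y.
Proof. by move=> Y0; apply: Rintegral_ge0. Qed.

Lemma expectR_le_cst Y M : bmeas Y -> (forall w, Y w <= M) -> expectR P Y <= M.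
Proof.
by move=> bY YM; rewrite -[leRHS]expectR_cst le_expectR//; exact: bmeas_cst.
Qed.

Lemma normr_expectR_le Y : bmeas Y -> `|expectR P Y| <= expectR P (fun w => `|Y w|).
Proof. by move=> bY; apply: le_normr_Rintegral => //; exact: bmeas_integrable. Qed.

Lemma normr_expectR_le_cst Y M : bmeas Y -> (forall w, `|Y w| <= M) ->
  `|expectR P Y| <= M.
Proof.
move=> bY YM; apply: le_trans (normr_expectR_le bY) _.
by apply: expectR_le_cst => //; exact: bmeas_norm.
Qed.

Lemma probability_fin_num (A : set O) : measurable A -> P A \is a fin_num.
Proof. by move=> mA; rewrite fin_num_measure. Qed.

Lemma fine_probability_le (A B : set O) : measurable A -> measurable B ->
  A `<=` B -> fine (P A) <= fine (P B).
Proof.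
move=> mA mB AB; rewrite fine_le ?probability_fin_num//.
by rewrite le_measure// inE.
Qed.

(* The integral of the library is the lower integral when the integrand is not
   measurable, so monotonicity survives when only the bounds are measurable. *)
Lemma expectR_between (Y L U : O -> R) : bmeas L -> bmeas U ->
  (forall w, L w <= Y w <= U w) -> expectR P L <= expectR P Y <= expectR P U.
Proof.
move=> bL bU LYU.
have step (f g : O -> \bar R) : measurable_fun setT g ->
    (forall w, (0 <= f w)%E) -> (forall w, (f w <= g w)%E) ->
    (\int[P]_w f w <= \int[P]_w g w)%E.
  move=> mg f0 fg; rewrite !ge0_integralTE//; last first.
    by move=> w; apply: le_trans (f0 w) (fg w).
  apply: le_ereal_sup => _ [h hf <-]; exists h => // w.
  by apply: le_trans (hf w) (fg w).
have step' (f g : O -> \bar R) : measurable_fun setT g ->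
    (forall w, (0 <= g w)%E) -> (forall w, (g w <= f w)%E) ->
    (\int[P]_w g w <= \int[P]_w f w)%E.
  move=> mg g0 gf; rewrite !ge0_integralTE//; last first.
    by move=> w; apply: le_trans (g0 w) (gf w).
  apply: le_ereal_sup => _ [h hf <-]; exists h => // w.
  by apply: le_trans (hf w) (gf w).
have [iL iU] := (bmeas_integrable bL, bmeas_integrable bU).
have mL := measurable_int _ iL; have mU := measurable_int _ iU.
rewrite /expectR.
have p1 : (\int[P]_w ((EFin \o L)^\+ w) <= \int[P]_w ((EFin \o Y)^\+ w)
    <= \int[P]_w ((EFin \o U)^\+ w))%E.
  apply/andP; split; [apply: step'|apply: step] => //.
  - exact: measurable_funepos.
  - move=> w; rewrite !funeposE /= le_max2 ?lexx// lee_fin.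
    by case/andP: (LYU w).
  - exact: measurable_funepos.
  - move=> w; rewrite !funeposE /= le_max2 ?lexx// lee_fin.
    by case/andP: (LYU w).
have p2 : (\int[P]_w ((EFin \o U)^\- w) <= \int[P]_w ((EFin \o Y)^\- w)
    <= \int[P]_w ((EFin \o L)^\- w))%E.
  apply/andP; split; [apply: step'|apply: step] => //.
  - exact: measurable_funeneg.
  - move=> w; rewrite !funenegE /= le_max2 ?lexx// lee_fin lerN2.
    by case/andP: (LYU w).
  - exact: measurable_funeneg.
  - move=> w; rewrite !funenegE /= le_max2 ?lexx// lee_fin lerN2.
    by case/andP: (LYU w).
have fpos f : P.-integrable setT f -> (\int[P]_w (f^\+ w))%E \is a fin_num.
  by move=> If; apply: integrable_fin_num => //; exact: integrable_funepos.
have fneg f : P.-integrable setT f -> (\int[P]_w (f^\- w))%E \is a fin_num.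
  by move=> If; apply: integrable_fin_num => //; exact: integrable_funeneg.
(* Squeezed between finite integrals, both parts of [Y] have finite integrals, so the difference in
   [integralE] is genuine and [fine] is monotone on it. *)
have sq (a b c : \bar R) : (a <= b <= c)%E -> a \is a fin_num ->
    c \is a fin_num -> b \is a fin_num.
  case/andP=> ab bc; rewrite !fin_numElt => /andP[a0 _] /andP[_ c0].
  by rewrite (lt_le_trans a0 ab) (le_lt_trans bc c0).
have f1 := sq _ _ _ p1 (fpos _ iL) (fpos _ iU).
have f2 := sq _ _ _ p2 (fneg _ iU) (fneg _ iL).
case/andP: p1 => p11 p12; case/andP: p2 => p21 p22.
rewrite (integralE P setT (EFin \o L)) (integralE P setT (EFin \o Y)) (integralE P setT (EFin \o U)).
apply/andP; split; apply: fine_le.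
- by rewrite fin_numB; apply/andP; split; [exact: fpos|exact: fneg].
- by rewrite fin_numB; apply/andP; split.
- exact: leeB.
- by rewrite fin_numB; apply/andP; split.
- by rewrite fin_numB; apply/andP; split; [exact: fpos|exact: fneg].
- exact: leeB.
Qed.

Lemma expectR_cvg (Y : nat -> O -> R) (Z : O -> R) M :
  (forall n, measurable_fun setT (Y n)) -> measurable_fun setT Z ->
  (forall n w, `|Y n w| <= M) ->
  {ae P, forall w, Y n w @[n --> \oo] --> Z w} ->
  expectR P (Y n) @[n --> \oo] --> expectR P Z.
Proof.
move=> mY mZ YM YZ.
have [|||||iZ _ ] := @dominated_convergence _ _ _ P _ measurableT
   (fun n => EFin \o Y n) (EFin \o Z) (EFin \o cst M).
- by move=> n; exact/measurable_EFinP.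
- exact/measurable_EFinP.
- apply: filterS YZ => w YZw _; apply/fine_cvgP; split; last exact: YZw.
  exact: nearW.
- exact: finite_measure_integrable_cst.
- by apply: aeW => w n _ /=; rewrite lee_fin.
rewrite /expectR => H.
have : fine (\int[P]_w (Y n w)%:E)%E @[n --> \oo] --> fine (\int[P]_w (Z w)%:E)%E.
  apply: fine_cvg; rewrite fineK//.
  exact: (integrable_fin_num measurableT iZ).
exact.
Qed.

Lemma expectR_close Y Z (B : set O) e M : bmeas Y -> bmeas Z -> measurable B ->
  0 <= e -> (forall w, `|Y w - Z w| <= M) ->
  (forall w, ~ B w -> `|Y w - Z w| <= e) ->
  `|expectR P Y - expectR P Z| <= e + M * fine (P B).
Proof.
move=> bY bZ mB e0 YZM YZe.
rewrite -expectRB//; apply: le_trans (normr_expectR_le (bmeasB bY bZ)) _.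
rewrite -(expectR_indic mB) -[e in leRHS]expectR_cst -expectRZ; last exact: bmeas_indic.
rewrite -expectRD; [|exact: bmeas_cst|exact/bmeasZ/bmeas_indic].
apply: le_expectR.
- exact/bmeas_norm/bmeasB.
- by apply: bmeasD; [exact: bmeas_cst|exact/bmeasZ/bmeas_indic].
move=> w; rewrite indicE; have [wB|wB] := boolP (w \in B).
  by rewrite mulr1 (le_trans (YZM w))// lerDr.
by rewrite mulr0 addr0 YZe// => Bw; move/negP: wB; apply; rewrite inE.
Qed.

Lemma measurable_gt_norm (Y : O -> R) e : measurable_fun setT Y ->
  measurable [set w | e < `|Y w|].
Proof.
move=> mY; have -> : [set w | e < `|Y w|] = (fun w => `|Y w|) @^-1` `]e, +oo[.
  by apply/seteqP; split => w /=; rewrite in_itv/= andbT.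
have mN : measurable_fun setT (fun w => `|Y w|) by exact: measurableT_comp.
by rewrite -[X in measurable X]setTI; exact: mN.
Qed.

Lemma markov_power (Y : O -> R) (k : nat) (c e : R) :
  measurable_fun setT Y -> 0 < e -> (\int[P]_w (`|Y w| ^+ k)%:E <= c%:E)%E ->
  fine (P [set w | e < `|Y w|]) <= c / e ^+ k.
Proof.
move=> mY e0 Yc.
have mA := measurable_gt_norm e mY.
rewrite ler_pdivlMr ?exprn_gt0// -lee_fin EFinM fineK ?probability_fin_num//.
apply: le_trans Yc.
have -> : (P [set w | (e < `|Y w|)%R] * (e ^+ k)%:E =
    \int[P]_(w in [set w | (e < `|Y w|)%R]) (e ^+ k)%:E)%E.
  by rewrite integral_cst// muleC.
have mYk : measurable_fun setT (fun w => (`|Y w| ^+ k)%:E).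
  by apply/measurable_EFinP/measurable_funX; exact: measurableT_comp.
apply: (@le_trans _ _ (\int[P]_(w in [set w | (e < `|Y w|)%R]) (`|Y w| ^+ k)%:E)%E).
  apply: ge0_le_integral => //.
  - by move=> w _; rewrite lee_fin exprn_ge0// ltW.
  - exact: measurable_funS mYk.
  - by move=> w /= ew; rewrite lee_fin lerXn2r// ?nnegrE ltW// (lt_trans e0).
exact: ge0_subset_integral.
Qed.

End bounded_expectation.

Lemma cvgr_le_cst {R : realType} {T : Type} (F : set_system T) {FF : ProperFilter F}
    (u : T -> R) (l c : R) :
  u x @[x --> F] --> l -> (forall x, u x <= c) -> l <= c.
Proof.
move=> ul uc; rewrite -(cvg_lim (@Rhausdorff R) ul).
by apply: limr_le; [apply/cvg_ex; exists l|exact: filterE].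
Qed.

Lemma cvg_rsum {R : realType} {T : Type} (F : set_system T) {FF : Filter F}
    (I : Type) (s : seq I) (f : I -> T -> R) (a : I -> R) :
  (forall i, f i x @[x --> F] --> a i) ->
  \sum_(i <- s) f i x @[x --> F] --> \sum_(i <- s) a i.
Proof.
move=> fa; elim: s => [|i s IH].
  by rewrite big_nil; under eq_fun do rewrite big_nil; exact: cvg_cst.
by rewrite big_cons; under eq_fun do rewrite big_cons; apply: cvgD => //; exact: fa.
Qed.

(** * Geometric series, Cauchy sequences and Borel-Cantelli *)

Section geometric_bounds.
Context {R : realType}.

Lemma sum_geometric_le (a x : R) (N n : nat) : 0 <= a -> 0 < x < 1 ->
  \sum_(N <= i < n) a * x ^+ i <= a * x ^+ N / (1 - x).
Proof.
move=> a0 /andP[x0 x1].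
have [nN|Nn] := leqP n N.
  rewrite big_geq//; apply: divr_ge0; last by rewrite subr_ge0 ltW.
  by rewrite mulr_ge0// exprn_ge0// ltW.
rewrite -(subnKC (ltnW Nn)); set m := (n - N)%N.
elim: m => [|m IH].
  rewrite addn0 big_geq//; apply: divr_ge0; last by rewrite subr_ge0 ltW.
  by rewrite mulr_ge0// exprn_ge0// ltW.
rewrite -big_distrr /= geometric_partial_tail.
rewrite -mulrA ler_wpM2l//.
by apply: geometric_le_lim; rewrite ?exprn_ge0 ?ger0_norm// ltW.
Qed.

(** The rate depends only on [N], [C] and [x], not on [u]; this later makes the convergence of the
    limit paths uniform in the time parameter. *)
Lemma geometric_cauchy_cvg (u : nat -> R) (N : nat) (C x : R) : 0 <= C -> 0 < x < 1 ->
  (forall n, (N <= n)%N -> `|u n.+1 - u n| <= C * x ^+ n) ->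
  exists2 l, u n @[n --> \oo] --> l &
    forall n, (N <= n)%N -> `|l - u n| <= C * x ^+ n / (1 - x).
Proof.
move=> C0 x01 uC.
have dist n m : (N <= n)%N -> (n <= m)%N -> `|u m - u n| <= C * x ^+ n / (1 - x).
  move=> Nn nm; apply: le_trans (sum_geometric_le n m C0 x01).
  rewrite -(telescope_sumr u nm); apply: le_trans (ler_norm_sum _ _ _) _.
  rewrite big_nat [leRHS]big_nat; apply: ler_sum => i /andP[ni _].
  by apply: uC; exact: leq_trans ni.
have [x0 x1] := andP x01.
have geo : (fun n => C * x ^+ n / (1 - x)) @ \oo --> (0 : R).
  have -> : (0 : R) = C * 0 / (1 - x) by rewrite mulr0 mul0r.
  apply: cvgMl; apply: cvgMr; apply: cvg_expr.
  by rewrite ger0_norm ?ltW.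
have cu : cvg (u n @[n --> \oo]).
  apply: cauchy_cvg; apply/cauchy_exP => e e0.
  have : \forall n \near \oo, C * x ^+ n / (1 - x) < e.
    by move/cvgrPdist_lt: geo => /(_ e e0); apply: filterS => n; rewrite sub0r normrN; apply: le_lt_trans; exact: ler_norm.
  case=> N' _ H; pose n := maxn N N'.
  exists (u n), n => // m /= nm; rewrite /ball /= distrC.
  apply: le_lt_trans (dist n m (leq_maxl _ _) nm) _.
  by apply: H; rewrite /= leq_maxr.
exists (lim (u n @[n --> \oo])) => // n Nn.
have h : `|u m - u n| @[m --> \oo] --> `|lim (u n @[n --> \oo]) - u n|.
  by apply: cvg_norm; apply: cvgB => //; exact: cvg_cst.
rewrite -(cvg_lim _ h)//; apply: limr_le; first by apply/cvg_ex; eexists; exact: h.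
by exists n => // m /= nm; exact: dist.
Qed.

Lemma borel_cantelli_geometric {dO : measure_display} {O : measurableType dO}
    (P : probability O R) (F : nat -> set O) (K y : R) : 0 <= K -> 0 < y < 1 ->
  (forall n, measurable (F n)) -> (forall n, fine (P (F n)) <= K * y ^+ n) ->
  P (lim_sup_set F) = 0%E.
Proof.
move=> K0 y01 mF FK; apply: lim_sup_set_cvg0 => //.
have [y0 y1] := andP y01.
apply: (@le_lt_trans _ _ (K / (1 - y))%:E); last exact: ltry.
apply: lime_le; first exact: is_cvg_nneseries.
apply: nearW => n.
rewrite (eq_bigr (fun k => (fine (P (F k)))%:E)); last first.
  by move=> k _; rewrite fineK// probability_fin_num.
rewrite sumEFin lee_fin.
apply: (@le_trans _ _ (\sum_(0 <= i < n) K * y ^+ i)); first exact: ler_sum.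
by apply: le_trans (sum_geometric_le _ _ K0 y01) _; rewrite expr0 mulr1.
Qed.

End geometric_bounds.

(** * Random variables with prescribed ultrafilter limits of laws *)

(** The image of [U] lies in a compact segment, so it has a cluster point; an ultrafilter converges
    to each of its cluster points. *)
Lemma ultra_bounded_cvg {R : realType} (U : set_system nat) (u : nat -> R) (M : R) :
  UltraFilter U -> (forall n, `|u n| <= M) -> cvg (u n @[n --> U]).
Proof.
move=> UU uM; have PU : ProperFilter U := @ultra_proper _ _ UU.
have uU : (u n @[n --> U]) (`[- M, M]%classic : set R).
  rewrite /fmap /=; apply: (@filterE _ U) => n /=.
  by rewrite in_itv/= -ler_norml.
have [p [_ clp]] := @segment_compact R (- M) M (u n @[n --> U]) _ uU.
apply/cvg_ex; exists p => A nA.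
have [//|UC] := in_ultra_setVsetC (u @^-1` A) UU.
by have [x [nAx /nAx]] := clp (~` A) A UC nA.
Qed.

Section finitely_valued.
Context {R : realType} {dO : measure_display} {O : measurableType dO}.
Variables (P : probability O R) (T : finType) (X : O -> T) (H : T -> R).
Hypothesis mX : forall t, measurable [set w | X w = t].

Let HE : (fun w => H (X w)) =
  (fun w => \sum_(t : T) H t * \1_[set w | X w = t] w).
Proof.
apply/funext => w; rewrite (bigD1 (X w))//= indicE mem_set// mulr1.
rewrite big1 ?addr0// => t tX; rewrite indicE memNset ?mulr0//= => Xt.
by rewrite Xt eqxx in tX.
Qed.

Lemma bmeas_finite : bmeas (fun w => H (X w)).
Proof. by rewrite HE; apply: bmeas_sum => t; exact/bmeasZ/bmeas_indic. Qed.

Lemma expectR_finite :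
  expectR P (fun w => H (X w)) = \sum_(t : T) H t * fine (P [set w | X w = t]).
Proof.
rewrite HE expectR_sum; last by move=> t; exact/bmeasZ/bmeas_indic.
apply: eq_bigr => t _; rewrite expectRZ; last exact: bmeas_indic.
by rewrite expectR_indic.
Qed.

End finitely_valued.

(** * Random bits with prescribed cylinder probabilities *)

Section binary_digits.
Context {R : realType}.
Variable mu : seq bool -> R.
Hypothesis mu_nil : mu [::] = 1.
Hypothesis mu_ge0 : forall s, 0 <= mu s.
Hypothesis mu_rcons : forall s, mu (rcons s false) + mu (rcons s true) = mu s.

(* The points of [0, 1[ whose digits start with s form the interval
   [left_end s, left_end s + mu s[. *)
Let run_step (sl : seq bool * R) (b : bool) :=
  (rcons sl.1 b, if b then sl.2 + mu (rcons sl.1 false) else sl.2).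
Let run s := foldl run_step ([::], 0) s.
Let left_end s := (run s).2.

Let run1 s : (run s).1 = s.
Proof.
by elim/last_ind: s => // s b IH; rewrite /run foldl_rcons /= -/(run s) IH.
Qed.

Let left_end_rcons s b : left_end (rcons s b) =
  if b then left_end s + mu (rcons s false) else left_end s.
Proof. by rewrite /left_end /run foldl_rcons /= -/(run s) run1. Qed.

(** The interval of [s] is cut in two, with [rcons s false] on the left; the digit says on which
    side w falls. *)
Definition next_digit (w : R) (s : seq bool) :=
  left_end s + mu (rcons s false) <= w.

Fixpoint digits (w : R) (k : nat) : seq bool :=
  if k is k'.+1 then rcons (digits w k') (next_digit w (digits w k')) else [::].

Definition digit (j : nat) (w : R) : bool := nth false (digits w j.+1) j.

Lemma size_digits w k : size (digits w k) = k.
Proof. by elim: k => //= k IH; rewrite size_rcons IH. Qed.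

Lemma nth_digits w k j : (j < k)%N -> nth false (digits w k) j = digit j w.
Proof.
elim: k => // k IH; rewrite ltnS leq_eqVlt => /predU1P[->//|jk].
by rewrite /= nth_rcons size_digits jk IH.
Qed.

Let left_end_bounds s : 0 <= left_end s /\ left_end s + mu s <= 1.
Proof.
elim/last_ind: s => [|s b [IH1 IH2]]; first by rewrite /left_end /= mu_nil add0r.
rewrite left_end_rcons; have := mu_rcons s; have := mu_ge0 (rcons s false).
by have := mu_ge0 (rcons s true); case: b => ? ? ?; split; lra.
Qed.

Let digits_itv s w : 0 <= w < 1 ->
  (digits w (size s) = s) <-> (left_end s <= w < left_end s + mu s).
Proof.
move=> w01; elim/last_ind: s => [|s b IH].
  by rewrite /left_end /= mu_nil add0r w01.
rewrite size_rcons /= left_end_rcons; split.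
  move=> /rcons_inj[ds]; have /IH := ds; rewrite ds /next_digit.
  move: (mu_rcons s); case: b => m /andP[h1 h2].
    by move=> h; apply/andP; split; [|lra].
  by move=> /negbT; rewrite -ltNge => h; apply/andP; split; [|lra].
move=> H.
have /IH ds : left_end s <= w < left_end s + mu s.
  move: H (mu_rcons s) (mu_ge0 (rcons s false)) (mu_ge0 (rcons s true)).
  by case: b => /andP[? ?] ? ? ?; apply/andP; split; lra.
rewrite ds; congr rcons; rewrite /next_digit.
move: H (mu_rcons s); case: b => /andP[h1 h2] m; first by rewrite h1.
by apply/negbTE; rewrite -ltNge.
Qed.

Lemma measurable_digits k s : measurable [set w : R | digits w k = s].
Proof.
elim: k s => [|k IH] s.
  have [->|s0] := eqVneq s [::].
    by rewrite (_ : [set _ | _] = setT)//; apply/seteqP; split.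
  by rewrite (_ : [set _ | _] = set0)//; apply/seteqP; split => // w /= s0'; rewrite -s0' eqxx in s0.
elim/last_ind: s => [|s b _].
  rewrite (_ : [set _ | _] = set0)//; apply/seteqP; split => // w /= /(congr1 size).
  by rewrite size_rcons.
have -> : [set w : R | digits w k.+1 = rcons s b] =
    [set w | digits w k = s] `&` [set w | next_digit w s = b].
  apply/seteqP; split => w /=.
    by move=> /rcons_inj[<-].
  by move=> [-> ->].
apply: measurableI; first exact: IH.
have mf : measurable_fun (setT : set R) (fun w => next_digit w s).
  by apply: measurable_fun_ler => //; exact: measurable_cst.
by rewrite -[X in measurable X]setTI; exact: (mf measurableT [set b]).
Qed.

Let Q : probability (measurableTypeR R) R := uniform_prob (@ltr01 R).

Let Q_itv (a b : R) : 0 <= a -> a <= b -> b <= 1 -> Q (`[a, b[%classic) = (b - a)%:E.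
Proof.
move=> a0 ab b1; rewrite /Q /= /uniform_prob.
rewrite (eq_integral (fun=> 1%:E)); last first.
  move=> x; rewrite inE/= in_itv/= => /andP[ax xb].
  rewrite /uniform_pdf (le_trans a0 ax) (le_trans (ltW xb) b1).
  by rewrite subr0 invr1.
rewrite integral_cst//= mul1e lebesgue_measure_itv/= lte_fin.
have [//|ba] := ltP a b.
by have -> : b = a; [apply/eqP; rewrite eq_le ba ab|rewrite subrr].
Qed.

Lemma uniform_digits s : fine (Q [set w | digits w (size s) = s]) = mu s.
Proof.
have [l0 l1] := left_end_bounds s.
have m01 : measurable (`[0, 1[%classic : set (measurableTypeR R)) by [].
have mA := measurable_digits (size s) s.
(* [digits_itv] speaks of points of [0, 1[ only; the rest of the line is [Q]-negligible. *)
have -> : Q [set w | digits w (size s) = s] =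
    Q ([set w | digits w (size s) = s] `&` `[0, 1[%classic).
  rewrite (measureDI Q mA m01) [X in (X + _)%E](_ : _ = 0%E) ?add0e//.
  apply/eqP; rewrite eq_le measure_ge0 andbT.
  have -> : 0%E = Q (~` `[0, 1[%classic).
    by rewrite probability_setC// Q_itv// subr0 subee.
  by apply: le_measure; rewrite ?inE; [exact: measurableD|exact: measurableC|move=> w []].
have -> : [set w | digits w (size s) = s] `&` `[0, 1[%classic =
    `[left_end s, left_end s + mu s[%classic.
  apply/seteqP; split => w /=; rewrite !in_itv/=.
    by move=> [ds w01]; apply/digits_itv.
  move=> H; have w01 : 0 <= w < 1.
    by move/andP: H => [h1 h2]; apply/andP; split; lra.
  by split => //; apply/digits_itv.
by rewrite Q_itv ?lerDl// addrC addKr.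
Qed.

End binary_digits.

(** Padding a prefix with [false] lets one functional of infinite bit sequences be evaluated on
    prefixes of every length. *)
Definition seq_bits (s : seq bool) : nat -> bool := nth false s.

Section limit_of_bits.
Context {R : realType} {dO : measure_display} {O : measurableType dO}.
Variables (P : probability O R) (U : set_system nat) (UU : UltraFilter U).
Variable b : nat -> nat -> O -> bool.
Hypothesis mb : forall n j, measurable_fun setT (b n j).

Definition bits_upto {T} (k : nat) (c : nat -> T -> bool) (w : T) : seq bool :=
  mkseq (fun j => c j w) k.

Lemma bits_upto_mktuple {T} k (c : nat -> T -> bool) w :
  bits_upto k c w = [tuple c j w | j < k].
Proof.
apply: (@eq_from_nth _ false) => [|i]; rewrite size_mkseq ?size_tuple// => ik.
by rewrite nth_mkseq// -(tnth_nth false _ (Ordinal ik)) tnth_mktuple.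
Qed.

Lemma measurable_tuple_bits {d1} {T : measurableType d1} k (c : nat -> T -> bool) t :
  (forall j, measurable_fun setT (c j)) ->
  measurable [set w | [tuple c j w | j < k] = t].
Proof.
move=> mc; have -> : [set w | [tuple c j w | j < k] = t] =
    \bigcap_(j in [set: 'I_k]) [set w | c j w = tnth t j].
  apply/seteqP; split => w /= h.
    by move=> j _; rewrite -h tnth_mktuple.
  by apply: eq_from_tnth => j; rewrite tnth_mktuple h.
apply: fin_bigcap_measurable => // j _.
by rewrite -[X in measurable X]setTI; exact: (mc j measurableT [set tnth t j]).
Qed.

Lemma bmeas_bits {d1} {T : measurableType d1} k (c : nat -> T -> bool) H :
  (forall j, measurable_fun setT (c j)) ->
  bmeas (fun w => H (seq_bits (bits_upto k c w)) : R).
Proof.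
move=> mc; under eq_fun do rewrite bits_upto_mktuple.
exact: (bmeas_finite (X := fun w => [tuple c j w | j < k]) (fun t : k.-tuple bool => H (seq_bits t)) (fun t => measurable_tuple_bits t mc)).
Qed.

Lemma expectR_bits {d1} {T : measurableType d1} (P1 : probability T R)
    k (c : nat -> T -> bool) H :
  (forall j, measurable_fun setT (c j)) ->
  expectR P1 (fun w => H (seq_bits (bits_upto k c w))) =
  \sum_(t : k.-tuple bool) H (seq_bits t) *
     fine (P1 [set w | bits_upto k c w = t]).
Proof.
move=> mc; under eq_fun do rewrite bits_upto_mktuple.
rewrite (expectR_finite P1 (fun t : k.-tuple bool => H (seq_bits t)) (fun t => measurable_tuple_bits t mc)).
apply: eq_bigr => t _; congr (_ * fine (P1 _)); apply/seteqP; split => w /=.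
  by rewrite bits_upto_mktuple => ->.
by rewrite bits_upto_mktuple => h; exact: val_inj.
Qed.

Let cell n (s : seq bool) := [set w | bits_upto (size s) (b n) w = s].

Let mcell n s : measurable (cell n s).
Proof.
have -> : cell n s = [set w | [tuple b n j w | j < size s] = in_tuple s].
  apply/seteqP; split => w; rewrite /cell/= bits_upto_mktuple => h.
    exact: val_inj.
  by rewrite h.
exact: measurable_tuple_bits.
Qed.

(** Limits along [U] of the cylinder probabilities. Mass 1, positivity and additivity over the next
    bit survive the limit, which is all that the construction of the digits asks for. *)
Let mu s : R := lim (fine (P (cell n s)) @[n --> U]).

Let mu_cvg s : fine (P (cell n s)) @[n --> U] --> mu s.
Proof.
apply: (@ultra_bounded_cvg _ U _ 1 UU) => n.
rewrite ger0_norm ?fine_ge0// -lee_fin fineK ?probability_fin_num//.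
exact: probability_le1.
Qed.

Let PU : ProperFilter U. Proof. exact: (@ultra_proper _ _ UU). Qed.

Let mu_nil : mu [::] = 1.
Proof.
apply: (@cvg_unique _ (@Rhausdorff R) (fine (P (cell n [::])) @[n --> U])) => //.
  exact: mu_cvg.
have -> : (fun n => fine (P (cell n [::]))) = fun=> 1.
  apply/funext => n; rewrite (_ : cell n [::] = setT) ?probability_setT//.
  by apply/seteqP; split.
exact: cvg_cst.
Qed.

Let mu_ge0 s : 0 <= mu s.
Proof.
by apply: limr_ge; [exact: mu_cvg|apply: filterE => n; exact: fine_ge0].
Qed.

Let mu_rcons s : mu (rcons s false) + mu (rcons s true) = mu s.
Proof.
apply: (@cvg_unique _ (@Rhausdorff R) (fine (P (cell n s)) @[n --> U])) => //; last first.
  exact: mu_cvg.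
have -> : (fun n => fine (P (cell n s))) =
    (fun n => fine (P (cell n (rcons s false))) + fine (P (cell n (rcons s true)))).
  apply/funext => n; rewrite -fineD ?probability_fin_num// -measureU//.
    congr (fine (P _)); apply/seteqP; split => w; rewrite /cell/= !size_rcons /bits_upto mkseqS.
      by move=> ->; case: (b n (size s) w); [right|left].
    by case=> /rcons_inj[].
  apply/seteqP; split => // w []; rewrite /cell/= !size_rcons /bits_upto mkseqS.
  by move=> /rcons_inj[_ ->] /rcons_inj[].
by apply: cvgD; exact: mu_cvg.
Qed.

Definition limit_bit (j : nat) (w : R) : bool := digit mu j w.

Lemma measurable_limit_bit j :
  measurable_fun (setT : set (measurableTypeR R)) (limit_bit j).
Proof.
apply: (@measurable_fun_bool _ _ _ _ true); rewrite setTI.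
have -> : limit_bit j @^-1` [set true] =
    \bigcup_(t in [set t : j.+1.-tuple bool | nth false t j])
       [set w | digits mu w j.+1 = t].
  apply/seteqP; split => w.
    rewrite /= /limit_bit /digit => h.
    by exists (tcast (size_digits mu w j.+1) (in_tuple (digits mu w j.+1))) => /=;
      rewrite val_tcast.
  by move=> [t /= tj dt]; rewrite /limit_bit /digit /= dt tj.
by apply: fin_bigcup_measurable => // t _; exact: measurable_digits.
Qed.

(** A functional of k bits is a finite combination of indicators of cylinders, whose probabilities
    converge to those of the digits by construction. *)
Lemma cvg_expectR_bits k (H : (nat -> bool) -> R) :
  expectR P (fun w => H (seq_bits (bits_upto k (b n) w))) @[n --> U] -->
  expectR (uniform_prob (@ltr01 R) : probability (measurableTypeR R) R)
    (fun w => H (seq_bits (bits_upto k limit_bit w))).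
Proof.
rewrite (expectR_bits _ _ _ measurable_limit_bit).
under eq_fun do rewrite (expectR_bits _ _ _ (mb _)).
apply: cvg_rsum => t; apply: cvgMr.
have -> : fine ((uniform_prob (@ltr01 R) : probability (measurableTypeR R) R)
    [set w | bits_upto k limit_bit w = t]) = mu t.
  rewrite -(uniform_digits mu_nil mu_ge0 mu_rcons) size_tuple.
  congr (fine (uniform_prob _ _)); apply/seteqP; split => w /= <-.
    apply: (@eq_from_nth _ false) => [|i]; rewrite size_digits ?size_mkseq// => ik.
    by rewrite nth_mkseq// nth_digits.
  apply: (@eq_from_nth _ false) => [|i]; rewrite size_mkseq ?size_digits// => ik.
  by rewrite nth_mkseq// nth_digits.
by have := @mu_cvg t; rewrite /cell size_tuple.
Qed.

End limit_of_bits.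

(* h depends on the coordinates listed in s only, in a Lipschitz way. *)
Definition fdlip {R : realType} {I : Type} (s : seq I) (L M : R)
    (h : (I -> R) -> R) :=
  [/\ 0 <= L, forall x y, `|h x - h y| <= L * \sum_(i <- s) `|x i - y i|
    & forall x, `|h x| <= M].

Lemma fdlip_agree {R : realType} {I : eqType} (s : seq I) (L M : R) h x y :
  fdlip s L M h -> {in s, x =1 y} -> h x = h y.
Proof.
move=> [L0 hL _] xy; apply/eqP; rewrite -subr_eq0 -normr_le0.
apply: le_trans (hL x y) _; rewrite big_seq big1 ?mulr0// => i si.
by rewrite xy// subrr normr0.
Qed.

Lemma fdlip_close {R : realType} {I : eqType} (s : seq I) (L M e : R) h x y :
  fdlip s L M h -> {in s, forall i, `|x i - y i| <= e} ->
  `|h x - h y| <= L * (e *+ size s).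
Proof.
move=> [L0 hL _] xy; apply: le_trans (hL x y) _; rewrite ler_wpM2l//.
rewrite -sum1_size -sumrMnr big_seq [leRHS]big_seq; apply: ler_sum => i si.
by rewrite mulr1n xy.
Qed.

(** * Coding real vectors by bits *)

Section quantization.
Context {R : realType} {I : countType}.

Lemma count_lt_bounds (z : R) (N : nat) : 0 <= z ->
  Num.min z N%:R <= \sum_(c < N) ((c%:R < z)%R)%:R <= z + 1.
Proof.
(* The third bound serves the induction: when the threshold N is passed, S <= N < z gives the upper
   bound for S + 1. *)
move=> z0; suff : [/\ Num.min z N%:R <= \sum_(c < N) ((c%:R < z)%R)%:R,
    \sum_(c < N) ((c%:R < z)%R)%:R <= z + 1 &
    \sum_(c < N) ((c%:R < z)%R)%:R <= N%:R :> R] by case=> -> ->.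
elim: N => [|N [IH1 IH2 IH3]].
  by rewrite big_ord0; split => //; [rewrite ge_min lexx orbT|lra].
rewrite big_ord_recr /= -natr1.
move: IH1; set S := \sum_(c < N) _; rewrite -/S in IH2 IH3 *.
rewrite !ge_min; have [Nz|zN] := ltP N%:R z => /orP[] h /=.
- by split; [apply/orP; right|..]; lra.
- by split; [apply/orP; right|..]; lra.
- by split; [apply/orP; left|..]; lra.
- by split; [apply/orP; left|..]; lra.
Qed.

(** Bit (i, l, c) compares x i with point c of the grid of step 2^(-l) starting at -2^l. Through
    pickling, a single bit sequence carries all coordinates at all precisions. *)
Definition level_bit (x : I -> R) (j : nat) : bool :=
  if unpickle j is Some (i, l, c) then c%:R / 2 ^+ l - 2 ^+ l < x i else false.

(** Counts the thresholds passed; 2 * 4^l steps of length 2^(-l) cover [-2^l, 2^l]. It is defined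
    for every bit sequence, since the limit bits need not code a vector. *)
Definition quant (l : nat) (B : nat -> bool) (i : I) : R :=
  (\sum_(c < 2 * 4 ^ l) (B (pickle (i, l, nat_of_ord c)))%:R) / 2 ^+ l - 2 ^+ l.

Lemma quant_close (l : nat) (x : I -> R) (i : I) : `|x i| <= 2 ^+ l ->
  `|quant l (level_bit x) i - x i| <= 2^-1 ^+ l.
Proof.
move=> xl; pose t : R := 2 ^+ l; have t0 : 0 < t by rewrite exprn_gt0.
pose z := t * (x i + t).
have z0 : 0 <= z by move: xl; rewrite ler_norml -/t => /andP[? ?]; apply: mulr_ge0; lra.
have zN : z <= (2 * 4 ^ l)%:R.
  rewrite natrM natrX -[4%N]/(2 * 2)%N natrM exprMn -/t /z.
  by move: xl; rewrite ler_norml -/t => /andP[? ?]; nra.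
have := count_lt_bounds (2 * 4 ^ l) z0; rewrite min_l//.
have -> : \sum_(c < 2 * 4 ^ l) ((c%:R < z)%R)%:R =
    \sum_(c < 2 * 4 ^ l) (level_bit x (pickle (i, l, nat_of_ord c)))%:R :> R.
  apply: eq_bigr => c _; rewrite /level_bit pickleK -/t.
  by rewrite ltrBlDr ltr_pdivrMr// mulrC.
rewrite /quant exprVn -/t; set S := \sum_(c < _) _ => /andP[h1 h2].
have -> : S / t - t - x i = (S - z) / t by rewrite /z; field; rewrite gt_eqF.
rewrite ger0_norm; last by rewrite divr_ge0 ?subr_ge0// ltW.
by rewrite ler_pdivrMr// mulVf ?gt_eqF//; lra.
Qed.

(** Finitely many coordinates at one precision read finitely many bits, with a bound that does not
    depend on [B]; this brings [quant] within the scope of [cvg_expectR_bits]. *)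
Lemma quant_bits_upto (s : seq I) (l : nat) : exists k0, forall k, (k0 <= k)%N ->
  forall B i, i \in s ->
    quant l (seq_bits (bits_upto k (fun j (_ : unit) => B j) tt)) i = quant l B i.
Proof.
pose js := [seq pickle (i, l, c) | i <- s, c <- iota 0 (2 * 4 ^ l)].
exists (\max_(j <- js) j).+1 => k kk B i si; rewrite /quant; congr (_ / _ - _).
apply: eq_bigr => c _; rewrite /seq_bits /bits_upto nth_mkseq//.
apply: leq_trans kk; rewrite ltnS; apply: (@leq_bigmax_seq _ _ _ id) => //.
by apply/allpairsP; exists (i, nat_of_ord c); split => //=; rewrite mem_iota ltn_ord.
Qed.

Context {dO : measure_display} {O : measurableType dO}.
Variable Y : I -> O -> R.
Hypothesis mY : forall i, measurable_fun setT (Y i).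

Lemma measurable_level_bit j :
  measurable_fun setT (fun w => level_bit (fun i => Y i w) j).
Proof.
rewrite /level_bit; case: (unpickle j) => [[[i l] c]|]; last exact: measurable_cst.
by apply: measurable_fun_ltr => //; exact: measurable_cst.
Qed.

Lemma bmeas_quant s l L M h (B : nat -> O -> bool) : fdlip s L M h ->
  (forall j, measurable_fun setT (B j)) ->
  bmeas (fun w => h (quant l (fun j => B j w))).
Proof.
move=> fh mB; have [k kP] := quant_bits_upto s l.
have -> : (fun w => h (quant l (fun j => B j w))) =
    (fun w => h (quant l (seq_bits (bits_upto k B w)))).
  apply/funext => w; apply: (fdlip_agree fh) => i si.
  exact: esym (kP k (leqnn k) (fun j => B j w) i si).
exact: (bmeas_bits k (fun b => h (quant l b)) mB).
Qed.


(** Measurability comes from the Lipschitz bound: h is the pointwise limit of its values at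
    quantized vectors, which are functions of finitely many bits. *)
Lemma bmeas_fdlip s L M h : fdlip s L M h -> bmeas (fun w => h (fun i => Y i w)).
Proof.
move=> fh; have [L0 hL hM] := fh; split; last by exists M.
apply: (@measurable_fun_cvg _ _ _ _ (fun l w => h (quant l (level_bit (fun i => Y i w))))).
  by move=> l; have [] := bmeas_quant l fh measurable_level_bit.
move=> w _; apply/cvgrPdist_le => e e0.
have [l0 l0P] : exists l0, forall l, (l0 <= l)%N -> {in s, forall i, `|Y i w| <= 2 ^+ l}.
  exists (\max_(i <- s) archi_bound `|Y i w|) => l ll i si.
  apply: ltW; apply: upper_nthrootP; apply: leq_trans ll.
  by apply: (@leq_bigmax_seq _ _ _ (fun i => archi_bound `|Y i w|)).
have : \forall l \near \oo, L * (size s)%:R * 2^-1 ^+ l <= e.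
  have : L * (size s)%:R * 2^-1 ^+ l @[l --> \oo] --> (0 : R).
    rewrite -[X in _ --> X](mulr0 (L * (size s)%:R)); apply: cvgMr.
    by apply: cvg_expr; rewrite ger0_norm ?invr_ge0// invf_lt1// ltr1n.
  move/cvgrPdist_le => /(_ e e0); apply: filterS => l; rewrite sub0r normrN.
  by apply: le_trans; exact: ler_norm.
case=> l1 _ l1P; exists (maxn l0 l1) => // l /=; rewrite geq_max => /andP[l0l l1l].
rewrite distrC; apply: le_trans (l1P _ l1l); rewrite -mulrA mulr_natl.
apply: (fdlip_close fh) => i si.
by rewrite quant_close// l0P.
Qed.

End quantization.

Lemma markov_square {R : realType} {dO : measure_display} {O : measurableType dO}
    (P : probability O R) (Y : O -> R) (c : R) (l : nat) :
  measurable_fun setT Y -> (\int[P]_w (`|Y w| ^+ 2)%:E <= c%:E)%E ->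
  fine (P [set w | 2 ^+ l < `|Y w|]) <= c * 4^-1 ^+ l.
Proof.
move=> mY Yc; apply: le_trans (markov_power mY _ Yc) _; first by rewrite exprn_gt0.
have -> : (2 ^+ l) ^+ 2 = 4 ^+ l :> R.
  by rewrite -exprM mulnC exprM; congr (_ ^+ _); rewrite expr2 -natrM.
by rewrite exprVn.
Qed.

Lemma tail_bound {R : realType} {I : choiceType} {dO : measure_display} {O : measurableType dO}
    (P : probability O R) (Y : I -> O -> R) (C : I -> R) (s : seq I) (l : nat) :
  (forall i, measurable_fun setT (Y i)) ->
  (forall i, (\int[P]_w (`|Y i w| ^+ 2)%:E <= (C i)%:E)%E) ->
  fine (P (\bigcup_(i in [set` s]) [set w | 2 ^+ l < `|Y i w|])) <=
  (\sum_(i <- s) C i) * 4^-1 ^+ l.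
Proof.
move=> mY YC; rewrite bigcup_seq.
have mB i : measurable [set w | 2 ^+ l < `|Y i w|] by exact: measurable_gt_norm.
elim: s => [|i s IH]; first by rewrite !big_nil measure0 mul0r.
rewrite !big_cons mulrDl.
have mU : measurable (\big[setU/set0]_(j <- s) [set w | 2 ^+ l < `|Y j w|]).
  exact: bigsetU_measurable.
apply: le_trans (lerD (markov_square l (mY i) (YC i)) IH).
rewrite -fineD ?probability_fin_num//; apply: fine_le.
- by rewrite probability_fin_num//; exact: measurableU.
- by rewrite fin_numD !probability_fin_num.
- exact: measureU2.
Qed.

(** * Realization of the limit law *)

Section limit_object.
Context {R : realType} {I : countType} {dO : measure_display} {O : measurableType dO}.
Variables (P : probability O R) (U : set_system nat) (UU : UltraFilter U).
Variables (Y : nat -> I -> O -> R) (C : I -> R).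
Hypothesis mY : forall n i, measurable_fun setT (Y n i).
Hypothesis YC : forall n i, (\int[P]_w (`|Y n i w| ^+ 2)%:E <= (C i)%:E)%E.

Let T := measurableTypeR R.
Let Q : probability T R := uniform_prob (@ltr01 R).
Let bit n j w := level_bit (fun i => Y n i w) j.
Let mbit n j : measurable_fun setT (bit n j).
Proof. exact: measurable_level_bit. Qed.
Let lbit := limit_bit P U bit.
Let mlbit j : measurable_fun (setT : set T) (lbit j).
Proof. exact: measurable_limit_bit. Qed.
Let V l (i : I) (w : T) : R := quant l (fun j => lbit j w) i.

Let PU : ProperFilter U. Proof. exact: (@ultra_proper _ _ UU). Qed.

Let C0 i : 0 <= C i.
Proof.
rewrite -lee_fin; apply: le_trans (YC 0%N i).
by apply: integral_ge0 => w _; rewrite lee_fin exprn_ge0.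
Qed.

Let big n l i := [set w | 2 ^+ l < `|Y n i w|].

Let mbig n l i : measurable (big n l i).
Proof. by apply: measurable_gt_norm. Qed.

Let mV l i : measurable_fun setT (V l i).
Proof.
have [k kP] := quant_bits_upto (R := R) [:: i] l.
have -> : V l i = fun w => quant l (seq_bits (bits_upto k lbit w)) i.
  apply/funext => w; have := kP k (leqnn k) (fun j => lbit j w) i.
  by rewrite inE eqxx => /(_ isT) => ->.
by have [] := @bmeas_bits R _ T k lbit (fun b => quant l b i) mlbit.
Qed.

Let step l i : set T := [set w | 2 * 2^-1 ^+ l < `|V l.+1 i w - V l i w|].

Let mstep l i : measurable (step l i).
Proof. by apply: measurable_gt_norm; exact: measurable_funB. Qed.

(** The limit bits need not come from a real number, so consecutive quantizations are compared in
    probability. For [Y n] they differ by more than 2 * 2^(-l) only if |Y n i| > 2^l, which has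
    probability at most C i * 4^(-l); as finitely many bits are involved, the bound passes to the
    limit. *)
Let step_small l i : fine (Q (step l i)) <= C i * 4^-1 ^+ l.
Proof.
pose H (B : nat -> bool) : R :=
  ((2 * (2^-1 : R) ^+ l < `|quant l.+1 B i - quant l B i|)%R)%:R.
have [k1 k1P] := quant_bits_upto (R := R) [:: i] l.
have [k2 k2P] := quant_bits_upto (R := R) [:: i] l.+1.
pose k := maxn k1 k2.
have HE (S : Type) (c : nat -> S -> bool) w :
    H (seq_bits (bits_upto k c w)) = H (fun j => c j w).
  rewrite /H (k1P k (leq_maxl _ _) (fun j => c j w) i) ?inE//.
  by rewrite (k2P k (leq_maxr _ _) (fun j => c j w) i) ?inE.
rewrite -(expectR_indic Q (mstep l i)).
have -> : \1_(step l i) = (fun w => H (seq_bits (bits_upto k lbit w))).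
  apply/funext => w; rewrite HE indicE; congr (_%:R); congr nat_of_bool.
  by apply/idP/idP; rewrite inE.
apply: (cvgr_le_cst (@cvg_expectR_bits _ _ _ P U UU bit mbit k H)) => n.
apply: le_trans (markov_square l (mY n i) (YC n i)).
rewrite -(expectR_indic P (mbig n l i)); apply: le_expectR.
- exact: (bmeas_bits k H (mbit n)).
- exact: bmeas_indic.
move=> w; rewrite HE indicE /H ler_nat.
have [//|] := boolP (w \in _); first by case: ltP.
rewrite notin_setE/= => /negP; rewrite -leNgt => Yl.
rewrite ltNge [X in ~~ X](_ : _ = true)//.
have Yl1 : `|Y n i w| <= 2 ^+ l.+1 by rewrite (le_trans Yl)// exprS ler_peMl ?exprn_ge0// ler1n.
have c1 := @quant_close R I l (fun i => Y n i w) i Yl.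
have c2 := @quant_close R I l.+1 (fun i => Y n i w) i Yl1.
rewrite exprS in c2; have h : 0 <= (2^-1 : R) ^+ l by rewrite exprn_ge0.
rewrite -/(bit n) in c1 c2 *.
move: c1 c2; rewrite !ler_norml => /andP[? ?] /andP[? ?].
by apply/andP; split; lra.
Qed.

Let N i : set T := lim_sup_set (fun l => step l i).

Let mN i : measurable (N i).
Proof. by apply: bigcap_measurable => // k _; exact: bigcup_measurable. Qed.

Let QN i : Q (N i) = 0%E.
Proof.
apply: (@borel_cantelli_geometric R _ _ Q _ (C i) 4^-1) => //.
by rewrite invr_gt0 ltr0n/= invf_lt1// ltr1n.
Qed.

Let V_cvg i w : ~ N i w -> cvg (V l i w @[l --> \oo]).
Proof.
move=> Nw; have [l0 l0P] : exists l0, forall l, (l0 <= l)%N -> ~ step l i w.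
  apply: contrapT => H; apply: Nw => l0 _; apply: contrapT => H'.
  by apply: H; exists l0 => l ll sl; apply: H'; exists l.
have [|||lm Vlm _] := @geometric_cauchy_cvg R (fun l => V l i w) l0 2 2^-1.
- by [].
- by rewrite invr_gt0 ltr0n/= invf_lt1// ltr1n.
- by move=> l /l0P /negP; rewrite -leNgt.
by apply/cvg_ex; exists lm.
Qed.

(** The indicator makes the sequence converge at every point, which gives a measurable limit; [N i]
    is negligible. *)
Definition limit_var (i : I) (w : T) : R :=
  lim (V l i w * \1_(~` N i) w @[l --> \oo]).

Let limit_varP i w : V l i w * \1_(~` N i) w @[l --> \oo] --> limit_var i w.
Proof.
rewrite /limit_var indicE; have [Nw|Nw] := boolP (w \in ~` N i).
  under eq_fun do rewrite mulr1.
  by apply: V_cvg; move: Nw; rewrite inE.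
by under eq_fun do rewrite mulr0; exact: is_cvg_cst.
Qed.

Lemma measurable_limit_var i : measurable_fun setT (limit_var i).
Proof.
apply: (@measurable_fun_cvg _ _ _ _ (fun l w => V l i w * \1_(~` N i) w)).
  move=> l; apply: measurable_funM => //; apply: measurable_indic.
  exact: measurableC.
by move=> w _; exact: limit_varP.
Qed.

Let V_ae (s : seq I) : {ae Q, forall w, forall i, i \in s -> V l i w @[l --> \oo] --> limit_var i w}.
Proof.
elim: s => [|i s IH]; first by apply: aeW => w i; rewrite in_nil.
have : {ae Q, forall w, V l i w @[l --> \oo] --> limit_var i w}.
  exists (N i); split => // w /= H; apply: contrapT => Nw; apply: H.
  have := @limit_varP i w; rewrite indicE mem_set//.
  by under eq_fun do rewrite mulr1.
apply: filterS2 IH => w IH Vi j; rewrite inE => /predU1P[->//|].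
exact: IH.
Qed.

(** An exchange of limits: quantizing [Y n] at level l costs at most K * 2^(-l) uniformly in n, and
    at fixed l only finitely many bits are involved. *)
Lemma cvg_expectR_limit_var s L M h : fdlip s L M h ->
  expectR P (fun w => h (fun i => Y n i w)) @[n --> U] -->
  expectR Q (fun w => h (fun i => limit_var i w)).
Proof.
move=> fh; have [L0 hL hM] := fh.
have bh n := bmeas_fdlip (mY n) fh.
have EhM n : `|expectR P (fun w => h (fun i => Y n i w))| <= M.
  exact: normr_expectR_le_cst.
have cA := ultra_bounded_cvg UU EhM.
set A := lim _ in cA; suff <- : A = expectR Q (fun w => h (fun i => limit_var i w)) by [].
(* The first term pays for the quantization error, the second for the event that some coordinate
   exceeds 2^l. *)
pose K := L * (size s)%:R + 2 * M * \sum_(i <- s) C i.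
have close n l : `|expectR P (fun w => h (quant l (fun j => bit n j w))) -
    expectR P (fun w => h (fun i => Y n i w))| <= K * 2^-1 ^+ l.
  pose B := \bigcup_(i in [set` s]) big n l i.
  have mB : measurable B by apply: fin_bigcup_measurable => // i _; exact: mbig.
  have PB : fine (P B) <= (\sum_(i <- s) C i) * 4^-1 ^+ l.
      exact: (tail_bound s l (mY n) (YC n)).
  have M0 : 0 <= M by apply: le_trans (hM (fun=> 0)).
  have := @expectR_close _ _ _ P (fun w => h (quant l (fun j => bit n j w)))
    (fun w => h (fun i => Y n i w)) B (L * (2^-1 ^+ l *+ size s)) (2 * M)
    (bmeas_quant l fh (mbit n)) (bh n) mB.
  have -> : L * (2^-1 ^+ l *+ size s) = L * (size s)%:R * 2^-1 ^+ l.
    by rewrite -mulr_natl mulrA.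
  move=> /(_ _ _ _)/le_trans; apply.
  - by rewrite !mulr_ge0// exprn_ge0.
  - move=> w; apply: le_trans (ler_normB _ _) _; rewrite mulr2n mulrDl !mul1r.
    by rewrite lerD.
  - move=> w NB; rewrite -mulrA mulr_natl; apply: (fdlip_close fh) => i si.
    apply: quant_close; rewrite leNgt; apply/negP => H; apply: NB.
    by exists i.
  rewrite /K [leRHS]mulrDl; apply: lerD => //; rewrite -[leRHS]mulrA.
  apply: ler_wpM2l; first by rewrite mulr_ge0.
  apply: le_trans PB _; apply: ler_wpM2l; first exact: sumr_ge0.
  by rewrite lerXn2r ?nnegrE ?invr_ge0// lef_pV2 ?posrE// ler_nat.
have close' l : `|expectR Q (fun w => h (fun i => V l i w)) - A| <= K * 2^-1 ^+ l.
  have [k kP] := quant_bits_upto (R := R) s l.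
  have HE (S : Type) (c : nat -> S -> bool) w :
      h (quant l (seq_bits (bits_upto k c w))) = h (quant l (fun j => c j w)).
    by apply: (fdlip_agree fh) => i si; exact: (kP k (leqnn k) (fun j => c j w) i si).
  have := @cvg_expectR_bits _ _ _ P U UU bit mbit k (fun b => h (quant l b)).
  rewrite -/lbit; under [X in _ --> expectR _ X]eq_fun do rewrite HE.
  have -> : (fun n => expectR P (fun w => h (quant l (seq_bits (bits_upto k (bit n) w))))) =
      (fun n => expectR P (fun w => h (quant l (fun j => bit n j w)))).
    by apply/funext => n; congr expectR; apply/funext => w; rewrite HE.
  move=> c1; apply: (@cvgr_le_cst R nat U _
    (fun n => `|expectR P (fun w => h (quant l (fun j => bit n j w))) -
    expectR P (fun w => h (fun i => Y n i w))|)) => [|n]; last exact: close.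
  by apply: cvg_norm; apply: cvgB cA; exact: c1.
have c3 : expectR Q (fun w => h (fun i => V l i w)) @[l --> \oo] --> A.
  apply/cvgrPdist_le => e e0.
  have : K * 2^-1 ^+ l @[l --> \oo] --> (0 : R).
    rewrite -[X in _ --> X](mulr0 K); apply: cvgMr.
    by apply: cvg_expr; rewrite ger0_norm ?invr_ge0// invf_lt1// ltr1n.
  move/cvgrPdist_le => /(_ e e0); apply: filterS => l; rewrite sub0r normrN => Kl.
  by rewrite distrC (le_trans (close' l))// (le_trans (ler_norm _)).
apply: cvg_unique c3 _ => //.
apply: (@expectR_cvg R _ _ Q _ _ M).
- by move=> l; have [] := bmeas_quant l fh mlbit.
- by have [] := bmeas_fdlip measurable_limit_var fh.
- by move=> l w; exact: hM.
apply: filterS (V_ae s) => w Vw; apply/cvgrPdist_le => e e0.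
(* Convergence is known for i in [s] only, while [cvg_rsum] asks for every index; outside [s] the
   sequence is replaced by its limit. *)
have : L * \sum_(i <- s) `|limit_var i w - (if i \in s then V l i w else limit_var i w)| @[l --> \oo] --> (0 : R).
  rewrite -[X in _ --> X](mulr0 L); apply: cvgMr.
  have S0 : \sum_(i <- s) `|limit_var i w - limit_var i w| = 0.
    by rewrite big1// => i _; rewrite subrr normr0.
  have := @cvg_rsum R nat \oo _ I s (fun i l =>
    `|limit_var i w - (if i \in s then V l i w else limit_var i w)|)
    (fun i => `|limit_var i w - limit_var i w|).
  rewrite S0; apply=> i; apply: cvg_norm; apply: cvgB; first exact: cvg_cst.
  by have [/Vw|_] := boolP (i \in s) => //; exact: cvg_cst.
move/cvgrPdist_le => /(_ e e0); apply: filterS => l; rewrite sub0r normrN => H.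
apply: le_trans (hL _ _) _; apply: le_trans (le_trans (ler_norm _) H).
by rewrite ler_wpM2l// big_seq [leRHS]big_seq; apply: ler_sum => i ->.
Qed.

End limit_object.

(** * Cramer-Wold *)

Section sine_bound.
Context {R : realType}.

Let mvt0 (f df : R -> R) (y : R) : (forall x : R, is_derive x 1 f (df x)) ->
  exists2 c, `|c| <= `|y| & f y - f 0 = df c * y.
Proof.
move=> fdf; have cf : continuous f.
  by move=> x; apply: differentiable_continuous; apply/derivable1_diffP; case: (fdf x).
have [y0|y0|->] := ltgtP y 0.
- have [|c] := @MVT R f df y 0 y0 (fun x _ => fdf x).
    exact: continuous_subspaceT.
  rewrite in_itv/= => /andP[yc c0] E; exists c.
    by rewrite !ltr0_norm// lerN2 ltW.
  by rewrite -opprB E sub0r mulrN opprK.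
- have [|c] := @MVT R f df 0 y y0 (fun x _ => fdf x).
    exact: continuous_subspaceT.
  rewrite in_itv/= => /andP[yc c0] E; exists c.
    by rewrite !gtr0_norm// ltW.
  by rewrite E subr0.
- by exists 0 => //; rewrite subrr mulr0.
Qed.

(** Used to replace y by sin(c y) / c, at a cost c y^2 that vanishes with c. *)
Lemma sin_sub_id_le (y : R) : `|sin y - y| <= y ^+ 2.
Proof.
have [c cy] := @mvt0 sin cos y (@is_derive_sin R).
rewrite sin0 subr0 => ->.
have [e ec] := @mvt0 cos (fun x => - sin x) c (@is_derive_cos R).
rewrite cos0 => E.
have -> : cos c * y - y = (cos c - 1) * y by rewrite mulrBl mul1r.
rewrite E !normrM normrN -[y ^+ 2]ger0_norm ?sqr_ge0// expr2 normrM.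
apply: ler_wpM2r => //; rewrite -[leRHS]mul1r.
by apply: ler_pM => //; exact: sin_max.
Qed.

End sine_bound.

Section random_walk_average.
Context {R : realType}.

(* bern N f u is the Bernstein sum \sum_k f k * C(N, k) u^k (1 - u)^(N - k):
   the average of f after N steps of a walk moving up with probability u. *)
Fixpoint bern (N : nat) (f : nat -> R) (u : R) : R :=
  if N is N'.+1 then u * bern N' (fun k => f k.+1) u + (1 - u) * bern N' f u
  else f 0%N.

Lemma bernD N f g u : bern N (fun k => f k + g k) u = bern N f u + bern N g u.
Proof. by elim: N f g => //= N IH f g; rewrite !IH; ring. Qed.

Lemma bernZ N c f u : bern N (fun k => c * f k) u = c * bern N f u.
Proof. by elim: N f => //= N IH f; rewrite !IH; ring. Qed.

Lemma bern_cst N c u : bern N (fun=> c) u = c.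
Proof. by elim: N => //= N ->; ring. Qed.

Lemma bern_id N u : bern N (fun k => k%:R) u = N%:R * u.
Proof.
elim: N => /= [|N IH]; first by rewrite mul0r.
under [X in bern N X]eq_fun do rewrite -natr1.
by rewrite bernD bern_cst IH -natr1; ring.
Qed.

Lemma bern_sqr N u : bern N (fun k => k%:R ^+ 2) u =
  N%:R * u * (1 - u) + N%:R ^+ 2 * u ^+ 2.
Proof.
elim: N => /= [|N IH]; first by rewrite expr0n /= !mul0r addr0.
have -> : (fun k => (k.+1%:R : R) ^+ 2) = (fun k => k%:R ^+ 2 + (2 * k%:R + 1)).
  by apply/funext => k; rewrite -natr1; ring.
by rewrite !bernD bernZ bern_cst bern_id IH -natr1; ring.
Qed.

Lemma le_bern N f g u : 0 <= u <= 1 -> (forall k, f k <= g k) ->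
  bern N f u <= bern N g u.
Proof.
move=> /andP[u0 u1]; elim: N f g => //= N IH f g fg.
by apply: lerD; apply: ler_wpM2l; rewrite ?subr_ge0// IH.
Qed.

Lemma bern_close N f g h u : 0 <= u <= 1 -> (forall k, `|f k - g k| <= h k) ->
  `|bern N f u - bern N g u| <= bern N h u.
Proof.
move=> u01 fgh.
have -> : bern N f u - bern N g u = bern N (fun k => f k + (-1) * g k) u.
  by rewrite bernD bernZ mulN1r.
rewrite ler_norml; apply/andP; split.
  have -> : - bern N h u = bern N (fun k => (-1) * h k) u by rewrite bernZ mulN1r.
  apply: le_bern => // k.
  by have := fgh k; rewrite ler_norml mulN1r mulN1r => /andP[].
by apply: le_bern => // k; rewrite mulN1r (le_trans (ler_norm _)).
Qed.

(** Bernstein's variance argument with N = d^2 steps and d = m + 1: |t| <= 1/d + d t^2 reduces the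
    error to the second moment of u - k/N, which is u(1 - u)/N. *)
Lemma bern_approx (f : R -> R) (L u : R) (m : nat) :
  0 <= L -> 0 <= u <= 1 -> (forall x y, `|f x - f y| <= L * `|x - y|) ->
  `|f u - bern (m.+1 ^ 2) (fun k => f (k%:R / (m.+1 ^ 2)%:R)) u| <= L * 2 / m.+1%:R.
Proof.
move=> L0 u01 fL; pose N := (m.+1 ^ 2)%N; rewrite -/N.
pose d : R := m.+1%:R; have d0 : 0 < d by rewrite ltr0n.
have NE : N%:R = d ^+ 2 :> R by rewrite natrX.
have N0 : N%:R != 0 :> R by rewrite NE gt_eqF// exprn_gt0.
rewrite -/d; clearbody d N.
rewrite -[X in X - _](bern_cst N _ u).
apply: le_trans (bern_close N u01 (h := fun k => L * (d^-1 + d * (u - k%:R / N%:R) ^+ 2)) _) _.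
  move=> k; apply: le_trans (fL _ _) _; apply: ler_wpM2l => //.
  set t := u - _.
  have : 0 <= d * (`|t| - d^-1 / 2) ^+ 2 by rewrite mulr_ge0 ?sqr_ge0 ?ltW.
  have -> : d * (`|t| - d^-1 / 2) ^+ 2 = d * t ^+ 2 - `|t| + d^-1 / 4.
    by rewrite -[t ^+ 2]real_normK ?num_real//; field; rewrite gt_eqF.
  have di : 0 < d^-1 by rewrite invr_gt0.
  by move: di (d * t ^+ 2) `|t|; move: d^-1 => di di0 a b ?; lra.
have -> : (fun k => L * (d^-1 + d * (u - k%:R / N%:R) ^+ 2)) =
   (fun k => (L * (d^-1 + d * u ^+ 2)) + ((- (L * d * u * 2 / N%:R)) * k%:R +
      (L * d / N%:R ^+ 2) * k%:R ^+ 2)).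
  by apply/funext => k; field; rewrite N0 gt_eqF.
rewrite !bernD !bernZ bern_cst bern_id bern_sqr NE.
have -> : L * (d^-1 + d * u ^+ 2) + (- (L * d * u * 2 / d ^+ 2) * (d ^+ 2 * u) +
    L * d / (d ^+ 2) ^+ 2 * (d ^+ 2 * u * (1 - u) + (d ^+ 2) ^+ 2 * u ^+ 2)) =
    L * (1 + u * (1 - u)) / d by field; rewrite gt_eqF.
apply: ler_wpM2r; first by rewrite invr_ge0 ltW.
apply: ler_wpM2l => //.
by move/andP: u01 => [? ?]; nra.
Qed.

End random_walk_average.

Section trigonometric_polynomials.
Context {R : realType} {I : eqType}.

Definition lincomb (t : seq (I * R)) (x : I -> R) := \sum_(p <- t) p.2 * x p.1.

(** Each generator depends on one linear combination of the coordinates, so a one-dimensional limit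
    theorem reaches its expectation; the addition formula makes the class stable under products. *)
Inductive trigpoly : ((I -> R) -> R) -> Prop :=
| Trig_cos t b : trigpoly (fun x => cos (lincomb t x + b))
| Trig_add f g : trigpoly f -> trigpoly g -> trigpoly (fun x => f x + g x)
| Trig_scale c f : trigpoly f -> trigpoly (fun x => c * f x).

Lemma trigpoly_cst c : trigpoly (fun=> c).
Proof.
have := Trig_scale c (Trig_cos [::] 0); congr trigpoly; apply/funext => x.
by rewrite /lincomb big_nil addr0 cos0 mulr1.
Qed.

Lemma trigpoly_sin c i : trigpoly (fun x => sin (c * x i)).
Proof.
have := Trig_cos [:: (i, c)] (- (pi / 2)); congr trigpoly; apply/funext => x.
by rewrite /lincomb big_seq1 /= cosBpihalf.
Qed.

Lemma trigpolyM f g : trigpoly f -> trigpoly g -> trigpoly (fun x => f x * g x).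
Proof.
move=> tf; elim: tf g => {f} [t b|f1 f2 _ IH1 _ IH2|c f _ IH] g tg.
- elim: tg => {g} [t' b'|g1 g2 _ IH1 _ IH2|c g _ IH].
  + have := Trig_scale 2^-1 (Trig_add (Trig_cos (t ++ t') (b + b'))
      (Trig_cos (t ++ [seq (p.1, - p.2) | p <- t']) (b - b'))).
    congr trigpoly; apply/funext => x.
    rewrite /lincomb !big_cat big_map /=.
    have -> : \sum_(p <- t') (- p.2) * x p.1 = - \sum_(p <- t') p.2 * x p.1.
      by rewrite -sumrN; apply: eq_bigr => p _; rewrite mulNr.
    rewrite addrACA [X in _ + cos X]addrACA -opprD.
    by rewrite cosB cosD; field.
  + have := Trig_add IH1 IH2; congr trigpoly; apply/funext => x.
    by rewrite mulrDr.
  + have := Trig_scale c IH; congr trigpoly; apply/funext => x.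
    by rewrite mulrCA.
- have := Trig_add (IH1 g tg) (IH2 g tg); congr trigpoly; apply/funext => x.
  by rewrite mulrDl.
- have := Trig_scale c (IH g tg); congr trigpoly; apply/funext => x.
  by rewrite mulrA.
Qed.

Lemma trigpoly_bern N (T : nat -> (I -> R) -> R) u :
  (forall k, trigpoly (T k)) -> trigpoly u ->
  trigpoly (fun x => bern N (fun k => T k x) (u x)).
Proof.
move=> tT tu; elim: N T tT => //= N IH T tT.
apply: Trig_add; apply: trigpolyM => //; last exact: IH.
  exact: (IH (fun k => T k.+1)).
by apply: Trig_add; [exact: trigpoly_cst|have := Trig_scale (-1) tu;
    congr trigpoly; apply/funext => x; rewrite mulN1r].
Qed.

(* One coordinate at a time, the function is replaced by its Bernstein
   polynomial in (1 + sin (c x_i)) / 2. *)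
Lemma trigpoly_approx (s s' : seq I) (L M c : R) g : 0 < c -> fdlip s L M g ->
  forall (e : R) (x0 : I -> R), 0 < e -> exists2 T, trigpoly T &
    forall x, `|g (fun i => if i \in s' then sin (c * x i) / c else x0 i) - T x| <= e.
Proof.
move=> c0 fg; have [L0 gL gM] := fg.
elim: s' => [|i s' IH] e x0 e0.
  exists (fun=> g x0); first exact: trigpoly_cst.
  move=> x; have -> : (fun i => if i \in [::] then sin (c * x i) / c else x0 i) = x0.
    by apply/funext => i; rewrite in_nil.
  by rewrite subrr normr0 ltW.
have [is'|is'] := boolP (i \in s').
  have [T tT TP] := IH e x0 e0; exists T => // x.
  have -> : (fun j => if j \in i :: s' then sin (c * x j) / c else x0 j) =
     (fun j => if j \in s' then sin (c * x j) / c else x0 j).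
    apply/funext => j; rewrite inE; case: eqVneq => //= ->.
    by rewrite is'.
  exact: TP.
(* A Lipschitz constant in v when coordinate i equals (2 v - 1) / c; the factor [size s] allows for
   i occurring throughout [s]. *)
pose K := L * (2 / c *+ size s).
have K0 : 0 <= K by rewrite mulr_ge0// mulrn_wge0// divr_ge0// ltW.
have [m mP] : exists m : nat, K * 2 / m.+1%:R <= e / 2.
  have x0' : 0 <= K * 2 / (e / 2).
    by apply: divr_ge0; [rewrite mulr_ge0|rewrite divr_ge0// ltW].
  have := archi_boundP x0'; set m := archi_bound _ => xm; exists m.
  have : K * 2 / (e / 2) <= m.+1%:R by apply: le_trans (ltW xm) _; rewrite ler_nat.
  by rewrite ler_pdivrMr ?divr_gt0// ler_pdivrMr ?ltr0n// [X in _ -> _ <= X]mulrC.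
pose N := (m.+1 ^ 2)%N.
(* Coordinate i is frozen at the value attached to the Bernstein node k/N, and the induction
   hypothesis is applied at each node. *)
pose x1 k j := if j == i then (2 * (k%:R / N%:R) - 1) / c else x0 j.
have e2 : 0 < e / 2 by rewrite divr_gt0.
have /choice[T TP] k : exists T, trigpoly T /\
    forall x, `|g (fun j => if j \in s' then sin (c * x j) / c else x1 k j) - T x| <= e / 2.
  by have [T tT TP] := IH (e / 2) (x1 k) e2; exists T.
pose u x := 2^-1 * (1 + sin (c * x i)) : R.
exists (fun x => bern N (fun k => T k x) (u x)).
  apply: trigpoly_bern => [k|]; first by have [] := TP k.
  by apply: Trig_scale; apply: Trig_add; [exact: trigpoly_cst|exact: trigpoly_sin].
move=> x; have u01 : 0 <= u x <= 1.
  by have := sin_max (c * x i); rewrite ler_norml /u => /andP[? ?]; apply/andP; split; lra.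
pose f v := g (fun j => if j == i then (2 * v - 1) / c else
   if j \in s' then sin (c * x j) / c else x0 j).
have fK v w : `|f v - f w| <= K * `|v - w|.
  have -> : K * `|v - w| = L * (2 / c * `|v - w| *+ size s).
    by rewrite /K -[LHS]mulrA (mulrnAl (2 / c)) .
  apply: (fdlip_close fg) => j _; case: eqVneq => _; last by rewrite subrr normr0 mulr_ge0// divr_ge0// ltW.
  have -> : (2 * v - 1) / c - (2 * w - 1) / c = 2 / c * (v - w) by field; rewrite gt_eqF.
  by rewrite normrM ger0_norm// divr_ge0// ltW.
have -> : g (fun j => if j \in i :: s' then sin (c * x j) / c else x0 j) = f (u x).
  congr g; apply/funext => j; rewrite inE; case: eqVneq => //= ->.
  by rewrite /u; field; rewrite gt_eqF.
have fN k : f (k%:R / N%:R) = g (fun j => if j \in s' then sin (c * x j) / c else x1 k j).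
  by congr g; apply/funext => j; rewrite /x1; case: eqVneq => // ->; rewrite (negbTE is').
rewrite (splitr e); apply: le_trans (ler_distD (bern N (fun k => f (k%:R / N%:R)) (u x)) _ _) _.
apply: lerD; first by apply: le_trans mP; exact: bern_approx.
rewrite -[leRHS](bern_cst N _ (u x)); apply: bern_close => // k.
by rewrite fN; have [_] := TP k.
Qed.

End trigonometric_polynomials.

Section cramer_wold.
Context {R : realType} {I : countType} {dO : measure_display} {O : measurableType dO}.
Variables (P : probability O R) (Y : nat -> I -> O -> R) (C : I -> R).
Hypothesis mY : forall n i, measurable_fun setT (Y n i).
Hypothesis YC : forall n i, (\int[P]_w (`|Y n i w| ^+ 2)%:E <= (C i)%:E)%E.
Hypothesis Ycos : forall t b,
  cvg (expectR P (fun w => cos (lincomb t (fun i => Y n i w) + b)) @[n --> \oo]).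

Lemma bmeas_trigpoly n T : trigpoly T -> bmeas (fun w => T (fun i => Y n i w)).
Proof.
elim=> [t b|f g _ ? _ ?|c f _ ?]; last 2 first.
- exact: bmeasD.
- exact: bmeasZ.
split; last by exists 1 => w; exact: cos_max.
have mc : measurable_fun setT (@cos R).
  by apply: continuous_measurable_fun => x; exact: continuous_cos.
apply: (measurableT_comp mc); apply: measurable_funD; last exact: measurable_cst.
by apply: measurable_sum => p; apply: measurable_funM.
Qed.

Lemma cvg_expectR_trigpoly T : trigpoly T ->
  cvg (expectR P (fun w => T (fun i => Y n i w)) @[n --> \oo]).
Proof.
elim=> [t b|f g tf cf tg cg|c f tf cf]; first exact: Ycos.
- have -> : (fun n => expectR P (fun w => f (fun i => Y n i w) + g (fun i => Y n i w))) =
     (fun n => expectR P (fun w => f (fun i => Y n i w)) + expectR P (fun w => g (fun i => Y n i w))).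
    by apply/funext => n; rewrite expectRD//; exact: bmeas_trigpoly.
  exact: is_cvgD.
- have -> : (fun n => expectR P (fun w => c * f (fun i => Y n i w))) =
     (fun n => c * expectR P (fun w => f (fun i => Y n i w))).
    by apply/funext => n; rewrite expectRZ//; exact: bmeas_trigpoly.
  by apply: is_cvgM => //; exact: is_cvg_cst.
Qed.

(** Second moments confine the coordinates of [s] to |y| <= 2^l up to a small probability; there y
    is close to sin(c y) / c for small c. The function of these sines is within e1 of a
    trigonometric polynomial everywhere, so expectations of h form a Cauchy sequence. *)
Lemma cramer_wold s L M h : fdlip s L M h ->
  cvg (expectR P (fun w => h (fun i => Y n i w)) @[n --> \oo]).
Proof.
move=> fh; have [L0 hL hM] := fh.
have M0 : 0 <= M by apply: le_trans (hM (fun=> 0)).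
have C0 i : 0 <= C i.
  rewrite -lee_fin; apply: le_trans (YC 0%N i).
  by apply: integral_ge0 => w _; rewrite lee_fin exprn_ge0.
have bh n := bmeas_fdlip (mY n) fh.
apply: cauchy_cvg; apply/cauchy_exP => e e0.
(* Expectations of h and T will differ by at most 4 e1, and those of T by e1 from their limit: 10 e1
   in all, below e. *)
have [e1 e1E] : exists e1, e1 = e / 16 by exists (e / 16).
have e10 : 0 < e1 by rewrite e1E divr_gt0.
have [l lP] : exists l, 2 * M * ((\sum_(i <- s) C i) * 4^-1 ^+ l) <= e1.
  have : (2 * M * \sum_(i <- s) C i) * 4^-1 ^+ l @[l --> \oo] --> (0 : R).
    rewrite -[X in _ --> X](mulr0 (2 * M * \sum_(i <- s) C i)); apply: cvgMr.
    by apply: cvg_expr; rewrite ger0_norm ?invr_ge0// invf_lt1// ltr1n.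
  move/cvgrPdist_le => /(_ e1 e10) [l _ lP]; exists l; rewrite mulrA.
  by have := lP l (leqnn l); rewrite sub0r normrN; apply: le_trans; exact: ler_norm.
(* With c = e1 / K, replacing y by sin(c y) / c changes h by at most e1 when |y| <= 2^l; the added 1
   keeps K positive. *)
have [K KE] : exists K, K = L * (4 ^+ l *+ size s) + 1.
  by exists (L * (4 ^+ l *+ size s) + 1).
have K0 : 0 < K by rewrite KE ltr_wpDl// mulr_ge0// mulrn_wge0// exprn_ge0.
have [c cE] : exists c, c = e1 / K by exists (e1 / K).
have c0 : 0 < c by rewrite cE divr_gt0.
have [T tT TP] := trigpoly_approx s c0 fh (fun=> 0) e10.
have bT n := bmeas_trigpoly n tT.
pose hc x := h (fun i => if i \in s then sin (c * x i) / c else 0).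
have close n : `|expectR P (fun w => h (fun i => Y n i w)) -
    expectR P (fun w => T (fun i => Y n i w))| <= 4 * e1.
  pose B := \bigcup_(i in [set` s]) [set w | 2 ^+ l < `|Y n i w|].
  have mB : measurable B.
    by apply: fin_bigcup_measurable => // i _; exact: measurable_gt_norm.
  have hT x : `|h x - T x| <= 2 * M + e1.
    apply: le_trans (ler_distD (hc x) _ _) _; apply: lerD; last exact: TP.
    apply: le_trans (ler_normB _ _) _; rewrite mulr2n mulrDl !mul1r.
    by apply: lerD; exact: hM.
  have := @expectR_close _ _ _ P _ _ B (e1 + e1) (2 * M + e1) (bh n) (bT n) mB.
  move=> /(_ _ _ _)/le_trans; apply.
  - by rewrite addr_ge0// ltW.
  - by move=> w; exact: hT.
  - move=> w Bw; apply: le_trans (ler_distD (hc (fun i => Y n i w)) _ _) _.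
    apply: lerD; last exact: TP.
    apply: (@le_trans _ _ (L * (c * 4 ^+ l *+ size s))).
      apply: (fdlip_close fh) => i si; rewrite si distrC.
      have Yi : `|Y n i w| <= 2 ^+ l.
        by rewrite leNgt; apply/negP => H; apply: Bw; exists i.
      have -> : sin (c * Y n i w) / c - Y n i w =
        (sin (c * Y n i w) - c * Y n i w) / c by field; rewrite gt_eqF.
      rewrite normrM [X in _ * X]gtr0_norm ?invr_gt0// ler_pdivrMr//.
      apply: le_trans (sin_sub_id_le _) _.
      have -> : (c * Y n i w) ^+ 2 = c * c * Y n i w ^+ 2 by ring.
      have -> : c * 4 ^+ l * c = c * c * (2 ^+ l) ^+ 2.
        have -> : (2 ^+ l) ^+ 2 = 4 ^+ l :> R.
          by rewrite -exprM mulnC exprM; congr (_ ^+ _); rewrite expr2 -natrM.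
        by ring.
      apply: ler_wpM2l; first by rewrite mulr_ge0// ltW.
      by rewrite -[Y n i w ^+ 2]real_normK ?num_real// lerXn2r ?nnegrE// exprn_ge0.
    have -> : L * (c * 4 ^+ l *+ size s) = e1 * ((K - 1) / K).
      have -> : K - 1 = L * (4 ^+ l *+ size s) by rewrite KE addrK.
      by rewrite cE -(mulr_natr (4 ^+ l)) -(mulr_natr (e1 / K * 4 ^+ l)); field; exact: lt0r_neq0.
    by rewrite ler_piMr ?ltW// ltr_pdivrMr// mul1r ltrBlDr ltrDl.
  have := tail_bound s l (mY n) (YC n); rewrite -/B => PB.
  have PB1 : fine (P B) <= 1.
    by rewrite -lee_fin fineK ?probability_fin_num// probability_le1.
  have h1 : 2 * M * fine (P B) <= e1.
    by apply: le_trans lP; apply: ler_wpM2l => //; rewrite mulr_ge0.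
  have h2 : e1 * fine (P B) <= e1 by rewrite ler_piMr// ltW.
  by rewrite (mulrDl (2 * M)); lra.
have := cvg_expectR_trigpoly tT; set x := lim _.
move/cvgrPdist_lt => /(_ e1 e10)[N _ NP].
exists (expectR P (fun w => h (fun i => Y N i w))), N => // n /= Nn.
have := NP N (leqnn N); have := NP n Nn; have := close N; have := close n.
rewrite /ball /= !ler_norml !ltr_norml e1E => /andP[? ?] /andP[? ?] /andP[? ?] /andP[? ?].
by apply/andP; split; lra.
Qed.

End cramer_wold.

(** * Centered normal laws on the line *)

Definition blip {R : realType} (L M : R) (h : R -> R) :=
  [/\ 0 <= L, forall x y, `|h x - h y| <= L * `|x - y| & forall x, `|h x| <= M].

Lemma blip_continuous {R : realType} (L M : R) h : blip L M h -> continuous h.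
Proof.
move=> [L0 hL _] x; apply/cvgrPdist_lt => e e0.
have K0 : 0 < L + 1 by rewrite ltr_wpDl.
have d0 : 0 < e / (L + 1) by rewrite divr_gt0.
near=> y; apply: le_lt_trans (hL x y) _.
have : `|x - y| < e / (L + 1) by near: y; apply: (@cvgr_dist_lt _ _ _ (nbhs x) _ id).
rewrite ltr_pdivlMr// => h1; apply: le_lt_trans h1; rewrite mulrDr mulr1 mulrC.
by rewrite lerDl.
Unshelve. all: by end_near.
Qed.

Section probability_on_line.
Context {R : realType}.

Lemma probability_eq_cdf (P1 P2 : probability (measurableTypeR R) R) :
  (forall r, P1 `]-oo, r]%classic = P2 `]-oo, r]%classic) ->
  forall A : set R, measurable A -> P1 A = P2 A.
Proof.
move=> P12 A mA.
have Pab (P0 : probability (measurableTypeR R) R) (a b : R) : a <= b ->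
    P0 `]a, b]%classic = (P0 `]-oo, b]%classic - P0 `]-oo, a]%classic)%E.
  move=> ab; have -> : `]a, b]%classic = `]-oo, b]%classic `\` `]-oo, a]%classic.
    by rewrite -[RHS]setCK setCD setCitvl setUC -[LHS]setCK setCitv.
  rewrite measureD//= ?setIidr//; first exact: subset_itvl.
  by rewrite -ge0_fin_numE// fin_num_measure.
apply: (@measure_unique _ R (measurableTypeR R) (@ocitv R)
    (fun n => `](- n%:R), n%:R]%classic) _ _ _ _ P1 P2) => //.
- exact: ocitvI.
- by move=> n; exact: is_ocitv.
- apply/seteqP; split => // x _; exists (archi_bound `|x|) => //=.
  rewrite in_itv/=; have := archi_boundP (normr_ge0 x).
  by rewrite ltr_norml => /andP[-> /ltW].
- move=> _ [[a b] /= _ <-]; have [ab|ba] := leP a b.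
    by rewrite !Pab// !P12.
  by rewrite set_itv_ge ?measure0// bnd_simp -leNgt ltW.
- by move=> n; rewrite -ge0_fin_numE// fin_num_measure.
Qed.

End probability_on_line.

Section normal_expectations.
Context {R : realType}.
Local Notation leb := (@lebesgue_measure R).

Lemma integrable_bounded_normal (h : R -> R) M s : measurable_fun setT h ->
  (forall x, `|h x| <= M) ->
  leb.-integrable setT (fun x => (h x * normal_pdf 0 s x)%:E).
Proof.
move=> mh hM.
apply: (@le_integrable _ _ R leb setT measurableT _ (fun x => (M%:E * (normal_pdf 0 s x)%:E)%E)).
- apply/measurable_EFinP; apply: measurable_funM => //.
  exact: measurable_normal_pdf.
- move=> x _; rewrite -EFinM !abse_EFin lee_fin !normrM.
  by rewrite ler_wpM2r// (le_trans (hM x))// ler_norm.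
- by apply: integrableZl => //; exact: integrable_normal_pdf.
Qed.

Lemma normal_integralD (h : R -> R) M s c : measurable_fun setT h ->
  (forall x, `|h x| <= M) ->
  (\int[leb]_x ((h x + c) * normal_pdf 0 s x)%:E =
   \int[leb]_x (h x * normal_pdf 0 s x)%:E + c%:E)%E.
Proof.
move=> mh hM.
under eq_integral do rewrite mulrDl EFinD.
rewrite integralD//=.
- congr (_ + _)%E; under eq_integral do rewrite EFinM.
  rewrite integralZl//; last exact: integrable_normal_pdf.
  by rewrite integral_normal_pdf mule1.
- exact: integrable_bounded_normal hM.
- by apply: (@integrable_bounded_normal (fun=> c) `|c|) => //; exact: measurable_cst.
Qed.

Lemma normal_pdf_scale s z : 0 < s -> normal_pdf 0 s (s * z) * s = normal_pdf 0 1 z :> R.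
Proof.
move=> s0; rewrite !normal_pdfE ?gt_eqF// /normal_peak /normal_fun !subr0.
rewrite expr1n mul1r -mulrnAr sqrtrM ?sqr_ge0// sqrtr_sqr gtr0_norm//.
have -> : - (s * z) ^+ 2 / (s ^+ 2 *+ 2) = - z ^+ 2 / (1 *+ 2).
  by rewrite -[s ^+ 2 *+ 2]mulr_natr; field; rewrite gt_eqF.
rewrite invfM; set a := (Num.sqrt _)^-1; set b := expR _.
by field; rewrite gt_eqF.
Qed.

Lemma normal_integral_scale (h : R -> R) s : 0 < s -> continuous h ->
  (forall x, 0 <= h x) ->
  (\int[leb]_x (h x * normal_pdf 0 s x)%:E =
   \int[leb]_x (h (s * x) * normal_pdf 0 1 x)%:E)%E.
Proof.
move=> s0 ch h0; pose F (x : R) := s * x.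
have F' : F^`()%classic = cst s.
  apply/funext => x; rewrite /F derive1E deriveM// derive_cst derive_id.
  by rewrite scaler0 addr0; exact: mulr1.
rewrite (increasing_ge0_integration_by_substitutionT (F := F)
   (G := fun x => h x * normal_pdf 0 s x)).
- apply: eq_integral => x _; congr (_%:E).
  by rewrite F' /= !fctE -mulrA normal_pdf_scale.
- by move=> x y xy; rewrite /F ltr_pM2l.
- by rewrite F' => x; exact: cvg_cst.
- by rewrite F'; exact: is_cvg_cst.
- by rewrite F'; exact: is_cvg_cst.
- by move=> x; rewrite /F; exact: derivableM.
- by apply: (gt0_cvgMrNy s0); exact: cvg_id.
- by apply: (gt0_cvgMry s0); exact: cvg_id.
- move=> x; apply: cvgM; first exact: ch.
  by apply: continuous_normal_pdf; rewrite gt_eqF.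
- by move=> x; rewrite mulr_ge0// normal_pdf_ge0.
Qed.

(** Writing N(0, v) as the law of sqrt(v) Z puts all variances, 0 included, under one density, so
    that continuity in v follows by domination. *)
Lemma normal_expectE (v L M : R) h : 0 <= v -> blip L M h ->
  normal_expect v h = fine (\int[leb]_x (h (Num.sqrt v * x) * normal_pdf 0 1 x)%:E)%E.
Proof.
move=> v0 hh; have [L0 hL hM] := hh; rewrite /normal_expect; case: eqVneq => [->|vN0].
  rewrite sqrtr0; under eq_integral do rewrite mul0r EFinM.
  rewrite integralZl//; last exact: integrable_normal_pdf.
  by rewrite integral_normal_pdf mule1.
have s0 : 0 < Num.sqrt v by rewrite sqrtr_gt0 lt_def vN0.
have ch := blip_continuous hh.
have mh : measurable_fun setT h := continuous_measurable_fun ch.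
have mhs : measurable_fun setT (fun x => h (Num.sqrt v * x)).
  by apply: (measurableT_comp mh); apply: measurable_funM => //; exact: measurable_cst.
have cancel (a b : \bar R) : a \is a fin_num -> b \is a fin_num ->
    (a + M%:E = b + M%:E)%E -> fine a = fine b.
  by case: a b => [a||] [b||]// _ _ [] /addIr.
have f1 := integrable_fin_num measurableT (integrable_bounded_normal (Num.sqrt v) mh hM).
have f2 := integrable_fin_num measurableT (integrable_bounded_normal 1 mhs (fun x => hM _)).
(* The change of variables is for nonnegative integrands: M is added to h on both sides and
   cancelled. *)
apply: (cancel _ _ f1 f2).
rewrite -(normal_integralD (Num.sqrt v) _ mh hM).
rewrite -(normal_integralD 1 _ mhs (fun x => hM _)).
apply: (@normal_integral_scale (fun x => h x + M) _ s0).
- by move=> x; apply: cvgD; [exact: ch|exact: cvg_cst].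
- by move=> x; have := hM x; rewrite ler_norml -lerBlDr sub0r => /andP[].
Qed.

Lemma normal_expect_cvg (v : nat -> R) (v0 L M : R) h : (forall k, 0 <= v k) ->
  blip L M h -> v k @[k --> \oo] --> v0 ->
  normal_expect (v k) h @[k --> \oo] --> normal_expect v0 h.
Proof.
move=> v_ge0 hh vv0; have [L0 hL hM] := hh.
have v00 : 0 <= v0.
  rewrite -(cvg_lim (@Rhausdorff R) vv0); apply: limr_ge; first by apply/cvg_ex; exists v0.
  exact: nearW.
have mh : measurable_fun setT h := continuous_measurable_fun (blip_continuous hh).
rewrite (normal_expectE v00 hh).
under eq_fun do rewrite (normal_expectE (v_ge0 _) hh).
have mhs (s : R) : measurable_fun setT (fun x : R => h (s * x)).
  by apply: (measurableT_comp mh); apply: measurable_funM => //; exact: measurable_cst.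
apply: fine_cvg; rewrite fineK; last first.
  apply: (integrable_fin_num measurableT).
  exact: (integrable_bounded_normal 1 (mhs _) (fun x => hM _)).
have [|||||_ _] := @dominated_convergence _ _ _ leb _ measurableT
   (fun k x => (h (Num.sqrt (v k) * x) * normal_pdf 0 1 x)%:E)
   (fun x => (h (Num.sqrt v0 * x) * normal_pdf 0 1 x)%:E)
   (fun x => (M%:E * (normal_pdf 0 1 x)%:E)%E).
- by move=> k; exact: (measurable_int _ (integrable_bounded_normal 1 (mhs _) (fun x => hM _))).
- exact: (measurable_int _ (integrable_bounded_normal 1 (mhs _) (fun x => hM _))).
- apply: aeW => x _; apply: cvg_EFin; first exact: nearW.
  apply: cvgMl; apply: (@continuous_cvg _ _ _ _ _ _ h); first exact: blip_continuous hh _.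
  apply: cvgMl; apply: (@continuous_cvg _ _ _ _ _ _ Num.sqrt) => //.
  exact: sqrt_continuous.
- by apply: integrableZl => //; exact: integrable_normal_pdf.
- apply: aeW => x k _; rewrite -EFinM abse_EFin lee_fin normrM.
  by rewrite [X in _ * X]ger0_norm ?normal_pdf_ge0// ler_wpM2r// normal_pdf_ge0.
exact.
Qed.

(** The density is at most 1 / sqrt(v), so a large variance leaves little mass in [-K, K]. Read
    backwards, this bounds the variances of a tight sequence. *)
Lemma normal_expect_flat (v L M K : R) h : 0 < v -> 0 < K -> blip L M h ->
  (forall x, 0 <= h x <= 1) -> (forall x, K < `|x| -> h x = 0) ->
  normal_expect v h <= 2 * K / Num.sqrt v.
Proof.
move=> v0 K0 hh h01 hK; have [_ _ hM] := hh.
have mh : measurable_fun setT h := continuous_measurable_fun (blip_continuous hh).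
rewrite /normal_expect gt_eqF//; set s := Num.sqrt v.
have s0 : 0 < s by rewrite sqrtr_gt0.
rewrite -lee_fin fineK; last first.
  exact: (integrable_fin_num measurableT (integrable_bounded_normal s mh hM)).
apply: (@le_trans _ _ (\int[leb]_(x in `[(- K)%R, K]) (s^-1)%:E)%E); last first.
  rewrite integral_cst//= lebesgue_measure_itv/= lte_fin ifT; last lra.
  by rewrite -EFinB -EFinM lee_fin opprK (_ : s^-1 * (K + K) = 2 * K / s)//; ring.
rewrite [leRHS]integral_mkcond/=; apply: ge0_le_integral => //=.
- by move=> x _; rewrite lee_fin mulr_ge0 ?normal_pdf_ge0//; case/andP: (h01 x).
- exact: (measurable_int _ (integrable_bounded_normal s mh hM)).
- apply/(measurable_restrict _ _ _) => //; exact: measurable_cst.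
move=> x _; rewrite /patch; have [xK|xK] := boolP (x \in _); last first.
  rewrite hK ?mul0r// ltNge; apply/negP => H; move/negP: xK; apply.
  by rewrite inE/= in_itv/= -ler_norml.
rewrite lee_fin; have /andP[h0 h1] := h01 x.
apply: (@le_trans _ _ (normal_pdf 0 s x)).
  by rewrite ler_piMl// normal_pdf_ge0.
apply: le_trans (normal_pdf_ub _ _ _) _; first by rewrite gt_eqF.
rewrite /normal_peak lef_pV2 ?posrE ?sqrtr_gt0//; last first.
  by rewrite mulrn_wgt0// mulr_gt0 ?pi_gt0// exprn_gt0.
rewrite -[leLHS](gtr0_norm s0) -sqrtr_sqr ler_wsqrtr// -mulrnAr ler_peMr ?sqr_ge0//.
by have := pi_ge2 R; rewrite mulr2n; lra.
Qed.

End normal_expectations.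

Section normal_limit.
Context {R : realType} {dW : measure_display} {OW : measurableType dW}.
Variable Q : probability OW R.

(* Lipschitz approximation from above of the indicator of ]-oo, r]. *)
Definition ramp_down (k : nat) (r x : R) : R := Num.max 0 (Num.min 1 (1 - k%:R * (x - r))).

Lemma ramp_down_blip k r : blip k%:R 1 (ramp_down k r).
Proof.
split => // [x y|x]; last first.
  rewrite /ramp_down ger0_norm ?le_max ?lexx// ge_max ler01/=.
  by rewrite ge_min lexx.
have h1 (a b : R) : `|Num.max 0 a - Num.max 0 b| <= `|a - b|.
  by rewrite /Num.max; case: ltP => ?; case: ltP => ?; rewrite ?subrr ?normr0//;
    rewrite ler_norml; case: (ger0P (a - b)) => ?; apply/andP; split; lra.
have h2 (a b : R) : `|Num.min 1 a - Num.min 1 b| <= `|a - b|.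
  by rewrite /Num.min; case: ltP => ?; case: ltP => ?; rewrite ?subrr ?normr0//;
    rewrite ler_norml; case: (ger0P (a - b)) => ?; apply/andP; split; lra.
apply: le_trans (h1 _ _) _; apply: le_trans (h2 _ _) _.
have -> : 1 - k%:R * (x - r) - (1 - k%:R * (y - r)) = k%:R * (y - x) by ring.
by rewrite normrM ger0_norm// distrC.
Qed.

Lemma ramp_down_cvg r x : ramp_down k r x @[k --> \oo] --> (((x <= r)%R)%:R : R).
Proof.
have [xr|rx] := leP x r.
  have -> : ramp_down^~ r ^~ x = fun=> 1.
    apply/funext => k; rewrite /ramp_down min_l ?max_r//.
    have : 0 <= k%:R * (r - x) by rewrite mulr_ge0// subr_ge0.
    by lra.
  exact: cvg_cst.
have d0 : 0 < x - r by rewrite subr_gt0.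
apply: (@cvg_near_cst _ _ _ _ \oo); near=> k.
rewrite /ramp_down; have h : 1 - k%:R * (x - r) <= 0.
  rewrite subr_le0 -ler_pdivrMr// mul1r; near: k; exact: nbhs_infty_ger.
by rewrite min_r ?max_l// (le_trans h).
Unshelve. all: by end_near.
Qed.

(** Bounded Lipschitz functions determine the law: the functions [ramp_down k r] tend to the
    indicator of a half-line under both laws, which identifies the distribution functions. *)
Lemma normal_law_eq (S : OW -> R) (v : R) : 0 <= v -> measurable_fun setT S ->
  (forall L M h, blip L M h -> expectR Q (fun w => h (S w)) = normal_expect v h) ->
  forall A : set R, measurable A -> Q [set w | A (S w)] = normal_law v A.
Proof.
move=> v0 mS Eh A mA.
pose S' : {mfun OW >-> measurableTypeR R} :=
  HB.pack S (@isMeasurableFun.Build _ _ OW (measurableTypeR R) S mS).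
have [N NE] : exists N : probability (measurableTypeR R) R,
    forall B : set R, normal_law v B = N B.
  rewrite /normal_law; case: eqVneq => _.
    by exists (\d_(0 : measurableTypeR R)) => B; rewrite /= diracE.
  by exists (normal_prob 0 (Num.sqrt v)).
rewrite NE.
have -> : Q [set w | A (S w)] = distribution Q S' A by [].
apply: probability_eq_cdf => // r.
have mL : measurable [set w | S w <= r].
  have -> : [set w | S w <= r] = S @^-1` `]-oo, r]%classic.
    by apply/seteqP; split => w /=; rewrite in_itv.
  by rewrite -[X in measurable X]setTI; exact: (mS measurableT).
have l1 : expectR Q (fun w => ramp_down k r (S w)) @[k --> \oo] -->
    fine (Q [set w | S w <= r]).
  rewrite -(expectR_indic Q mL); apply: (@expectR_cvg R _ _ Q _ _ 1).
  - move=> k; apply: (measurableT_comp _ mS).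
    exact: continuous_measurable_fun (blip_continuous (ramp_down_blip k r)).
  - exact: measurable_indic.
  - by move=> k w; have [] := ramp_down_blip k r.
  - apply: aeW => w; have := @ramp_down_cvg r (S w); congr (_ --> _).
    by rewrite indicE; congr (_%:R); congr nat_of_bool; apply/idP/idP; rewrite inE.
have l2 : normal_expect v (ramp_down k r) @[k --> \oo] --> fine (N `]-oo, r]%classic).
  rewrite -NE /normal_law /normal_expect; case: (eqVneq v 0) => _.
    rewrite /=; have := @ramp_down_cvg r 0; congr (_ --> _).
    by congr (_%:R); congr nat_of_bool; apply/idP/idP; rewrite inE/= in_itv.
  rewrite /= /normal_prob integral_mkcond.
  apply: fine_cvg; rewrite fineK; last first.
    rewrite -integral_mkcond -/(normal_prob 0 (Num.sqrt v) `]-oo, r]%classic).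
    by rewrite fin_num_measure.
  have mramp k := continuous_measurable_fun (blip_continuous (ramp_down_blip k r)).
  have bramp k : forall x, `|ramp_down k r x| <= 1 by have [] := ramp_down_blip k r.
  have [|||||_ _] := @dominated_convergence _ _ _ (@lebesgue_measure R) _ measurableT
     (fun k x => (ramp_down k r x * normal_pdf 0 (Num.sqrt v) x)%:E)
     ((fun x => (normal_pdf 0 (Num.sqrt v) x)%:E) \_ `]-oo, r]%classic)
     (fun x => (normal_pdf 0 (Num.sqrt v) x)%:E).
  - by move=> k; exact: (measurable_int _ (integrable_bounded_normal _ (mramp k) (bramp k))).
  - have mI : measurable (`]-oo, r]%classic : set (measurableTypeR R)) by [].
    apply: (measurable_restrictT _ mI).1; apply: measurable_funTS.
    exact: (measurable_int _ (integrable_normal_pdf 0 (Num.sqrt v))).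
  - apply: aeW => x _; rewrite /patch.
    have := @ramp_down_cvg r x; rewrite (_ : (x <= r) = (x \in `]-oo, r]%classic)); last first.
      by apply/idP/idP; rewrite inE/= in_itv.
    move=> rx; rewrite (_ : (if _ then _ else _) =
        ((x \in `]-oo, r]%classic)%:R * normal_pdf 0 (Num.sqrt v) x)%:E); last first.
      by case: ifP; rewrite ?mul1r ?mul0r.
    by apply: cvg_EFin; [exact: nearW|apply: cvgMl].
  - exact: integrable_normal_pdf.
  - apply: aeW => x k _; rewrite abse_EFin lee_fin normrM.
    by rewrite [X in _ * X]ger0_norm ?normal_pdf_ge0// ler_piMl// normal_pdf_ge0.
  exact.
rewrite -[LHS]fineK ?fin_num_measure// -[RHS]fineK ?fin_num_measure//; congr (_%:E).
apply: (cvg_unique _ _ l2) => //.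
have -> : (fun k => normal_expect v (ramp_down k r)) =
    (fun k => expectR Q (fun w => ramp_down k r (S w))).
  by apply/funext => k; rewrite (Eh _ _ _ (ramp_down_blip k r)).
by move: l1; congr (_ --> fine (Q _)); apply/seteqP; split => w /=; rewrite in_itv.
Qed.

Definition hat (K x : R) : R := Num.max 0 (1 - `|x| / K).

Lemma hat_bounds K x : 0 < K -> 0 <= hat K x <= 1.
Proof.
move=> K0; rewrite /hat le_max lexx ge_max ler01 /= lerBlDr lerDl.
by rewrite divr_ge0// ltW.
Qed.

Lemma hat_blip K : 0 < K -> blip K^-1 1 (hat K).
Proof.
move=> K0; split => [|x y|x]; first by rewrite invr_ge0 ltW.
  have h1 (a b : R) : `|Num.max 0 a - Num.max 0 b| <= `|a - b|.
    by rewrite /Num.max; case: ltP => ?; case: ltP => ?; rewrite ?subrr ?normr0//;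
      rewrite ler_norml; case: (ger0P (a - b)) => ?; apply/andP; split; lra.
  apply: le_trans (h1 _ _) _.
  have -> : 1 - `|x| / K - (1 - `|y| / K) = K^-1 * (`|y| - `|x|) by ring.
  rewrite normrM gtr0_norm ?invr_gt0//; apply: ler_wpM2l.
    by rewrite invr_ge0 ltW.
  rewrite [leRHS]distrC.
  exact: ler_dist_dist.
by have /andP[h0 h1] := hat_bounds x K0; rewrite ger0_norm.
Qed.

Lemma hat_out K x : 0 < K -> K < `|x| -> hat K x = 0.
Proof.
move=> K0 Kx; rewrite /hat max_l// subr_le0 ler_pdivlMr// mul1r; exact: ltW.
Qed.

(** For K large the mean of [hat K] at [S0] exceeds 3/4, hence 1/2 at [S q] for large q, and
    [normal_expect_flat] bounds the variances. A subsequence of them converges, and its limit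
    identifies the law of [S0]. *)
Lemma normal_limit (S : nat -> OW -> R) (S0 : OW -> R) (v : nat -> R) :
  (forall q, measurable_fun setT (S q)) -> measurable_fun setT S0 ->
  (forall q, 0 <= v q) ->
  (forall q L M h, blip L M h -> expectR Q (fun w => h (S q w)) = normal_expect (v q) h) ->
  {ae Q, forall w, S q w @[q --> \oo] --> S0 w} ->
  exists2 v0, 0 <= v0 & forall A : set R, measurable A ->
    Q [set w | A (S0 w)] = normal_law v0 A.
Proof.
move=> mS mS0 v0 Eh SS0.
have mh L M h : blip L M h -> measurable_fun setT h.
  by move=> hh; exact: continuous_measurable_fun (blip_continuous hh).
have cvgE L M h : blip L M h ->
    expectR Q (fun w => h (S q w)) @[q --> \oo] --> expectR Q (fun w => h (S0 w)).
  move=> hh; apply: (@expectR_cvg R _ _ Q _ _ M).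
  - by move=> q; apply: (measurableT_comp _ (mS q)); exact: mh hh.
  - by apply: (measurableT_comp _ mS0); exact: mh hh.
  - by move=> q w; have [_ _] := hh; exact.
  - apply: filterS SS0 => w Sw.
    by apply: (@continuous_cvg _ _ _ _ _ _ h) => //; exact: blip_continuous hh _.
have hatn1 : expectR Q (fun w => hat n.+1%:R (S0 w)) @[n --> \oo] --> (1 : R).
  rewrite -[X in _ --> X](expectR_cst Q 1); apply: (@expectR_cvg R _ _ Q _ _ 1).
  - by move=> n; apply: (measurableT_comp _ mS0); apply: mh (hat_blip _); rewrite ltr0n.
  - exact: measurable_cst.
  - by move=> n w; have [|_ _] := @hat_blip n.+1%:R; [rewrite ltr0n|exact].
  apply: aeW => w; apply/cvgrPdist_le => e e0; near=> n.
  have n0 : 0 < n.+1%:R :> R by rewrite ltr0n.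
  have : `|S0 w| / n.+1%:R <= e.
    rewrite ler_pdivrMr// mulrC -ler_pdivrMr//.
    apply: (@le_trans _ _ n%:R); last by rewrite ler_nat.
    near: n; exact: nbhs_infty_ger.
  have t0 : 0 <= `|S0 w| / n.+1%:R by rewrite divr_ge0// ltW.
  rewrite /hat; move: (`|S0 w| / n.+1%:R) t0 => t t0 te.
  by rewrite /Num.max; case: ltP => h1; rewrite ger0_norm; lra.
have [n nP] : exists n, 3 / 4 < expectR Q (fun w => hat n.+1%:R (S0 w)).
  have e0 : (0 : R) < 1 / 4 by lra.
  move/cvgrPdist_lt : hatn1 => /(_ _ e0)[n _ nP]; exists n.
  by have := nP n (leqnn n); rewrite /= ltr_norml => /andP[? ?]; lra.
pose K : R := n.+1%:R; have K0 : 0 < K by rewrite ltr0n.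
have [q0 q0P] : exists q0, forall q, (q0 <= q)%N -> 1 / 2 < normal_expect (v q) (hat K).
  have e0 : (0 : R) < 1 / 4 by lra.
  move/cvgrPdist_lt : (cvgE _ _ _ (hat_blip K0)) => /(_ _ e0)[q0 _ qP]; exists q0 => q qq.
  have := qP q qq; rewrite /= (Eh _ _ _ _ (hat_blip K0)) ltr_norml => /andP[? ?].
  by rewrite -/K in nP; lra.
(* Obtained from 1/2 < 2 K / sqrt(v q). *)
have vb q : (q0 <= q)%N -> v q <= (4 * K) ^+ 2.
  move=> qq; have [vq0|vqN0] := eqVneq (v q) 0; first by rewrite vq0 sqr_ge0.
  have vq : 0 < v q by rewrite lt_def vqN0 v0.
  have sq : 0 < Num.sqrt (v q) by rewrite sqrtr_gt0.
  have := normal_expect_flat vq K0 (hat_blip K0) (fun x => hat_bounds x K0)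
    (fun x => hat_out K0).
  move/(lt_le_trans (q0P q qq)); rewrite ltr_pdivlMr// => h.
  rewrite -[v q]sqr_sqrtr// lerXn2r ?nnegrE ?ltW//; first by rewrite mulr_gt0.
  by lra.
have [f incf cf] : exists2 f, increasing_seq f & cvgn ((fun q => v (q0 + q)%N) \o f).
  apply: bolzano_weierstrass; exists ((4 * K) ^+ 2); split; first exact: num_real.
  by move=> x xK q _ /=; rewrite ger0_norm// (le_trans (vb _ (leq_addr _ _)))// ltW.
set vl := lim _ in cf.
have vl0 : 0 <= vl by apply: limr_ge => //; apply: nearW => k; exact: v0.
exists vl => //; apply: normal_law_eq => // L M h hh.
have fge k : (k <= f k)%N.
  elim: k => // k IH; apply: leq_ltn_trans IH _.
  by rewrite ltnNge; have := incf k.+1 k; rewrite leEnat ltnn => ->.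
have l1 := normal_expect_cvg (fun k => v0 (q0 + f k)%N) hh cf.
apply: (cvg_unique _ _ l1) => //.
have -> : (fun k => normal_expect (v (q0 + f k)%N) h) =
   (fun q => expectR Q (fun w => h (S q w))) \o (fun k => (q0 + f k)%N).
  by apply/funext => k; rewrite /= (Eh _ _ _ _ hh).
apply: cvg_comp (cvgE _ _ _ hh) => A [N _ NA]; exists N => // k /= Nk.
by apply: NA => /=; rewrite (leq_trans Nk)// (leq_trans (fge k))// leq_addl.
Unshelve. all: by end_near.
Qed.

End normal_limit.

(** * Marginals and quantiles *)

Section marginals.
Context {R : realType} {d : nat} {dO : measure_display} {O : measurableType dO}.
Variables (P : probability O R) (X : nat -> O -> 'I_d -> R).
Hypothesis mX : forall i k, measurable_fun setT (fun w => X i w k).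
Local Notation F := (dist_fun P X).

Definition below (k : 'I_d) (t : \bar R) : set O := [set w | ((X 0%N w k)%:E <= t)%E].

Definition marg (k : 'I_d) (t : \bar R) : R := fine (P (below k t)).

Lemma measurable_belowi i k t : measurable [set w | ((X i w k)%:E <= t)%E].
Proof.
have -> : [set w | ((X i w k)%:E <= t)%E] = (fun w => (X i w k)%:E) @^-1` `]-oo, t]%classic.
  by apply/seteqP; split => w /=; rewrite in_itv.
rewrite -[X in measurable X]setTI.
have mXi : measurable_fun setT (fun w => (X i w k)%:E) by exact/measurable_EFinP.
by apply: mXi => //; exact: emeasurable_itv.
Qed.

Lemma measurable_below_all i (t : 'I_d -> \bar R) :
  measurable [set w | forall k, ((X i w k)%:E <= t k)%E].
Proof.
rewrite (_ : [set w | _] =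
    \bigcap_(k in [set: 'I_d]) [set w | ((X i w k)%:E <= t k)%E]); last first.
  by apply/seteqP; split => w H k => [_|]; exact: H.
by apply: fin_bigcap_measurable => // k _; exact: measurable_belowi.
Qed.

Lemma measurable_below k t : measurable (below k t).
Proof. exact: measurable_belowi. Qed.

Lemma marg_ge0 k t : 0 <= marg k t. Proof. exact: fine_ge0. Qed.

Lemma marg_le1 k t : marg k t <= 1.
Proof.
rewrite -lee_fin fineK ?probability_fin_num//; last exact: measurable_below.
by apply: probability_le1; exact: measurable_below.
Qed.

Lemma le_marg k s t : (s <= t)%E -> marg k s <= marg k t.
Proof.
move=> st; apply: fine_probability_le; try exact: measurable_below.
by move=> w /= ws; exact: le_trans st.
Qed.

Lemma margNy k : marg k -oo%E = 0.
Proof.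
rewrite /marg (_ : below k -oo%E = set0) ?measure0//.
by apply/seteqP; split => w //=; rewrite leeNy_eq.
Qed.

Lemma margy k : marg k +oo%E = 1.
Proof.
rewrite /marg (_ : below k +oo%E = setT) ?probability_setT//.
by apply/seteqP; split => w //= _; exact: leey.
Qed.

Let Fsub (t s : 'I_d -> R) : `|F t - F s| <= 1.
Proof.
have F01 (u : 'I_d -> R) : 0 <= F u <= 1.
  rewrite /dist_fun fine_ge0//=.
  have mA : measurable [set w | forall k, X 0%N w k <= u k].
    have -> : [set w | forall k, X 0%N w k <= u k] =
        \bigcap_(k in [set: 'I_d]) below k (u k)%:E.
      apply/seteqP; split => w /=; first by move=> h k _; rewrite /below /= lee_fin.
      by move=> h k; rewrite -lee_fin; exact: h.
    by apply: fin_bigcap_measurable => // k _; exact: measurable_below.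
  rewrite -lee_fin fineK ?probability_fin_num//.
  exact: probability_le1.
have := F01 t; have := F01 s; rewrite ler_norml => /andP[? ?] /andP[? ?].
by apply/andP; split; lra.
Qed.

Lemma modulus_cont_ge (t s : 'I_d -> R) (y : R) : edistR t s <= y ->
  `|F t - F s| <= modulus_cont F y.
Proof.
move=> tsy; apply: ub_le_sup; last by exists t, s.
by exists 1 => _ [t' [s' [_ ->]]].
Qed.

(** The other coordinates are sent to infinity along n. The two points differ in coordinate k only,
    so their distance stays b - a and the modulus bounds each difference. *)
Lemma marg_diff_le k (a b : R) : a <= b ->
  marg k b%:E - marg k a%:E <= modulus_cont F (b - a).
Proof.
move=> ab.
pose tn (c : R) (n : nat) (j : 'I_d) : R := if j == k then c else n%:R.
pose A (c : R) (n : nat) := [set w | forall j, X 0%N w j <= tn c n j].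
have mA c n : measurable (A c n).
  have -> : A c n = \bigcap_(j in [set: 'I_d]) below j (tn c n j)%:E.
    apply/seteqP; split => w /=; first by move=> h j _; rewrite /below /= lee_fin.
    by move=> h j; rewrite -lee_fin; exact: h.
  by apply: fin_bigcap_measurable => // j _; exact: measurable_below.
have UA c : \bigcup_n A c n = below k c%:E.
  apply/seteqP; split => w /=.
    by move=> [n _ h]; have := h k; rewrite /tn eqxx /below /= lee_fin.
  rewrite /below /= lee_fin => wc.
  exists (\max_(j < d) archi_bound `|X 0%N w j|) => // j; rewrite /tn; case: eqVneq => [->//|_].
  apply: (@le_trans _ _ (archi_bound `|X 0%N w j|)%:R).
    by apply: le_trans (ler_norm _) _; exact/ltW/archi_boundP/normr_ge0.
  by rewrite ler_nat; exact: (leq_bigmax (F := fun j => archi_bound `|X 0%N w j|)).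
have cv c : F (tn c n) @[n --> \oo] --> marg k c%:E.
  apply: fine_cvg; rewrite fineK ?probability_fin_num//; last exact: measurable_below.
  rewrite -UA; apply: (nondecreasing_cvg_mu (mu := P) (F := A c)) => //.
    by rewrite UA; exact: measurable_below.
  move=> n m nm; apply/subsetPset => w h j; apply: le_trans (h j) _.
  by rewrite /tn; case: eqP => // _; rewrite ler_nat.
apply: (@cvgr_le_cst R nat \oo _ (fun n => F (tn b n) - F (tn a n))) => [|n].
  by apply: cvgB; exact: cv.
apply: le_trans (ler_norm _) _; apply: modulus_cont_ge.
rewrite /edistR (bigD1 k)//= big1 ?addr0 => [|j jk]; last first.
  by rewrite /tn (negbTE jk) subrr expr0n.
by rewrite /tn eqxx sqrtr_sqr ger0_norm// subr_ge0.
Qed.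

Hypothesis modulus0 : forall e : R, 0 < e -> exists2 y, 0 < y & modulus_cont F y <= e.

Lemma marg_cvg_y k (e : R) : 0 < e -> exists n : nat, 1 - e < marg k n%:R%:E.
Proof.
move=> e0.
have cv : marg k n%:R%:E @[n --> \oo] --> marg k +oo%E.
  apply: fine_cvg; rewrite fineK ?probability_fin_num//; last exact: measurable_below.
  have U : \bigcup_n below k n%:R%:E = below k +oo%E.
    apply/seteqP; split => w /=; first by rewrite /below /= leey.
    move=> _; exists (archi_bound `|X 0%N w k|) => //; rewrite /below /= lee_fin.
    by apply: le_trans (ler_norm _) _; exact/ltW/archi_boundP/normr_ge0.
  rewrite -U; apply: (nondecreasing_cvg_mu (mu := P) (F := fun n => below k n%:R%:E)).
  - by move=> n; exact: measurable_below.
  - by rewrite U; exact: measurable_below.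
  - move=> n m nm; apply/subsetPset => w /= h; apply: le_trans h _.
    by rewrite lee_fin ler_nat.
move: cv; rewrite margy => /cvgrPdist_lt/(_ e e0)[n _ nP]; exists n.
by have := nP n (leqnn n); rewrite /= ltr_norml => /andP[? ?]; lra.
Qed.

Lemma marg_cvg_Ny k (e : R) : 0 < e -> exists n : nat, marg k (- n%:R)%:E < e.
Proof.
move=> e0.
have cv : marg k (- n%:R)%:E @[n --> \oo] --> marg k -oo%E.
  apply: fine_cvg; rewrite fineK ?probability_fin_num//; last exact: measurable_below.
  have U : \bigcap_n below k (- n%:R)%:E = below k -oo%E.
    apply/seteqP; split => w /=; last by rewrite /below /= leeNy_eq.
    move=> h; pose N := archi_bound `|X 0%N w k|.
    have h1 : X 0%N w k <= - N%:R by have := h N I; rewrite /below /= lee_fin.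
    have := archi_boundP (normr_ge0 (X 0%N w k)); rewrite -/N ltr_norml => /andP[h2 _].
    by move: h2; rewrite ltNge h1.
  rewrite -U; apply: (nonincreasing_cvg_mu (mu := P) (F := fun n => below k (- n%:R)%:E)).
  - by rewrite -ge0_fin_numE// probability_fin_num//; exact: measurable_below.
  - by move=> n; exact: measurable_below.
  - by rewrite U; exact: measurable_below.
  - move=> n m nm; apply/subsetPset => w /= h; apply: le_trans h _.
    by rewrite lee_fin lerN2 ler_nat.
move: cv; rewrite margNy => /cvgrPdist_lt/(_ e e0)[n _ nP]; exists n.
by have := nP n (leqnn n); rewrite /= sub0r normrN; apply: le_lt_trans; exact: ler_norm.
Qed.

(** At a finite t the modulus of F is used; at +oo, continuity of the measure along the integers. *)
Lemma marg_left k (t : \bar R) (e : R) : 0 < e -> (t != -oo)%E ->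
  exists2 a, (a < t)%E & marg k t - marg k a < e.
Proof.
move=> e0; case: t => [t|//|//] _; last first.
  have [n nP] := marg_cvg_y k e0; exists n%:R%:E; first exact: ltry.
  by rewrite margy; lra.
have e2 : 0 < e / 2 by rewrite divr_gt0.
have [y y0 ye] := modulus0 e2; exists (t - y)%:E; first by rewrite lte_fin ltrBlDr ltrDl.
apply: (@le_lt_trans _ _ (e / 2)); last by lra.
apply: le_trans ye; have := @marg_diff_le k (t - y) t.
by rewrite (_ : t - (t - y) = y); [apply; rewrite lerBlDr lerDl ltW|ring].
Qed.

Lemma marg_right k (t : \bar R) (e : R) : 0 < e -> (t != +oo)%E ->
  exists2 b, (t < b)%E & marg k b - marg k t < e.
Proof.
move=> e0; case: t => [t|//|//] _; last first.
  have [n nP] := marg_cvg_Ny k e0; exists (- n%:R)%:E; first exact: ltNyr.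
  by rewrite margNy subr0.
have e2 : 0 < e / 2 by rewrite divr_gt0.
have [y y0 ye] := modulus0 e2; exists (t + y)%:E; first by rewrite lte_fin ltrDl.
apply: (@le_lt_trans _ _ (e / 2)); last by lra.
apply: le_trans ye; have := @marg_diff_le k t (t + y).
by rewrite (_ : t + y - t = y); [apply; rewrite lerDl ltW|ring].
Qed.

Lemma marg_continuous k t (e : R) : 0 < e -> exists2 delta : R, 0 < delta &
  forall s, `|contract s - contract t| < delta -> `|marg k s - marg k t| < e.
Proof.
move=> e0.
have [d1 d10 d1P] : exists2 d1 : R, 0 < d1 & forall s,
    contract t - contract s < d1 -> marg k t - marg k s < e.
  have [->|tN] := eqVneq t -oo%E.
    by exists 1 => // s _; rewrite margNy sub0r (le_lt_trans _ e0)// oppr_le0 marg_ge0.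
  have [a at_ ae] := marg_left k e0 tN.
  exists (contract t - contract a); first by rewrite subr_gt0 lt_contract.
  move=> s; rewrite ltrD2l ltrN2 lt_contract => a_s.
  by apply: le_lt_trans ae; rewrite lerD2l lerN2 le_marg// ltW.
have [d2 d20 d2P] : exists2 d2 : R, 0 < d2 & forall s,
    contract s - contract t < d2 -> marg k s - marg k t < e.
  have [->|tN] := eqVneq t +oo%E.
    by exists 1 => // s _; rewrite margy (le_lt_trans _ e0)// subr_le0 marg_le1.
  have [b tb be] := marg_right k e0 tN.
  exists (contract b - contract t); first by rewrite subr_gt0 lt_contract.
  move=> s; rewrite ltrD2r lt_contract => sb.
  by apply: le_lt_trans be; rewrite lerD2r le_marg// ltW.
exists (Num.min d1 d2); first by rewrite lt_min d10.
move=> s; rewrite !ltr_norml !lt_min => /andP[h1]; rewrite ltrNl opprB in h1.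
move: h1; rewrite lt_min => /andP[h1 _] /andP[_ h2]; apply/andP; split; last exact: d2P.
by rewrite ltrNl opprB d1P.
Qed.

Definition quantile (k : 'I_d) (u : R) : \bar R := ereal_inf [set t | u <= marg k t].

(** Equality holds up to the ends u = 0 and u = 1, because [marg] is continuous on the extended line
    and takes the values 0 and 1 at its ends. *)
Lemma marg_quantile k (u : R) : 0 <= u <= 1 -> marg k (quantile k u) = u.
Proof.
move=> /andP[u0 u1]; apply/eqP; rewrite eq_le; apply/andP; split.
  rewrite leNgt; apply/negP => H.
  have [E|N] := eqVneq (quantile k u) -oo%E.
    by move: H; rewrite E margNy ltNge u0.
  have e0 : 0 < marg k (quantile k u) - u by rewrite subr_gt0.
  have [a aq] := marg_left k e0 N; rewrite ltrD2l ltrN2 => ua.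
  have : (quantile k u <= a)%E by apply: ereal_inf_lbound; exact: ltW.
  by rewrite leNgt aq.
rewrite leNgt; apply/negP => H.
have [E|N] := eqVneq (quantile k u) +oo%E.
  by move: H; rewrite E margy ltNge u1.
have e0 : 0 < u - marg k (quantile k u) by rewrite subr_gt0.
have [b qb] := marg_right k e0 N; rewrite ltrD2r => ub.
have [t ut tb] := ereal_inf_lt qb.
by move: ub; rewrite ltNge => /negP; apply; apply: le_trans ut _; exact/le_marg/ltW.
Qed.

Lemma quantile_le k (u : R) t : 0 <= u <= 1 -> (quantile k u <= t)%E = (u <= marg k t).
Proof.
move=> u01; apply/idP/idP => [qt|ut]; last exact: ereal_inf_lbound.
by rewrite -(marg_quantile k u01) le_marg.
Qed.

Lemma quantile_fin_num k (u : R) : 0 < u < 1 -> quantile k u \is a fin_num.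
Proof.
move=> /andP[u0 u1]; have u01 : 0 <= u <= 1 by rewrite !ltW.
have := marg_quantile k u01; case: (quantile k u) => //.
  by rewrite margy => E; move: u1; rewrite -E ltxx.
by rewrite margNy => E; move: u0; rewrite -E ltxx.
Qed.

Lemma quantile_mono k (u v : R) : 0 <= u -> u < v -> v <= 1 ->
  (quantile k u < quantile k v)%E.
Proof.
move=> u0 uv v1; have uu : 0 <= u <= 1 by rewrite u0 (le_trans (ltW uv)).
have vv : 0 <= v <= 1 by rewrite v1 (le_trans u0 (ltW uv)).
by rewrite ltNge quantile_le// marg_quantile// -ltNge.
Qed.

End marginals.

Lemma ler_norm_prod_sub {R : realType} (I : Type) (s : seq I) (f g : I -> R) :
  (forall i, 0 <= f i <= 1) -> (forall i, 0 <= g i <= 1) ->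
  `|\prod_(i <- s) f i - \prod_(i <- s) g i| <= \sum_(i <- s) `|f i - g i|.
Proof.
move=> f01 g01.
have prod01 (h : I -> R) : (forall i, 0 <= h i <= 1) ->
    forall s, 0 <= \prod_(i <- s) h i <= 1.
  move=> h01; elim=> [|i s' /andP[p0 p1]]; first by rewrite big_nil ler01 lexx.
  have /andP[h0 h1] := h01 i.
  by rewrite big_cons mulr_ge0//= mulr_ile1.
elim: s => [|i s IH]; first by rewrite !big_nil subrr normr0.
rewrite !big_cons; set a := \prod_(j <- s) f j; set b := \prod_(j <- s) g j.
have -> : f i * a - g i * b = (f i - g i) * a + g i * (a - b) by ring.
apply: le_trans (ler_normD _ _) _; rewrite !normrM; apply: lerD.
  have /andP[a0 a1] := prod01 _ f01 s.
  by rewrite ler_piMr// ger0_norm.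
have /andP[g0 g1] := g01 i.
by apply: le_trans IH; rewrite ler_piMl// ger0_norm.
Qed.

Lemma coord_le_edistR {R : realType} (d : nat) (x y : 'I_d -> R) k :
  `|x k - y k| <= edistR x y.
Proof.
rewrite -sqrtr_sqr /edistR ler_wsqrtr// (bigD1 k)//= lerDl.
by apply: sumr_ge0 => j _; exact: sqr_ge0.
Qed.

(** * Hoelder ramps between quantiles *)

Section ramps.
Context {R : realType} {d : nat} {dO : measure_display} {O : measurableType dO}.
Variables (P : probability O R) (X : nat -> O -> 'I_d -> R).
Hypothesis mX : forall i k, measurable_fun setT (fun w => X i w k).
Local Notation F := (dist_fun P X).
Hypothesis modulus0 : forall e : R, 0 < e -> exists2 y, 0 < y & modulus_cont F y <= e.
Local Notation Q := (quantile P X).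

(** The quantile of level 1 may be finite; the points beyond it must still count, since [ramp] is
    constantly 1 when v is at least 1. *)
Definition upto (k : 'I_d) (u x : R) : bool := (1 <= u) || (x%:E <= Q k u)%E.

(* The Hoelder substitute for the indicator of a half-line: 1 up to the
   quantile of level u, 0 after the quantile of level v, and constant when one
   of these quantiles may be infinite. *)
Definition ramp (k : 'I_d) (u v x : R) : R :=
  if 1 <= v then 1 else if u <= 0 then 0 else
  Num.max 0 (Num.min 1 ((fine (Q k v) - x) / (fine (Q k v) - fine (Q k u)))).

Lemma ramp01 k u v x : 0 <= ramp k u v x <= 1.
Proof.
rewrite /ramp; case: ifP => _; first by rewrite ler01 lexx.
case: ifP => _; first by rewrite lexx ler01.
by rewrite le_max lexx ge_max ler01/= ge_min lexx.
Qed.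

Lemma upto_mono k u v x : 0 <= u -> u <= v -> upto k u x -> upto k v x.
Proof.
move=> u0 uv; rewrite /upto; have [//|v1] := leP 1 v.
rewrite leNgt (le_lt_trans uv v1)/= => xu; apply: le_trans xu _.
rewrite (quantile_le mX modulus0) ?u0 ?(le_trans uv (ltW v1))//.
by rewrite (marg_quantile mX modulus0)// (le_trans u0 uv) ltW.
Qed.

Lemma quantile_gap k u v : 0 < u -> u < v -> v < 1 ->
  0 < fine (Q k v) - fine (Q k u).
Proof.
move=> u0 uv v1; rewrite subr_gt0 -lte_fin.
have fu : Q k u \is a fin_num by rewrite (quantile_fin_num mX modulus0)// u0 (lt_trans uv).
have fv : Q k v \is a fin_num by rewrite (quantile_fin_num mX modulus0)// v1 (lt_trans u0).
by rewrite !fineK// (quantile_mono mX modulus0 k (ltW u0) uv (ltW v1)).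
Qed.

Lemma ramp_between k u v x : 0 <= u -> u < v -> v <= 1 ->
  ((upto k u x)%:R <= ramp k u v x <= (upto k v x)%:R).
Proof.
move=> u0 uv v1; have /andP[r0 r1] := ramp01 k u v x; rewrite /ramp /upto.
have [v1'|v1'] := leP 1 v; first by rewrite lexx andbT lern1 leq_b1.
have u1 : u < 1 by exact: lt_trans v1'.
rewrite (leNgt 1 u) u1/=.
have [u0'|u0'] := leP u 0.
  have -> : u = 0 by apply/eqP; rewrite eq_le u0' u0.
  rewrite ler0n andbT lern0 eqb0.
  have -> : Q k 0 = -oo%E.
    by apply/eqP; rewrite -leeNy_eq (quantile_le mX modulus0) ?lexx ?ler01// margNy.
  by rewrite leeNy_eq.
have gap := quantile_gap k u0' uv v1'.
have fu : Q k u \is a fin_num by rewrite (quantile_fin_num mX modulus0)// u0'.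
have fv : Q k v \is a fin_num by rewrite (quantile_fin_num mX modulus0)// v1' (lt_trans u0').
rewrite -{1}(fineK fu) -[X in _ && (_ <= (_ <= X)%E%:R)](fineK fv) !lee_fin.
apply/andP; split.
  have [xu|_] := leP x (fine (Q k u)); last by rewrite le_max lexx.
  rewrite min_l ?le_max ?lexx ?orbT//.
  by rewrite ler_pdivlMr// mul1r lerD2l lerN2.
have [xv|vx] := leP x (fine (Q k v)); first by rewrite ge_max ler01 ge_min lexx.
rewrite ge_max lexx ge_min orbC; apply/orP; left.
by rewrite ler_pdivrMr// mul0r subr_le0 ltW.
Qed.

(** Both ramps lie between the indicators of levels lo and hi, so the difference is controlled by a
    function whose mean is hi - lo. *)
Lemma ramp_close k lo hi u v u' v' x : 0 <= lo -> hi <= 1 ->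
  lo <= u -> u < v -> v <= hi -> lo <= u' -> u' < v' -> v' <= hi ->
  `|ramp k u v x - ramp k u' v' x| <= (upto k hi x)%:R - (upto k lo x)%:R.
Proof.
move=> lo0 hi1 lu uv vh lu' uv' vh'.
have /andP[a1 a2] := ramp_between k x (le_trans lo0 lu) uv (le_trans vh hi1).
have /andP[b1 b2] := ramp_between k x (le_trans lo0 lu') uv' (le_trans vh' hi1).
have mono s t : 0 <= s -> s <= t -> (upto k s x)%:R <= (upto k t x)%:R :> R.
  move=> s0 st; rewrite ler_nat; have := @upto_mono k s t x s0 st.
  by case: (upto k s x) => // ->.
have h1 := mono _ _ lo0 lu; have h2 := mono _ _ lo0 lu'.
have h3 := mono _ _ (ltW (le_lt_trans (le_trans lo0 lu) uv)) vh.
have h4 := mono _ _ (ltW (le_lt_trans (le_trans lo0 lu') uv')) vh'.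
by rewrite ler_norml; apply/andP; split; lra.
Qed.

Lemma measurable_upto i k u : measurable [set w | upto k u (X i w k)].
Proof.
rewrite /upto; have [u1|u1] := leP 1 u => /=.
  by rewrite (_ : [set _ | _] = setT)//; apply/seteqP; split.
exact: measurable_belowi.
Qed.

Lemma expect_upto k u : 0 <= u <= 1 ->
  expectR P (fun w => (upto k u (X 0%N w k))%:R) = u.
Proof.
move=> /andP[u0 u1].
have -> : (fun w => (upto k u (X 0%N w k))%:R) = \1_[set w | upto k u (X 0%N w k)] :> (O -> R).
  by apply/funext => w; rewrite indicE; congr (_%:R); congr nat_of_bool;
    apply/idP/idP; rewrite inE.
rewrite expectR_indic; last exact: measurable_upto.
rewrite /upto; have [u1'|u1'] := leP 1 u => /=.
  rewrite (_ : [set _ | _] = setT) ?probability_setT; last by apply/seteqP; split.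
  by apply/eqP; rewrite eq_le u1 u1'.
by rewrite -[RHS](marg_quantile mX modulus0 k (u := u))// u0.
Qed.

Lemma bmeas_upto i k u : bmeas (fun w => (upto k u (X i w k))%:R : R).
Proof.
have -> : (fun w => (upto k u (X i w k))%:R) = \1_[set w | upto k u (X i w k)] :> (O -> R).
  by apply/funext => w; rewrite indicE; congr (_%:R); congr nat_of_bool;
    apply/idP/idP; rewrite inE.
exact/bmeas_indic/measurable_upto.
Qed.

Let clip_lip (a b : R) :
  `|Num.max 0 (Num.min 1 a) - Num.max 0 (Num.min 1 b)| <= `|a - b|.
Proof.
have h1 (x y : R) : `|Num.max 0 x - Num.max 0 y| <= `|x - y|.
  by rewrite /Num.max; case: ltP => ?; case: ltP => ?; rewrite ?subrr ?normr0//;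
    rewrite ler_norml; case: (ger0P (x - y)) => ?; apply/andP; split; lra.
have h2 (x y : R) : `|Num.min 1 x - Num.min 1 y| <= `|x - y|.
  by rewrite /Num.min; case: ltP => ?; case: ltP => ?; rewrite ?subrr ?normr0//;
    rewrite ler_norml; case: (ger0P (x - y)) => ?; apply/andP; split; lra.
exact: le_trans (h1 _ _) (h2 _ _).
Qed.

Lemma ramp_lip k u v x y : 0 < u -> u < v -> v < 1 ->
  `|ramp k u v x - ramp k u v y| <= `|x - y| / (fine (Q k v) - fine (Q k u)).
Proof.
move=> u0 uv v1; rewrite /ramp (leNgt 1 v) v1 (leNgt u 0) u0 /=.
have gap := quantile_gap k u0 uv v1.
apply: le_trans (clip_lip _ _) _; rewrite -mulrBl normrM.
rewrite [X in _ * X]gtr0_norm ?invr_gt0//.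
by rewrite (_ : _ - x - (_ - y) = y - x) ?[`|y - x|]distrC//; ring.
Qed.

Lemma bmeas_ramp i k u v : u < v -> bmeas (fun w => ramp k u v (X i w k)).
Proof.
move=> uv; split; last first.
  by exists 1 => w; have /andP[r0 r1] := ramp01 k u v (X i w k); rewrite ger0_norm.
have [v1|v1] := leP 1 v.
  rewrite (_ : (fun w => _) = fun=> 1) ?measurable_cst//; last first.
    by apply/funext => w; rewrite /ramp v1.
have [u0|u0] := leP u 0.
  rewrite (_ : (fun w => _) = fun=> 0) ?measurable_cst//; last first.
    by apply/funext => w; rewrite /ramp (leNgt 1 v) v1 u0.
have gap := quantile_gap k u0 uv v1.
have rb : blip (fine (Q k v) - fine (Q k u))^-1 1 (ramp k u v).
  split; first by rewrite invr_ge0 ltW.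
    by move=> x y; rewrite mulrC; exact: ramp_lip.
  by move=> x; have /andP[r0 r1] := ramp01 k u v x; rewrite ger0_norm.
apply: (measurableT_comp (f := ramp k u v)) => //.
exact: continuous_measurable_fun (blip_continuous rb).
Qed.

Section hoelder.
Variable alpha : R.
Hypothesis alpha01 : 0 < alpha <= 1.

Definition ramp_const k u v : R :=
  if (1 <= v) || (u <= 0) then 0 else
  (fine (Q k v) - fine (Q k u)) `^ (- alpha).

(** A ramp over a gap g is 1/g-Lipschitz with values in [0, 1], and min(1, z) <= z^alpha. The
    constant g^(-alpha) is the form that [Phi] takes as argument in the bound on the modulus. *)
Lemma ramp_hoelder k u v x y : u < v ->
  `|ramp k u v x - ramp k u v y| <= ramp_const k u v * `|x - y| `^ alpha.
Proof.
move=> uv; have [a0 a1] := andP alpha01.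
rewrite /ramp_const; have [v1|v1] := leP 1 v => /=.
  by rewrite /ramp v1 subrr normr0 mul0r.
have [u0|u0] := leP u 0 => /=.
  by rewrite /ramp (leNgt 1 v) v1 u0 subrr normr0 mul0r.
have gap := quantile_gap k u0 uv v1; set g := fine _ - _ in gap *.
have [->|xy] := eqVneq x y; first by rewrite subrr normr0 mulr_ge0// powR_ge0.
have xy0 : 0 < `|x - y| by rewrite normr_gt0 subr_eq0.
have z0 : 0 < `|x - y| / g by rewrite divr_gt0.
have -> : g `^ (- alpha) * `|x - y| `^ alpha = (`|x - y| / g) `^ alpha.
  rewrite powRM ?invr_ge0 ?ltW// mulrC; congr (_ * _).
  by rewrite -[g^-1]powR_inv1 ?ltW// -powRrM mulN1r.
have [z1|z1] := leP (`|x - y| / g) 1.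
  apply: le_trans (ramp_lip k x y u0 uv v1) _; apply: ger1_powR => //.
  by rewrite z0.
apply: (@le_trans _ _ 1).
  have /andP[? ?] := ramp01 k u v x; have /andP[? ?] := ramp01 k u v y.
  by rewrite ler_norml; apply/andP; split; lra.
have <- : 1 `^ alpha = 1 :> R by rewrite powR1.
by apply: ge0_ler_powR; rewrite ?nnegrE ?ltW.
Qed.

Variables (Phi : R -> R) (beta gamma : R).
Hypothesis beta0 : 0 < beta.
Hypothesis gamma1 : 1 < gamma.
Hypothesis Phi_ge0 : forall x, 0 <= x -> 0 <= Phi x.
Hypothesis Phi_mono : forall x y, 0 <= x -> x <= y -> Phi x <= Phi y.
Hypothesis Phi_bij : forall y, 0 <= y -> exists! x, 0 <= x /\ Phi x = y.
Hypothesis modulus_Phi : forall y, 0 < y ->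
  modulus_cont F y <= beta * (Phi (y `^ (- alpha))) `^ (- gamma).

Lemma Phi_inj x y : 0 <= x -> 0 <= y -> Phi x = Phi y -> x = y.
Proof.
move=> x0 y0 xy; have [z [_ zU]] := Phi_bij (Phi_ge0 x0).
by rewrite -(zU x) // -(zU y).
Qed.

Lemma Phi_cancel_le x y : 0 <= x -> 0 <= y -> Phi x <= Phi y -> x <= y.
Proof.
move=> x0 y0 xy; rewrite leNgt; apply/negP => yx.
have E : Phi y = Phi x by apply/eqP; rewrite eq_le xy Phi_mono// ltW.
by move: yx; rewrite (Phi_inj y0 x0 E) ltxx.
Qed.

Lemma Phi_gt0 x : 0 < x -> 0 < Phi x.
Proof.
move=> x0; rewrite lt_def Phi_ge0 ?ltW// andbT; apply/eqP => E.
have P00 : Phi 0 = 0.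
  have := Phi_mono (lexx 0) (ltW x0); rewrite E => h.
  by apply/eqP; rewrite eq_le h Phi_ge0.
have x00 : x = 0 by apply: (Phi_inj (ltW x0)); rewrite ?E ?P00.
by rewrite x00 ltxx in x0.
Qed.

Lemma ramp_const_ge0 k u v : 0 <= ramp_const k u v.
Proof. by rewrite /ramp_const; case: ifP => // _; exact: powR_ge0. Qed.

(** Here the modulus enters: the gap g between the quantiles carries probability v - u, at most
    [modulus_cont F g], so [Phi] of the Hoelder constant is at most (beta / (v - u))^(1/gamma). B is
    where [Phi] takes this value for v - u = delta. *)
Lemma ramp_const_le k u v (delta B : R) : 0 <= u -> u < v -> v <= 1 ->
  0 < delta -> delta <= v - u -> 0 <= B ->
  Phi B = (beta / delta) `^ gamma^-1 -> ramp_const k u v <= B.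
Proof.
move=> u0 uv v1 de0 deuv B0 PB; apply: Phi_cancel_le => //; first exact: ramp_const_ge0.
have g0 : 0 < gamma by exact: lt_trans gamma1.
rewrite PB /ramp_const; have [v1'|v1'] := leP 1 v => /=.
  apply: le_trans (_ : Phi B <= _); last by rewrite PB.
  exact: Phi_mono.
have [u0'|u0'] := leP u 0 => /=.
  apply: le_trans (_ : Phi B <= _); last by rewrite PB.
  exact: Phi_mono.
have gap := quantile_gap k u0' uv v1'.
set g := fine _ - _ in gap *; set z := g `^ (- alpha).
have z0 : 0 < z by exact: powR_gt0.
have Pz := Phi_gt0 z0.
have h : v - u <= beta * Phi z `^ (- gamma).
  apply: le_trans (modulus_Phi gap).
  have := @marg_diff_le R d dO O P X mX k (fine (Q k u)) (fine (Q k v)).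
  rewrite !fineK ?(quantile_fin_num mX modulus0) ?u0' ?v1' ?(lt_trans u0' uv) ?(lt_trans uv v1')//.
  rewrite !(marg_quantile mX modulus0) ?u0 ?v1 ?(ltW (lt_trans u0' uv)) ?(ltW (lt_trans uv v1'))//.
  by apply; rewrite ltW// -subr_gt0.
have h2 : Phi z `^ gamma <= beta / delta.
  rewrite ler_pdivlMr// mulrC -ler_pdivlMr; last exact: powR_gt0.
  by rewrite -powRN (le_trans deuv).
have -> : Phi z = (Phi z `^ gamma) `^ gamma^-1.
  by rewrite -powRrM mulfV ?gt_eqF// powRr1// ltW.
apply: ge0_ler_powR => //; rewrite ?nnegrE ?powR_ge0 ?invr_ge0 ?ltW//.
by rewrite divr_gt0.
Qed.

End hoelder.

Definition phi (u v : 'I_d -> R) (x : 'I_d -> R) : R := \prod_k ramp k (u k) (v k) (x k).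

Lemma phi01 u v x : 0 <= phi u v x <= 1.
Proof.
rewrite /phi; elim/big_ind: _ => [|a b /andP[a0 a1] /andP[b0 b1]|k _].
- by rewrite ler01 lexx.
- by rewrite mulr_ge0//= mulr_ile1.
- exact: ramp01.
Qed.

Lemma bmeas_phi i u v : (forall k, u k < v k) -> bmeas (fun w => phi u v (X i w)).
Proof.
move=> uv; split.
  by apply: measurable_prod => k _; have [] := bmeas_ramp i k (uv k).
by exists 1 => w; have /andP[p0 p1] := phi01 u v (X i w); rewrite ger0_norm.
Qed.

Lemma phi_hoelder alpha u v x y : 0 < alpha <= 1 -> (forall k, u k < v k) ->
  `|phi u v x - phi u v y| <=
  (\sum_k ramp_const alpha k (u k) (v k)) * edistR x y `^ alpha.
Proof.
move=> a01 uv; have [a0 a1] := andP a01.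
apply: le_trans (ler_norm_prod_sub _ _ _) _ => [k|k|]; try exact: ramp01.
rewrite mulr_suml; apply: ler_sum => k _.
apply: le_trans (ramp_hoelder a01 _ _ _ (uv k)) _; apply: ler_wpM2l.
  exact: ramp_const_ge0.
apply: ge0_ler_powR; rewrite ?nnegrE//; first exact: ltW.
  exact: sqrtr_ge0.
exact: coord_le_edistR.
Qed.

Definition boxed (lo hi u v : 'I_d -> R) :=
  forall k, [/\ 0 <= lo k, hi k <= 1, lo k <= u k, u k < v k & v k <= hi k].

Lemma phi_close lo hi u v u' v' x : boxed lo hi u v -> boxed lo hi u' v' ->
  `|phi u v x - phi u' v' x| <= \sum_k ((upto k (hi k) (x k))%:R - (upto k (lo k) (x k))%:R).
Proof.
move=> b b'; apply: le_trans (ler_norm_prod_sub _ _ _) _ => [k|k|]; try exact: ramp01.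
apply: ler_sum => k _; have [? ? ? ? ?] := b k; have [? ? ? ? ?] := b' k.
exact: ramp_close.
Qed.

Lemma expect_phi_close lo hi u v u' v' : boxed lo hi u v -> boxed lo hi u' v' ->
  expectR P (fun w => `|phi u v (X 0%N w) - phi u' v' (X 0%N w)|) <= \sum_k (hi k - lo k).
Proof.
move=> b b'.
have lohi k : 0 <= lo k <= 1 /\ 0 <= hi k <= 1.
  have [l0 h1 lu uv vh] := b k.
  by split; apply/andP; split => //; lra.
apply: (@le_trans _ _ (expectR P (fun w => \sum_k ((upto k (hi k) (X 0%N w k))%:R - (upto k (lo k) (X 0%N w k))%:R)))).
  apply: le_expectR.
  - by apply/bmeas_norm/bmeasB; apply: bmeas_phi => k; [have [] := b k|have [] := b' k].
  - by apply: bmeas_sum => k; apply: bmeasB; exact: bmeas_upto.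
  - by move=> w; exact: phi_close.
rewrite expectR_sum; last by move=> k; apply: bmeasB; exact: bmeas_upto.
apply: ler_sum => k _; rewrite expectRB; [|exact: bmeas_upto..].
by have [l h] := lohi k; rewrite !expect_upto.
Qed.

End ramps.

(** * Moment bounds for the empirical process *)

Lemma sup_nonneg {R : realType} (S : set R) : (forall z, S z -> 0 <= z) -> 0 <= sup S.
Proof.
move=> S0; have [[[z Sz] ub]|nS] := pselect (has_sup S); last by rewrite sup_out.
by apply: le_trans (S0 _ Sz) _; exact: ub_le_sup.
Qed.

(** With a / 0 = 0 the case e = 0 is covered, so Hoelder quotients are bounded without discussing
    their denominators. *)
Lemma ler_div_junk {R : realFieldType} (a e Z : R) :
  0 <= Z -> 0 <= e -> a <= Z * e -> a / e <= Z.
Proof.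
move=> Z0 e0 h; have [->|eN] := eqVneq e 0; first by rewrite invr0 mulr0.
by rewrite ler_pdivrMr// lt_def eN.
Qed.

Lemma expr_powR_inv {R : realType} (s : R) (l i : nat) :
  (((2 ^+ l)^-1) `^ s) ^+ i = (2 `^ (- (i%:R * s))) ^+ l.
Proof.
have l0 : 0 <= 2 ^+ l :> R by rewrite exprn_ge0.
rewrite -(powR_mulrn i (powR_ge0 _ s)) -(powR_mulrn l (powR_ge0 _ _)).
rewrite -(powR_inv1 l0) -(powR_mulrn l (ler0n R 2)) -!powRrM; congr (_ `^ _); ring.
Qed.

Lemma powR_expr_powR {R : realType} (s k : R) (l : nat) :
  ((2 `^ s) ^+ l) `^ k = (2 `^ (k * s)) ^+ l.
Proof.
rewrite -(powR_mulrn l (powR_ge0 _ s)) -(powR_mulrn l (powR_ge0 _ _)) -!powRrM.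
by congr (_ `^ _); ring.
Qed.

Section moment_bounds.
Context {R : realType} {d : nat} {dO : measure_display} {O : measurableType dO}.
Variables (P : probability O R) (X : nat -> O -> 'I_d -> R).
Hypothesis mX : forall i k, measurable_fun setT (fun w => X i w k).
Variable alpha : R.
Hypothesis alpha01 : 0 < alpha <= 1.
Local Notation F := (dist_fun P X).

Definition emp (n : nat) (f : ('I_d -> R) -> R) (w : O) : R :=
  (Num.sqrt n%:R)^-1 *
  \sum_(1 <= i < n.+1) (f (X i w) - expectR P (fun w => f (X 0%N w))).

Lemma bmeas_emp n f : (forall i, bmeas (fun w => f (X i w))) -> bmeas (emp n f).
Proof.
move=> bf; apply: bmeasZ; apply: bmeas_sum => i.
by apply: bmeasB => //; exact: bmeas_cst.
Qed.

Lemma empB n f g w : bmeas (fun w => f (X 0%N w)) -> bmeas (fun w => g (X 0%N w)) ->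
  emp n (fun x => f x - g x) w = emp n f w - emp n g w.
Proof.
move=> bf bg; rewrite /emp expectRB// -mulrBr -sumrB; congr (_ * _).
by apply: eq_bigr => i _; ring.
Qed.

Lemma in_Hoelder_bound (f : ('I_d -> R) -> R) Z : (forall x, `|f x| <= 1) -> 0 <= Z ->
  (forall x y, `|f x - f y| <= Z * edistR x y `^ alpha) -> in_Holder alpha f.
Proof.
move=> f1 Z0 fZ; split; first by exists 1.
by exists Z => x y _; apply: ler_div_junk => //; exact: powR_ge0.
Qed.

Lemma sup_norm_le (f : ('I_d -> R) -> R) M : (forall x, `|f x| <= M) -> sup_norm f <= M.
Proof.
move=> fM; apply: ge_sup; first by exists `|f (fun=> 0)|, (fun=> 0).
by move=> _ [x _ <-].
Qed.

Lemma hoelder_norm_le (f : ('I_d -> R) -> R) M Z : (forall x, `|f x| <= M) -> 0 <= Z ->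
  (forall x y, `|f x - f y| <= Z * edistR x y `^ alpha) -> holder_norm alpha f <= M + Z.
Proof.
move=> fM Z0 fZ; apply: lerD; first exact: sup_norm_le.
rewrite /holder_seminorm.
have [->|S0] := eqVneq [set z | exists x y, x <> y /\ z = `|f x - f y| / edistR x y `^ alpha] set0.
  by rewrite sup0.
apply: ge_sup; first exact/set0P.
by move=> _ [x [y [_ ->]]]; apply: ler_div_junk => //; exact: powR_ge0.
Qed.

(** As |Y - m| / 2 lies in [0, 1], its power r is at most itself; moreover E|Y - m| <= 2 delta. *)
Lemma Lr_norm_le (r delta : R) (Y : O -> R) : 1 <= r -> bmeas Y ->
  (forall w, `|Y w| <= 1) -> expectR P (fun w => `|Y w|) <= delta ->
  Lr_norm P r (fun w => Y w - expectR P Y) <= 2 * delta `^ r^-1.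
Proof.
move=> r1 bY Y1 Yd; set m := expectR P Y.
have r0 : 0 < r by exact: lt_le_trans r1.
have d0 : 0 <= delta by apply: le_trans Yd; apply: expectR_ge0.
have m1 : `|m| <= 1 by exact: normr_expectR_le_cst.
have bYm : bmeas (fun w => Y w - m) by apply: bmeasB => //; exact: bmeas_cst.
have Ym2 w : `|Y w - m| <= 2 by have := ler_normB (Y w) m; have := Y1 w; lra.
have pw w : `|Y w - m| `^ r <= 2 `^ r * (2^-1 * `|Y w - m|).
  have [->|N0] := eqVneq `|Y w - m| 0.
    by rewrite powR0 ?gt_eqF// mulr0 mulr0.
  have z0 : 0 < 2^-1 * `|Y w - m| by rewrite mulr_gt0// lt_def N0 normr_ge0.
  have E : `|Y w - m| = 2 * (2^-1 * `|Y w - m|) by rewrite mulrA mulfV ?mul1r.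
  rewrite [X in X `^ r]E powRM ?(ltW z0)//; apply: ler_wpM2l; first exact: powR_ge0.
  by apply: ge1r_powR => //; rewrite z0/=; have := Ym2 w; lra.
have bp : bmeas (fun w => `|Y w - m| `^ r).
  split.
    have mn : measurable_fun setT (fun w => `|Y w - m|) by have [] := bmeas_norm bYm.
    exact: (measurableT_comp (measurable_powR r) mn).
  exists (2 `^ r * 1) => w; rewrite ger0_norm ?powR_ge0//.
  apply: le_trans (pw w) _; apply: ler_wpM2l; first exact: powR_ge0.
  by have := Ym2 w; lra.
have E1 : expectR P (fun w => `|Y w - m| `^ r) <= 2 `^ r * delta.
  apply: (@le_trans _ _ (expectR P (fun w => 2 `^ r * (2^-1 * `|Y w - m|)))).
    by apply: le_expectR => //; apply/bmeasZ/bmeasZ/bmeas_norm.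
  rewrite expectRZ; last exact/bmeasZ/bmeas_norm.
  rewrite expectRZ; last exact/bmeas_norm.
  apply: ler_wpM2l; first exact: powR_ge0.
  have h1 : expectR P (fun w => `|Y w - m|) <= expectR P (fun w => `|Y w| + `|m|).
    apply: le_expectR => [||w]; first exact/bmeas_norm.
      by apply: bmeasD; [exact/bmeas_norm|exact: bmeas_cst].
    exact: ler_normB.
  have h2 : expectR P (fun w => `|Y w| + `|m|) = expectR P (fun w => `|Y w|) + `|m|.
    by rewrite expectRD ?expectR_cst//; [exact: bmeas_norm|exact: bmeas_cst].
  have h3 : `|m| <= expectR P (fun w => `|Y w|) by exact: normr_expectR_le.
  by lra.
rewrite /Lr_norm; apply: (@le_trans _ _ ((2 `^ r * delta) `^ r^-1)).
  apply: ge0_ler_powR => //; rewrite ?nnegrE.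
  - by rewrite invr_ge0 ltW.
  - by apply: expectR_ge0 => w; exact: powR_ge0.
  - by rewrite mulr_ge0// powR_ge0.
rewrite powRM// ?powR_ge0// -powRrM mulfV ?gt_eqF// powRr1//.
Qed.

Variables (beta gamma r : R) (p : nat) (kappa : nat -> R) (lambda z0 : R).
Variables (Phi : R -> R) (C : R).
Hypothesis beta0 : 0 < beta.
Hypothesis gamma1 : 1 < gamma.
Hypothesis r1 : 1 <= r.
Hypothesis kappa0 : forall i : nat, (1 <= i <= p)%N -> 0 < kappa i.
Hypothesis lambda1 : 1 < lambda.
Hypothesis z00 : 0 < z0.
Hypothesis Phi_ge0 : forall x, 0 <= x -> 0 <= Phi x.
Hypothesis Phi_mono : forall x y, 0 <= x -> x <= y -> Phi x <= Phi y.
Hypothesis Phi_bij : forall y, 0 <= y -> exists! x, 0 <= x /\ Phi x = y.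
Hypothesis modulus_Phi : forall y, 0 < y ->
  modulus_cont F y <= beta * (Phi (y `^ (- alpha))) `^ (- gamma).
Hypothesis Phi_double : forall z, z0 <= z -> Phi (2 * z) <= lambda * Phi z.
Hypothesis C0 : 0 < C.
Hypothesis moment : forall f : ('I_d -> R) -> R, in_Holder alpha f -> sup_norm f <= 1 ->
  forall n : nat, (1 <= n)%N ->
  let m := expectR P (fun w => f (X 0%N w)) in
  (\int[P]_w ((`| \sum_(1 <= i < n.+1) (f (X i w) - m) | ^+ (2 * p))%:E) <=
   (C * \sum_(1 <= i < p.+1)
          (n%:R ^+ i * (Lr_norm P r (fun w => f (X 0%N w) - m)) ^+ i *
           (Phi (holder_norm alpha (fun x => f x - m))) `^ (kappa i)))%:E)%E.

Let gamma0 : 0 < gamma. Proof. exact: lt_trans gamma1. Qed.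
Let r0 : 0 < r. Proof. exact: lt_le_trans r1. Qed.
Let alpha0 : 0 < alpha. Proof. by case/andP: alpha01. Qed.

(** [Phi] is onto, hence unbounded, so the bound on the modulus tends to 0 with y. The point y is
    chosen so that y^(-alpha) = x + 1, with [Phi x] equal to (beta / e)^(1/gamma). *)
Lemma modulus_to0 (e : R) : 0 < e -> exists2 y, 0 < y & modulus_cont F y <= e.
Proof.
move=> e0; pose K := (beta / e) `^ gamma^-1.
have K0 : 0 < K by apply: powR_gt0; rewrite divr_gt0.
have [x [[x0 PK] _]] := Phi_bij (ltW K0).
have xp : 0 < x + 1 by rewrite ltr_wpDl.
exists ((x + 1) `^ (- alpha^-1)); first exact: powR_gt0.
apply: le_trans (modulus_Phi _) _; first exact: powR_gt0.
rewrite -powRrM mulrN mulNr opprK mulVf ?gt_eqF// powRr1 ?(ltW xp)//.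
rewrite powRN ler_pdivrMr; last first.
  by apply: powR_gt0; apply: lt_le_trans K0 _; rewrite -PK Phi_mono// lerDl.
rewrite mulrC -ler_pdivrMr//.
have -> : beta / e = K `^ gamma.
  by rewrite /K -powRrM mulVf ?gt_eqF// powRr1// divr_ge0// ltW.
apply: ge0_ler_powR; rewrite ?nnegrE; first exact: ltW.
- exact: ltW.
- by apply: Phi_ge0; exact: ltW.
- by rewrite -PK Phi_mono// lerDl.
Qed.

(** Doubling absorbs the factor between the Hoelder norm N and the constant B of a single ramp
    product: N <= 2^j max(B, z1) for a fixed j, at a cost lambda^j. The maximum with z1 keeps the
    argument at least z0, where doubling starts, and at least 1, which absorbs the summand 2. *)
Lemma Phi_doubling_bound : exists2 K1 : R, 0 < K1 & forall (l : nat) (B N : R),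
  0 <= B -> Phi B = (beta * 2 ^+ l.+1) `^ gamma^-1 -> 0 <= N ->
  N <= 2 + 2 * d%:R * B -> Phi N <= K1 * (2 `^ gamma^-1) ^+ l.
Proof.
pose z1 := Num.max z0 1; pose j := archi_bound (2 + 2 * d%:R : R).
have j0 : 0 <= 2 + 2 * d%:R :> R by rewrite addr_ge0// mulr_ge0.
have z10 : 0 < z1 by rewrite /z1 lt_max z00.
have l0 : 0 < lambda by exact: lt_trans lambda1.
exists (lambda ^+ j * ((beta * 2) `^ gamma^-1 + Phi z1)).
  apply: mulr_gt0; first exact: exprn_gt0.
  apply: ltr_wpDr; first by apply: Phi_ge0; exact: ltW.
  by apply: powR_gt0; rewrite mulr_gt0.
move=> l B N B0 PB N0 NB.
pose z := Num.max B z1.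
have z0z : z0 <= z by rewrite /z /z1 !le_max lexx !orbT.
have z1z : 1 <= z by rewrite /z /z1 !le_max lexx !orbT.
have Bz : B <= z by rewrite /z le_max lexx.
have iter i : Phi (2 ^+ i * z) <= lambda ^+ i * Phi z.
  elim: i => [|i IH]; first by rewrite !expr0 !mul1r.
  rewrite exprS -mulrA; apply: le_trans (Phi_double _) _.
    by apply: le_trans z0z _; rewrite ler_peMl ?(le_trans _ z1z)// exprn_ege1// ler1n.
  by rewrite exprS -mulrA ler_wpM2l// ltW.
have NZ : N <= 2 ^+ j * z.
  apply: le_trans NB _; apply: (@le_trans _ _ ((2 + 2 * d%:R) * z)).
    rewrite [leRHS]mulrDl; apply: lerD; first by rewrite ler_peMr.
    by apply: ler_wpM2l => //; rewrite mulr_ge0.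
  apply: ler_wpM2r; first exact: le_trans z1z.
  apply: ltW; apply: upper_nthrootP; exact: leqnn.
apply: le_trans (Phi_mono N0 NZ) _; apply: le_trans (iter j) _.
rewrite -mulrA; apply: ler_wpM2l; first by rewrite exprn_ge0// ltW.
have g1 : 1 <= (2 `^ gamma^-1) ^+ l :> R.
  rewrite exprn_ege1//; apply: (@le_trans _ _ (2 `^ 0)); first by rewrite powRr0.
  by apply: ler_powR; rewrite ?ler1n// invr_ge0 ltW.
apply: (@le_trans _ _ (Phi B + Phi z1)).
  rewrite /z; case: (leP B z1) => _; first by rewrite lerDr Phi_ge0.
  by rewrite lerDl Phi_ge0// ltW.
rewrite [leRHS]mulrDl; apply: lerD; last by rewrite ler_peMr// Phi_ge0// ltW.
have El : (2 ^+ l) `^ gamma^-1 = (2 `^ gamma^-1) ^+ l :> R.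
  rewrite -[in LHS]powR_mulrn// -[in RHS]powR_mulrn; last exact: powR_ge0.
  by rewrite -!powRrM mulrC.
rewrite PB exprS mulrA powRM; [by rewrite El| |exact: exprn_ge0].
by rewrite mulr_ge0 ?(ltW beta0).
Qed.

(** Growth per level of term i of the moment bound: 2^(kappa_i/gamma) from [Phi] of the Hoelder
    norm, 2^(-i/r) from the L^r norm. *)
Definition rho (i : nat) : R := 2 `^ (kappa i / gamma - i%:R / r).

Lemma rho_gt0 i : 0 < rho i. Proof. by apply: powR_gt0. Qed.

Let moment_scale n f : (forall i, bmeas (fun w => f (X i w))) -> (1 <= n)%N ->
  (\int[P]_w ((`|emp n f w| ^+ (2 * p))%:E) = ((n%:R^-1) ^+ p)%:E *
   \int[P]_w ((`|\sum_(1 <= i < n.+1) (f (X i w) - expectR P (fun w => f (X 0%N w)))| ^+ (2 * p))%:E))%E.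
Proof.
move=> bf n1.
rewrite -ge0_integralZl//=.
- apply: eq_integral => w _; rewrite -EFinM; congr (_%:E).
  rewrite /emp normrM exprMn; congr (_ * _).
  rewrite ger0_norm ?invr_ge0 ?sqrtr_ge0// exprM; congr (_ ^+ _).
  by rewrite exprVn sqr_sqrtr.
- apply/measurable_EFinP; apply: measurable_funX; apply: measurableT_comp => //.
  by apply: measurable_sum => i; have [] := bmeasB (bf i) (bmeas_cst (expectR P (fun w => f (X 0%N w)))).
Qed.

(** The point is that A depends neither on l, nor on f, nor on n. The power p - i of 1/n combines
    n^i with the factor n^(-p) due to the normalization of [emp]. *)
Lemma emp_moment_link (D : R) : 0 <= D -> exists2 A : R, 0 <= A &
  forall (l : nat) (f : ('I_d -> R) -> R) (B : R),
    0 <= B -> Phi B = (beta * 2 ^+ l.+1) `^ gamma^-1 ->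
    (forall i, bmeas (fun w => f (X i w))) -> (forall x, `|f x| <= 1) ->
    (forall x y, `|f x - f y| <= 2 * d%:R * B * edistR x y `^ alpha) ->
    expectR P (fun w => `|f (X 0%N w)|) <= D / 2 ^+ l ->
    forall n, (1 <= n)%N ->
    (\int[P]_w ((`|emp n f w| ^+ (2 * p))%:E) <=
     (A * \sum_(1 <= i < p.+1) (n%:R^-1 ^+ (p - i) * rho i ^+ l))%:E)%E.
Proof.
move=> D0; have [K1 K10 PK1] := Phi_doubling_bound.
pose a i := (2 * D `^ r^-1) ^+ i * K1 `^ kappa i.
have a0 i : 0 <= a i.
  by rewrite mulr_ge0 ?powR_ge0// exprn_ge0// mulr_ge0// powR_ge0.
pose A := C * \sum_(1 <= i < p.+1) a i.
exists A; first by rewrite mulr_ge0 ?(ltW C0)// sumr_ge0.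
move=> l f B B0 PB bf f1 fB fD n n1.
have Z0 : 0 <= 2 * d%:R * B by rewrite !mulr_ge0.
rewrite moment_scale//.
set m := expectR P (fun w => f (X 0%N w)).
have m1 : `|m| <= 1 by exact: normr_expectR_le_cst.
have := moment (in_Hoelder_bound f1 Z0 fB) (sup_norm_le f1) n1; rewrite -/m /= => Hm.
apply: le_trans (lee_wpmul2l _ Hm) _; first by rewrite lee_fin exprn_ge0// invr_ge0.
rewrite -EFinM lee_fin /A mulrCA -!mulrA ler_wpM2l ?(ltW C0)//.
have Lr := Lr_norm_le r1 (bf 0%N) (fun w => f1 _) fD; rewrite -/m in Lr.
have Lr0 : 0 <= Lr_norm P r (fun w => f (X 0%N w) - m) by exact: powR_ge0.
have N2 : holder_norm alpha (fun x => f x - m) <= 2 + 2 * d%:R * B.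
  apply: hoelder_norm_le => // [x|x y].
    by have := ler_normB (f x) m; have := f1 x; lra.
  by rewrite (_ : f x - m - (f y - m) = f x - f y)//; ring.
have N0 : 0 <= holder_norm alpha (fun x => f x - m).
  rewrite /holder_norm; apply: addr_ge0; apply: sup_nonneg.
    by move=> _ [x _ <-].
  by move=> _ [x [y [_ ->]]]; rewrite divr_ge0// powR_ge0.
have PN := PK1 l B _ B0 PB N0 N2.
rewrite mulr_sumr.
apply: (@le_trans _ _ (\sum_(1 <= i < p.+1) a i * (n%:R^-1 ^+ (p - i) * rho i ^+ l))).
  rewrite big_nat [leRHS]big_nat; apply: ler_sum => i /andP[i1 ip].
  rewrite ltnS in ip.
  have nn : n%:R^-1 ^+ p * n%:R ^+ i = n%:R^-1 ^+ (p - i) :> R.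
    rewrite -{1}(subnK ip) exprD -mulrA -exprMn mulVf ?expr1n ?mulr1//.
    by rewrite pnatr_eq0 -lt0n.
  set L1 := Lr_norm _ _ _ ^+ i; set P1 := _ `^ kappa i.
  have -> : n%:R^-1 ^+ p * (n%:R ^+ i * L1 * P1) = n%:R^-1 ^+ (p - i) * (L1 * P1).
    by rewrite -nn; ring.
  rewrite [leRHS]mulrCA; apply: ler_wpM2l; first by rewrite exprn_ge0// invr_ge0.
  rewrite /L1 /P1.
  have h1 : Lr_norm P r (fun w => f (X 0%N w) - m) ^+ i <=
      (2 * D `^ r^-1) ^+ i * (2 `^ (- (i%:R / r))) ^+ l.
    apply: (@le_trans _ _ ((2 * (D / 2 ^+ l) `^ r^-1) ^+ i)).
      by rewrite lerXn2r// nnegrE// mulr_ge0// powR_ge0.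
    rewrite powRM// ?invr_ge0 ?exprn_ge0// mulrA exprMn ler_wpM2l//.
      by rewrite exprn_ge0// mulr_ge0// powR_ge0.
    by rewrite expr_powR_inv.
  have h2 : Phi (holder_norm alpha (fun x => f x - m)) `^ kappa i <=
      K1 `^ kappa i * (2 `^ (kappa i / gamma)) ^+ l.
    apply: (@le_trans _ _ ((K1 * (2 `^ gamma^-1) ^+ l) `^ kappa i)).
      apply: ge0_ler_powR => //; rewrite ?nnegrE ?Phi_ge0//.
        by rewrite ltW// kappa0// i1.
      by rewrite mulr_ge0 ?(ltW K10)// exprn_ge0// powR_ge0.
    rewrite powRM ?(ltW K10) ?exprn_ge0 ?powR_ge0// ler_wpM2l ?powR_ge0//.
    by rewrite powR_expr_powR.
  apply: (@le_trans _ _ (((2 * D `^ r^-1) ^+ i * (2 `^ (- (i%:R / r))) ^+ l) *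
     (K1 `^ kappa i * (2 `^ (kappa i / gamma)) ^+ l))).
    by apply: ler_pM => //; rewrite ?exprn_ge0 ?powR_ge0.
  rewrite mulrACA -exprMn -powRD ?pnatr_eq0 ?implybT// addrC.
  by rewrite /a /rho lexx.
(* For nonnegative terms, the sum of the products is at most the product of the sums. *)
rewrite mulr_suml; apply: ler_sum_nat => i /andP[i1 ip].
apply: ler_wpM2l => //.
rewrite (bigD1_seq i) ?mem_index_iota ?i1 ?ip ?iota_uniq//= lerDl.
by apply: sumr_ge0 => k _; rewrite mulr_ge0 ?exprn_ge0 ?invr_ge0// ltW// rho_gt0.
Qed.

(** From the moment of order 2p by y <= 1 + y^p; the normalization n^(-p) compensates every n^i with
    i <= p. *)
Lemma emp_second_moment f Z : (0 < p)%N ->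
  (forall i, bmeas (fun w => f (X i w))) -> (forall x, `|f x| <= 1) -> 0 <= Z ->
  (forall x y, `|f x - f y| <= Z * edistR x y `^ alpha) ->
  exists c : R, forall n, (\int[P]_w ((`|emp n f w| ^+ 2)%:E) <= c%:E)%E.
Proof.
move=> p0 bf f1 Z0 fZ; set m := expectR P (fun w => f (X 0%N w)).
pose c := C * \sum_(1 <= i < p.+1) ((Lr_norm P r (fun w => f (X 0%N w) - m)) ^+ i *
   (Phi (holder_norm alpha (fun x => f x - m))) `^ (kappa i)).
have c0 : 0 <= c.
  rewrite mulr_ge0 ?(ltW C0)// sumr_ge0// => i _.
  by rewrite mulr_ge0 ?powR_ge0// exprn_ge0// powR_ge0.
exists (1 + c) => n.
have mE k : measurable_fun setT (fun w => (`|emp n f w| ^+ k)%:E).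
  apply/measurable_EFinP/measurable_funX; apply: measurableT_comp => //.
  by have [] := bmeas_emp n bf.
have [->|n0] := posnP n.
  rewrite (eq_integral (fun=> 0%E)); last first.
    by move=> w _; rewrite /emp sqrtr0 invr0 mul0r normr0 expr0n.
  by rewrite integral0 lee_fin addr_ge0.
apply: (@le_trans _ _ (\int[P]_w (1%:E + (`|emp n f w| ^+ (2 * p))%:E))%E).
  apply: ge0_le_integral => //.
  - exact: emeasurable_funD.
  - move=> w _; rewrite -EFinD lee_fin exprM; set y := `|emp n f w| ^+ 2.
    have y0 : 0 <= y by rewrite exprn_ge0.
    have [y1|y1] := leP y 1; first by rewrite (le_trans y1)// lerDl exprn_ge0.
    apply: (@le_trans _ _ (y ^+ p)); last by rewrite lerDr.
    by rewrite -[leLHS]expr1 ler_weXn2l// ltW.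
rewrite ge0_integralD//=.
rewrite EFinD; apply: leeD; first by rewrite integral_cst//= probability_setT mule1.
rewrite moment_scale//.
have := moment (in_Hoelder_bound f1 Z0 fZ) (sup_norm_le f1) n0; rewrite -/m /= => Hm.
apply: le_trans (lee_wpmul2l _ Hm) _; first by rewrite lee_fin exprn_ge0// invr_ge0.
rewrite -EFinM lee_fin /c mulrCA ler_wpM2l ?(ltW C0)// mulr_sumr.
rewrite big_nat [leRHS]big_nat; apply: ler_sum => i /andP[i1 ip]; rewrite ltnS in ip.
set L1 := Lr_norm _ _ _ ^+ i; set P1 := _ `^ kappa i.
have -> : n%:R^-1 ^+ p * (n%:R ^+ i * L1 * P1) = n%:R^-1 ^+ p * n%:R ^+ i * (L1 * P1).
  by ring.
apply: ler_piMl.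
  by rewrite mulr_ge0 ?powR_ge0// exprn_ge0// powR_ge0.
rewrite exprVn ler_pdivrMl ?exprn_gt0 ?ltr0n// mulr1 ler_weXn2l//.
by rewrite ler1n.
Qed.

End moment_bounds.

(** * Tail bounds for differences of neighbouring brackets *)

Section links.
Context {R : realType} {d : nat} {dO : measure_display} {O : measurableType dO}.
Variables (P : probability O R) (X : nat -> O -> 'I_d -> R).
Local Notation F := (dist_fun P X).
Local Notation phi := (phi P X).

(** The increments of the chaining. Each ramp spans at least 2^(-l-1) in level, which bounds the
    Hoelder constants; the common box has sides at most 4 * 2^(-l), which bounds the mean of |f|. *)
Definition is_link (l : nat) (f : ('I_d -> R) -> R) :=
  exists lo hi u v u' v', [/\ boxed lo hi u v, boxed lo hi u' v',
    (forall k, (2 ^+ l.+1)^-1 <= v k - u k) /\ (forall k, (2 ^+ l.+1)^-1 <= v' k - u' k),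
    (forall k, hi k - lo k <= 4 / 2 ^+ l) &
    f = (fun x => phi u v x - phi u' v' x)].

Hypothesis mX : forall i k, measurable_fun setT (fun w => X i w k).
Variable alpha : R.
Hypothesis alpha01 : 0 < alpha <= 1.
Variables (beta gamma r : R) (p : nat) (kappa : nat -> R) (lambda z0 : R).
Variables (Phi : R -> R) (C : R).
Hypothesis p0 : (0 < p)%N.
Hypothesis beta0 : 0 < beta.
Hypothesis gamma1 : 1 < gamma.
Hypothesis r1 : 1 <= r.
Hypothesis kappa0 : forall i : nat, (1 <= i <= p)%N -> 0 < kappa i.
Hypothesis kappa_lt : forall i : nat, (1 <= i <= p)%N ->
  kappa i < gamma * (i%:R / r + 2 * (p%:R - i%:R) - d%:R).
Hypothesis lambda1 : 1 < lambda.
Hypothesis z00 : 0 < z0.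
Hypothesis Phi_ge0 : forall x, 0 <= x -> 0 <= Phi x.
Hypothesis Phi_mono : forall x y, 0 <= x -> x <= y -> Phi x <= Phi y.
Hypothesis Phi_bij : forall y, 0 <= y -> exists! x, 0 <= x /\ Phi x = y.
Hypothesis modulus_Phi : forall y, 0 < y ->
  modulus_cont F y <= beta * (Phi (y `^ (- alpha))) `^ (- gamma).
Hypothesis Phi_double : forall z, z0 <= z -> Phi (2 * z) <= lambda * Phi z.
Hypothesis C0 : 0 < C.
Hypothesis moment : forall f : ('I_d -> R) -> R, in_Holder alpha f -> sup_norm f <= 1 ->
  forall n : nat, (1 <= n)%N ->
  let m := expectR P (fun w => f (X 0%N w)) in
  (\int[P]_w ((`| \sum_(1 <= i < n.+1) (f (X i w) - m) | ^+ (2 * p))%:E) <=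
   (C * \sum_(1 <= i < p.+1)
          (n%:R ^+ i * (Lr_norm P r (fun w => f (X 0%N w) - m)) ^+ i *
           (Phi (holder_norm alpha (fun x => f x - m))) `^ (kappa i)))%:E)%E.

Let gamma0 : 0 < gamma. Proof. exact: lt_trans gamma1. Qed.
Let modulus0 := modulus_to0 alpha01 beta0 gamma1 Phi_ge0 Phi_mono Phi_bij modulus_Phi.

Let link_bmeas l f : is_link l f -> forall i, bmeas (fun w => f (X i w)).
Proof.
move=> [lo [hi [u [v [u' [v' [b b' _ _ ->]]]]]]] i.
by apply: bmeasB; apply: (bmeas_phi mX modulus0) => k; [have [] := b k|have [] := b' k].
Qed.

Let link_moment : exists2 A : R, 0 <= A & forall l f, is_link l f ->
  forall n, (1 <= n)%N ->
    (\int[P]_w ((`|emp P X n f w| ^+ (2 * p))%:E) <=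
     (A * \sum_(1 <= i < p.+1) (n%:R^-1 ^+ (p - i) * rho gamma r kappa i ^+ l))%:E)%E.
Proof.
have D0 : 0 <= 4 * d%:R :> R by rewrite mulr_ge0.
have [A A0 HA] := @emp_moment_link R d dO O P X alpha beta gamma r p kappa
  lambda z0 Phi C beta0 gamma1 r1 kappa0 lambda1 z00 Phi_ge0 Phi_mono Phi_double C0 moment _ D0.
exists A => // l f lf n n1; have bf := link_bmeas lf.
have [B [[B0 PB] _]] := Phi_bij (powR_ge0 (beta * 2 ^+ l.+1) gamma^-1).
case: lf => lo [hi [u [v [u' [v' [b b' [g g'] hl fE]]]]]].
have f1 x : `|f x| <= 1.
  rewrite fE; have /andP[? ?] := phi01 P X u v x; have /andP[? ?] := phi01 P X u' v' x.
  by rewrite ler_norml; apply/andP; split; lra.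
apply: (HA l f B) => //.
- have cB (s t : 'I_d -> R) : boxed lo hi s t -> (forall k, (2 ^+ l.+1)^-1 <= t k - s k) ->
      \sum_k ramp_const P X alpha k (s k) (t k) <= d%:R * B.
    move=> bst gst; apply: (@le_trans _ _ (\sum_(k < d) B)); last first.
      by rewrite sumr_const card_ord mulr_natl.
    apply: ler_sum => k _; have [l0 h1 lu uv vh] := bst k.
    apply: (@ramp_const_le R d dO O P X mX modulus0 alpha Phi beta gamma beta0 gamma1
       Phi_ge0 Phi_mono Phi_bij modulus_Phi k (s k) (t k) (2 ^+ l.+1)^-1) => //.
    + exact: le_trans lu.
    + exact: le_trans h1.
    + by rewrite PB invrK.
  move=> x y; rewrite fE.
  have -> : phi u v x - phi u' v' x - (phi u v y - phi u' v' y) =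
      (phi u v x - phi u v y) - (phi u' v' x - phi u' v' y) by ring.
  apply: le_trans (ler_normB _ _) _.
  have uv k : u k < v k by have [] := b k.
  have uv' k : u' k < v' k by have [] := b' k.
  apply: le_trans (lerD (phi_hoelder mX modulus0 x y alpha01 uv) (phi_hoelder mX modulus0 x y alpha01 uv')) _.
  rewrite -mulrDl; apply: ler_wpM2r; first exact: powR_ge0.
  have := cB _ _ b g; have := cB _ _ b' g'.
  have -> : 2 * d%:R * B = d%:R * B + d%:R * B by ring.
  by lra.
- rewrite fE; apply: le_trans (expect_phi_close mX modulus0 b b') _.
  apply: (@le_trans _ _ (\sum_(k < d) 4 / 2 ^+ l)); first exact: ler_sum.
  rewrite sumr_const card_ord -mulr_natl le_eqVlt; apply/orP; left; apply/eqP.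
  by ring.
Qed.

(** The condition on [kappa] says that this quotient, a power of 2, has a negative exponent: 2^d
    counts the new cells per level, and 4 is the growth of n allowed per level. *)
Let rate_lt1 i : (1 <= i <= p)%N ->
  rho gamma r kappa i * 2 ^+ d / 4 ^+ (p - i) < 1.
Proof.
move=> ip; have /andP[i1 ip'] := ip.
have -> : 4 ^+ (p - i) = 2 `^ (2 * (p%:R - i%:R)) :> R.
  have -> : 2 * (p%:R - i%:R) = (2 * (p - i))%:R :> R by rewrite natrM natrB.
  by rewrite powR_mulrn// exprM; congr (_ ^+ _); rewrite expr2 -natrM.
have -> : 2 ^+ d = 2 `^ d%:R :> R by rewrite powR_mulrn.
rewrite /rho -powRD ?pnatr_eq0 ?implybT// -powRN -powRD ?pnatr_eq0 ?implybT//.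
set s := _ + _; have s0 : 0 < - s.
  have := kappa_lt ip; rewrite mulrC -ltr_pdivrMr// /s.
  by move: (i%:R / r) (kappa i / gamma) => a b; lra.
rewrite -[s]opprK powRN invf_lt1 ?powR_gt0//.
have := gt0_ltr_powR s0 (x := 1) (y := 2); rewrite powR1; apply; rewrite ?nnegrE//.
by rewrite ltr1n.
Qed.

Let rate : exists2 b : R, 0 < b < 1 & forall i, (1 <= i <= p)%N ->
  rho gamma r kappa i * 2 ^+ d <= b * 4 ^+ (p - i).
Proof.
suff [b b01 bP] : exists2 b : R, 0 < b < 1 & forall i, i \in index_iota 1 p.+1 ->
    rho gamma r kappa i * 2 ^+ d / 4 ^+ (p - i) <= b.
  exists b => // i ip; have := bP i; rewrite mem_index_iota ltnS => /(_ ip).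
  by rewrite ler_pdivrMr// exprn_gt0.
have : forall i, i \in index_iota 1 p.+1 ->
    rho gamma r kappa i * 2 ^+ d / 4 ^+ (p - i) < 1.
  by move=> i; rewrite mem_index_iota ltnS; exact: rate_lt1.
elim: (index_iota 1 p.+1) => [|i s IH] H.
  by exists 2^-1 => //; rewrite invr_gt0 ltr0n invf_lt1// ltr1n.
have [|b /andP[b0 b1] bP] := IH; first by move=> j js; apply: H; rewrite inE js orbT.
have Hi := H i; rewrite inE eqxx in Hi; have {}Hi := Hi isT.
exists (Num.max b (rho gamma r kappa i * 2 ^+ d / 4 ^+ (p - i))).
  by rewrite lt_max b0 gt_max b1.
move=> j; rewrite inE => /predU1P[->|js]; first by rewrite le_max lexx orbT.
by rewrite le_max bP.
Qed.

(** The divisor (2^d)^l anticipates the union over the cells of level l. The constant K allows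
    levels with 2^l up to a large multiple of sqrt(n), where the chaining has to stop. *)
Lemma link_prob : exists A x y : R, [/\ 0 <= A, 0 < x < 1, 0 < y < 1 &
  forall K e l f n, 1 <= K -> 0 < e -> is_link l f -> (1 <= n)%N ->
    4 ^+ l <= K * n%:R ->
    fine (P [set w | e * x ^+ l < `|emp P X n f w|]) <=
    A * K ^+ p / e ^+ (2 * p) * y ^+ l / (2 ^+ d) ^+ l].
Proof.
have [A A0 HA] := link_moment; have [b /andP[b0 b1] bP] := rate.
(* The decay b^l is shared equally: x^(2p) = b^(1/2) pays for the shrinking threshold e x^l, and y =
   b^(1/2) remains in the probability. *)
pose x := b `^ (4 * p%:R)^-1; pose y := b `^ 2^-1.
have p4 : 0 < 4 * p%:R :> R by rewrite mulr_gt0 ?ltr0n.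
have pw01 s : 0 < s -> 0 < b `^ s < 1.
  move=> s0; rewrite powR_gt0//=.
  by have := gt0_ltr_powR s0 (x := b) (y := 1); rewrite powR1; apply; rewrite ?nnegrE// ltW.
have x01 : 0 < x < 1 by apply: pw01; rewrite invr_gt0.
have y01 : 0 < y < 1 by apply: pw01; rewrite invr_gt0.
exists (A * p%:R), x, y; split => //; first by rewrite mulr_ge0.
move=> K e l f n K1 e0 lf n1 lK.
have [x0 _] := andP x01; have [y0 _] := andP y01.
have mf : measurable_fun setT (emp P X n f) by have [] := bmeas_emp P n (link_bmeas lf).
have n0 : 0 < n%:R :> R by rewrite ltr0n.
have d0 : 0 < (2 ^+ d) ^+ l :> R by rewrite !exprn_gt0.
have ex0 : 0 < e * x ^+ l by rewrite mulr_gt0// exprn_gt0.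
apply: le_trans (markov_power mf ex0 (HA l f lf n n1)) _.
have term i : (1 <= i < p.+1)%N ->
    n%:R^-1 ^+ (p - i) * rho gamma r kappa i ^+ l <= K ^+ p * b ^+ l / (2 ^+ d) ^+ l.
  rewrite ltnS => ip; rewrite ler_pdivlMr// -mulrA -exprMn.
  have h1 : (rho gamma r kappa i * 2 ^+ d) ^+ l <= (b * 4 ^+ (p - i)) ^+ l.
    rewrite lerXn2r ?nnegrE ?bP// ?mulr_ge0 ?exprn_ge0 ?(ltW b0)//.
    by rewrite ltW// rho_gt0.
  apply: (@le_trans _ _ (n%:R^-1 ^+ (p - i) * (b * 4 ^+ (p - i)) ^+ l)).
    by apply: ler_wpM2l => //; rewrite exprn_ge0// invr_ge0 ltW.
  rewrite exprMn -exprM mulnC exprM mulrCA mulrC; apply: ler_wpM2r; first by rewrite exprn_ge0 ?(ltW b0).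
  rewrite -exprMn; apply: (@le_trans _ _ (K ^+ (p - i))).
    rewrite lerXn2r ?nnegrE//.
    - exact: le_trans K1.
    - by rewrite ler_pdivrMl// mulrC.
  by rewrite ler_weXn2l// leq_subr.
have sumle : \sum_(1 <= i < p.+1) (n%:R^-1 ^+ (p - i) * rho gamma r kappa i ^+ l) <=
    p%:R * (K ^+ p * b ^+ l / (2 ^+ d) ^+ l).
  apply: (@le_trans _ _ (\sum_(1 <= i < p.+1) (K ^+ p * b ^+ l / (2 ^+ d) ^+ l))).
    exact: ler_sum_nat.
  by rewrite sumr_const_nat subSS subn0 mulr_natl.
have xy : x ^+ (2 * p) = y.
  rewrite /x /y -powR_mulrn ?powR_ge0// -powRrM; congr (_ `^ _).
  by rewrite natrM; field; rewrite pnatr_eq0 -lt0n.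
have yy : b = y * y.
  rewrite /y -powRD ?(gt_eqF b0) ?implybT//.
  have -> : 2^-1 + 2^-1 = 1 :> R by field.
  by rewrite powRr1// ltW.
have -> : (e * x ^+ l) ^+ (2 * p) = e ^+ (2 * p) * y ^+ l.
  by rewrite exprMn -exprM (mulnC l) (exprM x) xy.
rewrite ler_pdivrMr; last by rewrite mulr_gt0 ?exprn_gt0.
apply: le_trans (ler_wpM2l A0 sumle) _.
rewrite {1}yy exprMn le_eqVlt; apply/orP; left; apply/eqP.
set yl := y ^+ l; set dd := (2 ^+ d) ^+ l; set ee := e ^+ _.
have ee0 : ee != 0 by rewrite gt_eqF// exprn_gt0.
by field; rewrite ee0 gt_eqF.
Qed.

End links.

(** * Brackets on dyadic grids of quantiles *)

Section unions.
Context {R : realType} {dO : measure_display} {O : measurableType dO}.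
Variable P : probability O R.

Let setE (T : choiceType) (E : T -> set O) (s : seq T) :
  [set w | exists2 t, t \in s & E t w] = \big[setU/set0]_(t <- s) E t.
Proof.
rewrite -bigcup_seq; apply/seteqP; split => w [t ts tw]; by exists t.
Qed.

Lemma measurable_exists_in (T : choiceType) (E : T -> set O) (s : seq T) :
  (forall t, measurable (E t)) -> measurable [set w | exists2 t, t \in s & E t w].
Proof. by move=> mE; rewrite setE; apply: bigsetU_measurable. Qed.

Lemma union_bound (T : choiceType) (E : T -> set O) (s : seq T) :
  (forall t, measurable (E t)) ->
  fine (P [set w | exists2 t, t \in s & E t w]) <= \sum_(t <- s) fine (P (E t)).
Proof.
move=> mE; rewrite setE; elim: s => [|t s IH].
  by rewrite !big_nil measure0.
rewrite !big_cons; apply: le_trans (lerD (lexx _) IH).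
have mU : measurable (\big[setU/set0]_(j <- s) E j) by exact: bigsetU_measurable.
rewrite -lee_fin EFinD !fineK ?probability_fin_num//; last exact: measurableU.
exact: measureU2.
Qed.

Lemma union_bound_fin (T : finType) (E : T -> set O) (c : R) :
  (forall t, measurable (E t)) -> (forall t, fine (P (E t)) <= c) ->
  measurable [set w | exists t, E t w] /\
  fine (P [set w | exists t, E t w]) <= #|T|%:R * c.
Proof.
move=> mE Ec.
have -> : [set w | exists t, E t w] = [set w | exists2 t, t \in enum T & E t w].
  by apply/seteqP; split => w [t]; [exists t; rewrite ?mem_enum|exists t].
split; first exact: measurable_exists_in.
apply: le_trans (union_bound _ mE) _.
apply: (@le_trans _ _ (\sum_(t <- enum T) c)); first by apply: ler_sum.
by rewrite big_enum sumr_const mulr_natl.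
Qed.

End unions.

Section grid.
Context {R : realType} {d : nat} {dO : measure_display} {O : measurableType dO}.
Variables (P : probability O R) (X : nat -> O -> 'I_d -> R).
Hypothesis mX : forall i k, measurable_fun setT (fun w => X i w k).
Local Notation F := (dist_fun P X).
Hypothesis modulus0 : forall e : R, 0 < e -> exists2 y, 0 < y & modulus_cont F y <= e.

Definition grid_phi (q : nat) (a : 'I_d -> nat) : ('I_d -> R) -> R :=
  phi P X (fun k => (a k)%:R / 2 ^+ q) (fun k => (a k).+1%:R / 2 ^+ q).

(* low and up are the Hoelder brackets of the quadrant whose marginal levels lie
   in the cells m: below and above it by one cell. The clipping keeps the cells
   inside [0, 1]. *)
Definition low (q : nat) (m : 'I_d -> nat) :=
  grid_phi q (fun k => minn (m k).-1 (2 ^ q - 2)).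

Definition up (q : nat) (m : 'I_d -> nat) :=
  grid_phi q (fun k => minn (m k).+1 (2 ^ q - 1)).

Definition lev (q : nat) (t : 'I_d -> \bar R) (k : 'I_d) : nat :=
  Num.truncn (2 ^+ q * marg P X k (t k)).

Lemma lev_itv q t k : (lev q t k)%:R <= 2 ^+ q * marg P X k (t k) < (lev q t k).+1%:R.
Proof. by apply: truncn_itv; rewrite mulr_ge0// marg_ge0. Qed.

Lemma lev_le q t k : (lev q t k <= 2 ^ q)%N.
Proof.
have /andP[h _] := lev_itv q t k; rewrite -(ler_nat R) natrX; apply: le_trans h _.
by rewrite -[leRHS]mulr1; apply: ler_wpM2l => //; exact: marg_le1.
Qed.

Lemma lev_half q t k : lev q t k = (lev q.+1 t k)./2.
Proof.
apply: truncn_def; have := lev_itv q.+1 t k; rewrite exprS -mulrA.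
set n := lev q.+1 t k; set z := _ * marg _ _ _ _ => /andP[h1 h2].
have e1 : n./2%:R * 2 <= n%:R :> R by rewrite -natrM ler_nat; lia.
have e2 : n.+1%:R <= n./2.+1%:R * 2 :> R by rewrite -natrM ler_nat; lia.
by apply/andP; split; lra.
Qed.

Lemma low_half q t : low q (lev q t) = low q (fun k => (lev q.+1 t k)./2).
Proof. by congr low; apply/funext => k; exact: lev_half. Qed.

(** Everything is written on the grid of level l + 1, so that links within a level and between two
    levels are treated alike; 8 cells of that grid have total length 4 * 2^(-l). *)
Let is_link_cells l (lo hi a a' b b' : 'I_d -> nat) :
  (forall k, [&& lo k <= a k, a k < a' k, a' k <= hi k, lo k <= b k, b k < b' k,
     b' k <= hi k, hi k <= 2 ^ l.+1 & hi k <= lo k + 8]%N) ->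
  is_link P X l (fun x =>
    phi P X (fun k => (a k)%:R / 2 ^+ l.+1) (fun k => (a' k)%:R / 2 ^+ l.+1) x -
    phi P X (fun k => (b k)%:R / 2 ^+ l.+1) (fun k => (b' k)%:R / 2 ^+ l.+1) x).
Proof.
move=> H; set N : R := 2 ^+ l.+1.
have N0 : 0 < N by rewrite exprn_gt0.
exists (fun k => (lo k)%:R / N), (fun k => (hi k)%:R / N).
exists (fun k => (a k)%:R / N), (fun k => (a' k)%:R / N).
exists (fun k => (b k)%:R / N), (fun k => (b' k)%:R / N).
have gap (m m' : nat) : (m < m')%N -> N^-1 <= m'%:R / N - m%:R / N.
  move=> mm'; rewrite -mulrBl -[leLHS]mul1r ler_pM2r ?invr_gt0// -natrB 1?ltnW//.
  by rewrite (ler_nat R 1) subn_gt0.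
split => //; last first.
- move=> k; have /and5P[_ _ _ _ /and4P[_ _ _ h]] := H k.
  have -> : 4 / 2 ^+ l = 8 / N by rewrite /N exprS; field.
  by rewrite -mulrBl ler_pM2r ?invr_gt0// lerBlDl -natrD ler_nat.
- by split => k; have /and5P[? ? ? ? /and4P[? ? _ _]] := H k; exact: gap.
- move=> k; have /and5P[? ? ? ? /and4P[? ? h _]] := H k; split.
  + by rewrite divr_ge0// ltW.
  + by rewrite ler_pdivrMr// mul1r /N -natrX ler_nat.
  + by rewrite ler_pM2r ?invr_gt0// ler_nat.
  + by rewrite ltr_pM2r ?invr_gt0// ltr_nat.
  + by rewrite ler_pM2r ?invr_gt0// ler_nat.
- move=> k; have /and5P[? ? ? ? /and4P[? ? h _]] := H k; split.
  + by rewrite divr_ge0// ltW.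
  + by rewrite ler_pdivrMr// mul1r /N -natrX ler_nat.
  + by rewrite ler_pM2r ?invr_gt0// ler_nat.
  + by rewrite ltr_pM2r ?invr_gt0// ltr_nat.
  + by rewrite ler_pM2r ?invr_gt0// ler_nat.
Qed.

Let grid_phiE q a : grid_phi q a =
  phi P X (fun k => (2 * a k)%:R / 2 ^+ q.+1) (fun k => (2 * (a k).+1)%:R / 2 ^+ q.+1).
Proof.
rewrite /grid_phi; congr phi; apply/funext => k; rewrite exprS natrM; by field.
Qed.

Let pow2 l : exists N, [/\ (0 < N)%N, (2 ^ l = N)%N & (2 ^ l.+1 = 2 * N)%N].
Proof. by exists (2 ^ l)%N; rewrite expn_gt0 expnS. Qed.

Lemma link_refine l m : (forall k, m k <= 2 ^ l.+1)%N ->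
  is_link P X l (fun x => low l.+1 m x - low l (fun k => (m k)./2) x).
Proof.
have [N [N0 E1 E2]] := pow2 l; move=> mN.
rewrite /low (grid_phiE l) /grid_phi.
apply: (@is_link_cells l
  (fun k => minn (minn (m k).-1 (2 ^ l.+1 - 2)) (2 * (minn (m k)./2.-1 (2 ^ l - 2))))%N
  (fun k => maxn (minn (m k).-1 (2 ^ l.+1 - 2)).+1 (2 * (minn (m k)./2.-1 (2 ^ l - 2)).+1))%N).
by move=> k; have := mN k; rewrite E1 E2 => h; lia.
Qed.

(** For the continuity of the limit: nearby points may lie in different cells of the same level. *)
Lemma link_neighbor l m m' : (forall k, m' k <= 2 ^ l)%N ->
  (forall k, m k <= m' k <= (m k).+1)%N ->
  is_link P X l (fun x => low l m x - low l m' x).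
Proof.
have [N [N0 E1 E2]] := pow2 l; move=> mN mm'.
rewrite /low !(grid_phiE l).
apply: (@is_link_cells l
  (fun k => 2 * (minn (m k).-1 (2 ^ l - 2)))%N
  (fun k => 2 * (minn (m' k).-1 (2 ^ l - 2)).+1)%N).
by move=> k; have := mN k; have := mm' k; rewrite E1 E2 => /andP[? ?] h; lia.
Qed.

Lemma link_bracket l m : (forall k, m k <= 2 ^ l)%N ->
  is_link P X l (fun x => up l m x - low l m x).
Proof.
have [N [N0 E1 E2]] := pow2 l; move=> mN.
rewrite /low /up !(grid_phiE l).
apply: (@is_link_cells l
  (fun k => 2 * (minn (m k).-1 (2 ^ l - 2)))%N
  (fun k => 2 * (minn (m k).+1 (2 ^ l - 1)).+1)%N).
by move=> k; have := mN k; rewrite E1 E2 => h; lia.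
Qed.

Lemma bmeas_link l f i : is_link P X l f -> bmeas (fun w => f (X i w)).
Proof.
move=> [lo [hi [u [v [u' [v' [b b' _ _ ->]]]]]]].
by apply: bmeasB; apply: (bmeas_phi mX modulus0) => k; [have [] := b k|have [] := b' k].
Qed.

Lemma link_expect l f : is_link P X l f ->
  expectR P (fun w => `|f (X 0%N w)|) <= 4 * d%:R / 2 ^+ l.
Proof.
move=> [lo [hi [u [v [u' [v' [b b' _ g ->]]]]]]].
apply: le_trans (expect_phi_close mX modulus0 b b') _.
apply: (@le_trans _ _ (\sum_(k < d) 4 / 2 ^+ l)); first exact: ler_sum.
by rewrite sumr_const card_ord -[leLHS]mulr_natl mulrA (mulrC d%:R).
Qed.

Let cell01 q (i : nat) : (i < 2 ^ q)%N ->
  [/\ 0 <= i%:R / 2 ^+ q :> R, i%:R / 2 ^+ q < i.+1%:R / 2 ^+ q :> R & i.+1%:R / 2 ^+ q <= 1 :> R].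
Proof.
have N0 : 0 < 2 ^+ q :> R by rewrite exprn_gt0.
move=> h; split; first by rewrite divr_ge0// ltW.
  by rewrite ltr_pM2r ?invr_gt0// ltr_nat.
by rewrite ler_pdivrMr// mul1r -natrX ler_nat.
Qed.

Let prod_indic (b : 'I_d -> bool) :
  (if [forall k, b k] then 1 else 0 : R) = \prod_k ((b k)%:R : R).
Proof.
case: ifP => [/forallP H|/negbT]; first by rewrite big1// => k _; rewrite H.
rewrite negb_forall => /existsP[k bk]; rewrite (bigD1 k)//= (negbTE bk) mul0r//.
Qed.

Lemma low_le_indic q t x : (0 < q)%N -> low q (lev q t) x <=
  if [forall k, ((x k)%:E <= t k)%E] then 1 else 0.
Proof.
move=> q0; rewrite (prod_indic (fun k => (x k)%:E <= t k)%E) /low /grid_phi /phi.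
apply: ler_prod => k _; set i := minn _ _.
have N2 : (2 <= 2 ^ q)%N by rewrite -[X in (X <= _)%N](expn1 2) leq_pexp2l.
(* The clipping at 2^q - 2 keeps the upper level below 1, where the ramp would be constantly 1 and
   no lower bracket. *)
have iN : (i.+1 < 2 ^ q)%N by rewrite /i; lia.
have [c0 c1 c2] := cell01 (ltnW iN).
have v1 : i.+1%:R / 2 ^+ q < 1 :> R.
  by rewrite ltr_pdivrMr ?exprn_gt0// mul1r -natrX ltr_nat.
have /andP[-> _] /= := ramp01 P X k (i%:R / 2 ^+ q) (i.+1%:R / 2 ^+ q) (x k).
(* The predecessor of cell 0 is again 0, and a ramp with lower level 0 and upper level below 1
   vanishes. *)
have [l0|l0] := posnP (lev q t k).
  move: v1; rewrite /i l0 min0n /ramp mul0r lexx ltNge => /negbTE ->.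
  exact: ler0n.
have /andP[_ h] := ramp_between mX modulus0 k (x k) c0 c1 c2.
apply: le_trans h _; rewrite ler_nat /upto leNgt v1 /=.
case: (boolP ((x k)%:E <= quantile P X k (i.+1%:R / 2 ^+ q))%E) => // xq.
suff -> : ((x k)%:E <= t k)%E by [].
apply: le_trans xq _; rewrite quantile_le//; last by rewrite c2 (le_trans c0) ?ltW.
have /andP[h1 _] := lev_itv q t k.
rewrite ler_pdivrMr ?exprn_gt0// mulrC; apply: le_trans h1.
by rewrite ler_nat /i; lia.
Qed.

Lemma indic_le_up q t x :
  (if [forall k, ((x k)%:E <= t k)%E] then 1 else 0) <= up q (lev q t) x.
Proof.
rewrite (prod_indic (fun k => (x k)%:E <= t k)%E) /up /grid_phi /phi.
apply: ler_prod => k _; rewrite ler0n /=; set i := minn _ _.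
have N1 : (0 < 2 ^ q)%N by rewrite expn_gt0.
have iN : (i < 2 ^ q)%N by rewrite /i; lia.
have [c0 c1 c2] := cell01 iN.
(* In the last cell the ramp is constantly 1 and bounds any indicator. *)
have [iN'|iN'] := leqP (2 ^ q) i.+1.
  rewrite /ramp ifT; first by case: (_ <= _)%E.
  by rewrite ler_pdivlMr ?exprn_gt0// mul1r -natrX ler_nat.
have /andP[h _] := ramp_between mX modulus0 k (x k) c0 c1 c2.
apply: le_trans h; rewrite ler_nat /upto.
case: (boolP ((x k)%:E <= t k)%E) => // xt.
suff -> : ((x k)%:E <= quantile P X k (i%:R / 2 ^+ q))%E by rewrite orbT.
apply: le_trans xt _; apply: ltW; rewrite ltNge quantile_le//; last by rewrite c0 (le_trans _ c2) ?ltW.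
rewrite -ltNge ltr_pdivlMr ?exprn_gt0// mulrC.
have /andP[_ h1] := lev_itv q t k; apply: lt_le_trans h1 _.
by rewrite ler_nat /i; lia.
Qed.

Lemma low_bmeas q m i : bmeas (fun w => low q m (X i w)).
Proof.
by apply: (bmeas_phi mX modulus0) => k; rewrite ltr_pM2r ?invr_gt0 ?exprn_gt0// ltr_nat.
Qed.

Lemma up_bmeas q m i : bmeas (fun w => up q m (X i w)).
Proof.
by apply: (bmeas_phi mX modulus0) => k; rewrite ltr_pM2r ?invr_gt0 ?exprn_gt0// ltr_nat.
Qed.

End grid.

Lemma expr_small {R : realType} (x e : R) : 0 < x < 1 -> 0 < e ->
  exists N, forall n, (N <= n)%N -> x ^+ n <= e.
Proof.
move=> /andP[x0 x1] e0.
have x1' : `|x| < 1 by rewrite ger0_norm// ltW.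
have /cvgrPdist_le/(_ _ e0)[N _ HN] := cvg_expr x1'.
exists N => n Nn; have := HN n Nn; rewrite /= sub0r normrN; exact: le_trans (ler_norm _).
Qed.

Lemma level_card_le {R : realType} (d l : nat) :
  #|{ffun 'I_d -> 'I_(2 ^ l.+1).+1}|%:R <= 3 ^+ d * (2 ^+ d) ^+ l :> R.
Proof.
rewrite card_ffun !card_ord natrX exprAC -exprMn; apply: lerXn2r; rewrite ?nnegrE.
- exact: ler0n.
- by rewrite mulr_ge0// exprn_ge0.
by rewrite -natrX -natrM ler_nat expnS; have := expn_gt0 2 l; lia.
Qed.

(** * Uniform approximation of the empirical process by brackets *)

Section approximation.
Context {R : realType} {d : nat} {dO : measure_display} {O : measurableType dO}.
Variables (P : probability O R) (X : nat -> O -> 'I_d -> R).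
Hypothesis mX : forall i k, measurable_fun setT (fun w => X i w k).
Local Notation F := (dist_fun P X).
Hypothesis modulus0 : forall e : R, 0 < e -> exists2 y, 0 < y & modulus_cont F y <= e.
Variables (A x y : R) (p : nat).
Hypothesis A0 : 0 <= A.
Hypothesis x01 : 0 < x < 1.
Hypothesis y01 : 0 < y < 1.
Hypothesis tail : forall K e l f n, 1 <= K -> 0 < e -> is_link P X l f -> (1 <= n)%N ->
  4 ^+ l <= K * n%:R ->
  fine (P [set w | e * x ^+ l < `|emp P X n f w|]) <=
  A * K ^+ p / e ^+ (2 * p) * y ^+ l / (2 ^+ d) ^+ l.

Let indic (t : 'I_d -> \bar R) (z : 'I_d -> R) : R :=
  if [forall k, ((z k)%:E <= t k)%E] then 1 else 0.

Let indicE t i : (fun w => indic t (X i w)) = \1_[set w | forall k, ((X i w k)%:E <= t k)%E].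
Proof.
apply/funext => w; rewrite /indic indicE; case: ifPn => h.
  by rewrite mem_set//= => k; exact: (forallP h k).
by rewrite memNset//= => H; move/negP: h; apply; apply/forallP.
Qed.

Let bindic t i : bmeas (fun w => indic t (X i w)).
Proof. by rewrite indicE; apply: bmeas_indic; exact: measurable_below_all. Qed.

Lemma emp_processE n w t : emp_process P X n w t = emp P X n (indic t) w.
Proof.
rewrite /emp_process /emp; congr (_ * _); apply: eq_bigr => i _; congr (_ - _).
by rewrite indicE expectR_indic//; exact: measurable_below_all.
Qed.

Let sqrt_inv n : (Num.sqrt n%:R)^-1 * n%:R = Num.sqrt n%:R :> R.
Proof.
case: n => [|n]; first by rewrite sqrtr0 mulr0.
rewrite -[X in _ * X]sqr_sqrtr// expr2 mulKf// gt_eqF// sqrtr_gt0 ltr0n//.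
Qed.

Let expect_up_low q m l : (forall k, m k <= 2 ^ q)%N -> l = 4 * d%:R / 2 ^+ q ->
  expectR P (fun w => up P X q m (X 0%N w) - low P X q m (X 0%N w)) <= l.
Proof.
move=> mq ->; apply: le_trans (link_expect mX modulus0 (link_bracket P X mq)).
apply: le_expectR.
- by apply: bmeasB; [exact: up_bmeas|exact: low_bmeas].
- by apply: bmeas_norm; apply: bmeasB; [exact: up_bmeas|exact: low_bmeas].
- by move=> w; exact: ler_norm.
Qed.

(** The indicator minus [low] lies between 0 and [up] - [low]. Centering costs sqrt(n) times a mean,
    and the mean of [up] - [low] is at most 4 d / 2^q. *)
Lemma emp_process_bracket q t n w : (0 < q)%N ->
  `|emp_process P X n w t - emp P X n (low P X q (lev P X q t)) w| <=
  `|emp P X n (fun z => up P X q (lev P X q t) z - low P X q (lev P X q t) z) w| +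
  Num.sqrt n%:R * (4 * d%:R / 2 ^+ q).
Proof.
move=> q0; set lo := low _ _ _ _; set hi := up _ _ _ _.
have blo i : bmeas (fun w => lo (X i w)) by exact: low_bmeas.
have bhi i : bmeas (fun w => hi (X i w)) by exact: up_bmeas.
rewrite emp_processE -empB//.
pose f z := indic t z - lo z; pose g z := hi z - lo z.
have fg z : 0 <= f z <= g z.
  rewrite /f /g subr_ge0 lerD2r /lo /hi.
  by apply/andP; split; [exact: low_le_indic|exact: indic_le_up].
have sumE h : emp P X n h w = (Num.sqrt n%:R)^-1 * (\sum_(1 <= i < n.+1) h (X i w)) -
    Num.sqrt n%:R * expectR P (fun w => h (X 0%N w)).
  by rewrite /emp sumrB mulrBr sumr_const_nat subn1 /= -(mulr_natl (expectR _ _)) mulrA sqrt_inv.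
rewrite -/f -/g !sumE.
set s := (Num.sqrt n%:R)^-1; have s0 : 0 <= s by rewrite invr_ge0.
have bf : bmeas (fun w => f (X 0%N w)) by apply: bmeasB.
have bg : bmeas (fun w => g (X 0%N w)) by apply: bmeasB.
have Ef : 0 <= expectR P (fun w => f (X 0%N w)).
  by apply: expectR_ge0 => z; have /andP[] := fg (X 0%N z).
have Eg : expectR P (fun w => f (X 0%N w)) <= expectR P (fun w => g (X 0%N w)).
  by apply: le_expectR => // z; have /andP[] := fg (X 0%N z).
have Eg' : expectR P (fun w => g (X 0%N w)) <= 4 * d%:R / 2 ^+ q.
  by apply: expect_up_low => // k; exact: lev_le.
have Sf : 0 <= s * \sum_(1 <= i < n.+1) f (X i w).
  by apply: mulr_ge0 => //; apply: sumr_ge0 => i _; have /andP[] := fg (X i w).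
have Sg : s * \sum_(1 <= i < n.+1) f (X i w) <= s * \sum_(1 <= i < n.+1) g (X i w).
  by apply: ler_wpM2l => //; apply: ler_sum => i _; have /andP[] := fg (X i w).
have r0 : 0 <= Num.sqrt n%:R :> R by exact: sqrtr_ge0.
move: Sf Sg (ler_wpM2l r0 Ef) (ler_wpM2l r0 Eg) (ler_wpM2l r0 Eg'); rewrite mulr0.
move: (s * _) (s * _) (_ * expectR _ _) (_ * expectR _ _) (_ * (4 * _ / _)) => a b c e h.
move=> b0 ba e0 ec ch; have h1 := ler_norm (a - c); have h2 := normr_ge0 (a - c).
by rewrite ler_norml; apply/andP; split; lra.
Qed.


Let level_bad e n l (g : ('I_d -> nat) -> ('I_d -> R) -> R) : set O :=
  [set w | exists m : {ffun 'I_d -> 'I_(2 ^ l.+1).+1},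
     e * x ^+ l < `|emp P X n (g (fun k => nat_of_ord (m k))) w|].

Let level_badP K e n l g : 1 <= K -> 0 < e -> (1 <= n)%N -> 4 ^+ l <= K * n%:R ->
  (forall m, (forall k, m k <= 2 ^ l.+1)%N -> is_link P X l (g m)) ->
  measurable (level_bad e n l g) /\
  fine (P (level_bad e n l g)) <= 3 ^+ d * (A * K ^+ p / e ^+ (2 * p)) * y ^+ l.
Proof.
move=> K1 e0 n1 lK lg'.
have lg (m : {ffun 'I_d -> 'I_(2 ^ l.+1).+1}) : is_link P X l (g (fun k => nat_of_ord (m k))).
  by apply: lg' => k; rewrite -ltnS.
have mE (m : {ffun 'I_d -> 'I_(2 ^ l.+1).+1}) :
    measurable [set w | e * x ^+ l < `|emp P X n (g (fun k => nat_of_ord (m k))) w|].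
  apply: measurable_gt_norm.
  by have [] := bmeas_emp P n (fun i => bmeas_link mX modulus0 i (lg m)).
have [mB PB] := union_bound_fin mE (fun m => tail K1 e0 (lg m) n1 lK).
split=> //; apply: le_trans PB _.
have d0 : 0 < (2 ^+ d) ^+ l :> R by rewrite !exprn_gt0.
have [y0 _] := andP y01.
have D0 : 0 <= A * K ^+ p / e ^+ (2 * p) * y ^+ l.
  by rewrite !mulr_ge0 ?invr_ge0 ?exprn_ge0// ?(ltW e0)// ?(ltW y0)// (le_trans ler01).
apply: le_trans (ler_wpM2r _ (level_card_le d l)) _; first by rewrite divr_ge0// ltW.
rewrite le_eqVlt; apply/orP; left; apply/eqP.
move: (A * _ / _) ((2 ^+ d) ^+ l) d0 => D z z0.
by rewrite -!mulrA; congr (_ * _); rewrite mulrC -!mulrA mulVf ?mulr1// gt_eqF.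
Qed.

Let to_ffun l (t : 'I_d -> nat) : (forall k, t k <= 2 ^ l.+1)%N ->
  exists m : {ffun 'I_d -> 'I_(2 ^ l.+1).+1}, (fun k => nat_of_ord (m k)) = t.
Proof.
move=> tl; exists [ffun k => inord (t k)]; apply/funext => k.
by rewrite ffunE inordK// ltnS.
Qed.

(* Chaining from level q up to the level at which a cell has probability of
   order n^(-1/2): from there on, the bracket of emp_process_bracket is small. *)
Lemma emp_approx eps eta : 0 < eps -> 0 < eta -> exists q0, forall q, (q0 <= q)%N ->
  exists n0, forall n, (n0 <= n)%N -> exists B : set O,
  [/\ measurable B, fine (P B) <= eta & forall w, ~ B w -> forall t,
    `|emp_process P X n w t - emp P X n (low P X q (lev P X q t)) w| <= eps].
Proof.
move=> eps0 eta0; have [x0 x1] := andP x01; have [y0 y1] := andP y01.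
have quarters : eps / 4 + eps / 4 + eps / 4 <= eps by lra.
(* If 2^Q >= c sqrt(n), the bracket term 4 d sqrt(n) / 2^Q is at most eps / 4. For the least such Q,
   2^Q is at most 2 c sqrt(n), that is, 4^Q <= K n. *)
pose c := Num.max 1 (16 * d%:R / eps); pose K := 4 * c ^+ 2.
have c1 : 1 <= c by rewrite le_max lexx.
have cd : 16 * d%:R / eps <= c by rewrite le_max lexx orbT.
have K1 : 1 <= K.
  have : 1 <= c ^+ 2 by rewrite exprn_ege1.
  by rewrite /K; lra.
(* The thresholds e x^l then sum to at most e / (1 - x) = eps / 4. *)
pose e := (1 - x) * eps / 4.
have e0 : 0 < e by rewrite /e !mulr_gt0// subr_gt0.
pose G := 3 ^+ d * (A * K ^+ p / e ^+ (2 * p)).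
have G0 : 0 <= G.
  by rewrite !mulr_ge0 ?invr_ge0 ?exprn_ge0// ?(ltW e0)// (le_trans ler01).
pose H := G / (1 - y) + G.
have H0 : 0 <= H by rewrite addr_ge0// divr_ge0// subr_ge0 ltW.
have [N HN] := expr_small y01 (divr_gt0 eta0 (ltr_wpDl H0 ltr01)).
exists N.+1 => q Nq.
have q0 : (0 < q)%N by apply: leq_trans Nq.
(* This forces 2^q < sqrt(n) <= 2^Q, so the chaining starts below the level where it ends. *)
exists (4 ^ q).+1 => n nq.
have n1 : (1 <= n)%N by apply: leq_trans nq.
have n0 : 0 < n%:R :> R by rewrite ltr0n.
have s0 : 0 < Num.sqrt n%:R :> R by rewrite sqrtr_gt0.
have ex : exists Q, c * Num.sqrt n%:R <= 2 ^+ Q.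
  exists (Num.bound (c * Num.sqrt n%:R)); apply: ltW; apply: upper_nthrootP; exact: leqnn.
case: (ex_minnP ex) => Q HQ Qmin.
have sc : Num.sqrt n%:R <= c * Num.sqrt n%:R by rewrite ler_peMl// ltW.
have qQ : (q < Q)%N.
  rewrite ltnNge; apply/negP => Qq.
  have : 4 ^+ q < n%:R :> R by rewrite -natrX ltr_nat.
  rewrite -[n%:R]sqr_sqrtr// (_ : 4 = 2 ^+ 2); last by rewrite expr2 -natrM.
  rewrite exprAC ltr_pXn2r ?nnegrE ?exprn_ge0 ?ltW// ltNge => /negP; apply.
  apply: le_trans (le_trans sc HQ) _; rewrite ler_weXn2l// ler1n//.
have QK l : (l <= Q)%N -> 4 ^+ l <= K * n%:R.
  move=> lQ; apply: (@le_trans _ _ (4 ^+ Q)); first by rewrite ler_weXn2l// ler1n.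
  have Q1 : (Q.-1 < Q)%N by case: (Q) qQ.
  have : ~~ (c * Num.sqrt n%:R <= 2 ^+ Q.-1).
    by apply/negP => /Qmin; rewrite leqNgt Q1.
  rewrite -ltNge => /ltW h.
  have -> : 4 ^+ Q = 4 * (2 ^+ Q.-1) ^+ 2 :> R.
    rewrite -{1}(ltn_predK Q1) exprS exprAC; congr (_ * _ ^+ _); rewrite expr2 -natrM//.
  rewrite /K -mulrA; apply: ler_wpM2l => //.
  rewrite -[n%:R]sqr_sqrtr// -exprMn; apply: lerXn2r => //; rewrite nnegrE ?exprn_ge0//.
  by apply: mulr_ge0; [exact: le_trans c1|exact: ltW].
pose lk l (m : 'I_d -> nat) z := low P X l.+1 m z - low P X l (fun k => (m k)./2) z.
(* [level_badP] asks for a link at every m up to 2^(l+1), while brackets are links for m up to 2^l;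
   the remaining m get a refinement as a filler. *)
pose br l (m : 'I_d -> nat) :=
  if [forall k, (m k <= 2 ^ l)%N] then (fun z => up P X l m z - low P X l m z) else lk l m.
have lkP l : (q <= l < Q)%N -> measurable (level_bad e n l (lk l)) /\
    fine (P (level_bad e n l (lk l))) <= G * y ^+ l.
  move=> /andP[ql lQ]; apply: level_badP => //; first by apply: QK; exact: ltnW.
  by move=> m; exact: link_refine.
have [mbr Pbr] : measurable (level_bad e n Q (br Q)) /\
    fine (P (level_bad e n Q (br Q))) <= G * y ^+ Q.
  apply: level_badP => //; first exact: QK.
  move=> m mQ; rewrite /br; case: ifPn => h; last exact: link_refine.
  by apply: link_bracket => k; exact: (forallP h k).
pose E l := if (q <= l < Q)%N then level_bad e n l (lk l) else set0.
have mE l : measurable (E l).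
  by rewrite /E; case: ifPn => // h; have [] := lkP l h.
exists ([set w | exists2 l, l \in index_iota q Q & E l w] `|` level_bad e n Q (br Q)).
have mU := measurable_exists_in (index_iota q Q) mE.
split.
- exact: measurableU.
- apply: (@le_trans _ _ (G * y ^+ q / (1 - y) + G * y ^+ q)).
    apply: (@le_trans _ _ (fine (P [set w | exists2 l, l \in index_iota q Q & E l w]) +
        fine (P (level_bad e n Q (br Q))))).
      rewrite -lee_fin EFinD !fineK ?probability_fin_num//; last exact: measurableU.
      exact: measureU2.
    apply: lerD.
      apply: le_trans (union_bound P (index_iota q Q) mE) _.
      apply: le_trans (sum_geometric_le q Q G0 y01).
      apply: ler_sum_nat => l ql; rewrite /E ql; have [] := lkP l ql; by [].
    apply: le_trans Pbr _; apply: ler_wpM2l => //.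
    by apply: ler_wiXn2l; rewrite ?ltW// ltnW.
  have h := HN q (ltnW Nq); rewrite ler_pdivlMr ?ltr_wpDl// in h.
  apply: le_trans h.
  have -> : G * y ^+ q / (1 - y) + G * y ^+ q = y ^+ q * H by rewrite /H; ring.
  by apply: ler_wpM2l; [rewrite exprn_ge0// ltW|rewrite lerDl].
- move=> w /not_orP[wE wbr] t.
  have lkw l : (q <= l < Q)%N ->
      `|emp P X n (low P X l.+1 (lev P X l.+1 t)) w - emp P X n (low P X l (lev P X l t)) w|
      <= e * x ^+ l.
    move=> ql; rewrite (low_half P X l t) -empB; [|exact: low_bmeas|exact: low_bmeas].
    rewrite leNgt; apply/negP => h; apply: wE; exists l; first by rewrite mem_index_iota.
    rewrite /E ql; have [m mt] := to_ffun (fun k => lev_le P mX l.+1 t k).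
    by exists m => /=; rewrite mt.
  have chain : `|emp P X n (low P X Q (lev P X Q t)) w - emp P X n (low P X q (lev P X q t)) w|
      <= e * x ^+ q / (1 - x).
    have := telescope_sumr (fun l => emp P X n (low P X l (lev P X l t)) w) (ltnW qQ).
    move=> <-; apply: le_trans (ler_norm_sum _ _ _) _.
    apply: le_trans (sum_geometric_le q Q (ltW e0) x01).
    by apply: ler_sum_nat => l ql; exact: lkw.
  have brw : `|emp P X n (fun z => up P X Q (lev P X Q t) z - low P X Q (lev P X Q t) z) w|
      <= e * x ^+ Q.
    rewrite leNgt; apply/negP => h; apply: wbr.
    have tQ k : (lev P X Q t k <= 2 ^ Q.+1)%N.
      by apply: leq_trans (lev_le P mX Q t k) _; rewrite leq_pexp2l.
    have [m mt] := to_ffun tQ; exists m => /=; rewrite mt.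
    have -> : br Q (lev P X Q t) =
        (fun z => up P X Q (lev P X Q t) z - low P X Q (lev P X Q t) z); last by [].
    rewrite /br; case: ifPn => // /negP; case.
    by apply/forallP => k; exact: lev_le.
  have Q0 : (0 < Q)%N by apply: leq_trans qQ.
  have := emp_process_bracket t n w Q0.
  have x_le1 i : x ^+ i <= 1 by rewrite exprn_ile1// ltW.
  have ex1 : e * x ^+ Q <= e / (1 - x).
    rewrite ler_pdivlMr ?subr_gt0// -mulrA -[leRHS]mulr1; apply: ler_wpM2l; first exact: ltW.
    rewrite -[leRHS]mulr1; by apply: ler_pM => //; [apply: exprn_ge0; lra|lra|lra].
  have ex2 : e * x ^+ q / (1 - x) <= e / (1 - x).
    rewrite ler_pM2r ?invr_gt0 ?subr_gt0// -[leRHS]mulr1; apply: ler_wpM2l => //; exact: ltW.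
  have eE : e / (1 - x) = eps / 4.
    by rewrite /e; field; rewrite gt_eqF// subr_gt0.
  have last_le : Num.sqrt n%:R * (4 * d%:R / 2 ^+ Q) <= eps / 4.
    rewrite mulrA ler_pdivrMr ?exprn_gt0//.
    apply: (@le_trans _ _ (eps / 4 * (c * Num.sqrt n%:R))); last first.
      by apply: ler_wpM2l => //; rewrite divr_ge0// ltW.
    rewrite mulrA [leLHS]mulrC; apply: ler_wpM2r; first exact: ltW.
    move: cd; rewrite ler_pdivrMr// => cd; lra.
  move=> bk; rewrite eE in ex1 ex2.
  apply: le_trans (ler_distD (emp P X n (low P X Q (lev P X Q t)) w) _ _) _.
  apply: le_trans (lerD bk chain) _.
  exact: le_trans (lerD (lerD (le_trans brw ex1) last_le) ex2) quarters.
Qed.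

End approximation.

(** * The limit process *)

Section limit_field.
Context {R : realType} {d : nat} {dO : measure_display} {O : measurableType dO}.
Variables (P : probability O R) (X : nat -> O -> 'I_d -> R).
Hypothesis mX : forall i k, measurable_fun setT (fun w => X i w k).
Local Notation F := (dist_fun P X).
Hypothesis modulus0 : forall e : R, 0 < e -> exists2 y, 0 < y & modulus_cont F y <= e.
Variable alpha : R.
Hypothesis alpha01 : 0 < alpha <= 1.
Hypothesis clt : forall f : ('I_d -> R) -> R, in_Holder alpha f ->
  expectR P (fun w => f (X 0%N w)) = 0 ->
  exists2 sigma2 : R, 0 <= sigma2 &
    cvg_dist_normal P
      (fun n w => (Num.sqrt n%:R)^-1 * \sum_(1 <= i < n.+1) f (X i w)) sigma2.
Hypothesis second_moment : forall (f : ('I_d -> R) -> R) Z,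
  (forall i, bmeas (fun w => f (X i w))) -> (forall x, `|f x| <= 1) -> 0 <= Z ->
  (forall x y, `|f x - f y| <= Z * edistR x y `^ alpha) ->
  exists c : R, forall n, (\int[P]_w (`|emp P X n f w| ^+ 2)%:E <= c%:E)%E.

(** A level and a cell, the latter as a finite function: the index set is countable, so the joint
    law can be coded by one bit sequence. *)
Definition gidx : countType := (nat * {ffun 'I_d -> nat})%type.

Definition gfun (i : gidx) : ('I_d -> R) -> R := low P X i.1 (fun k => i.2 k).

Definition cell (q : nat) (m : 'I_d -> nat) : gidx := (q, [ffun k => m k]).

Lemma gfun_cell q m : gfun (cell q m) = low P X q m.
Proof. by rewrite /gfun /=; congr low; apply/funext => k; rewrite ffunE. Qed.

Let Y n i := emp P X n (gfun i).

Let bgfun i j : bmeas (fun w => gfun i (X j w)).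
Proof. exact: low_bmeas. Qed.

Let mY n i : measurable_fun setT (Y n i).
Proof. by have [] := bmeas_emp P n (bgfun i). Qed.

Let gfun1 i x : `|gfun i x| <= 1.
Proof. by have /andP[? ?] := phi01 P X (fun k => (minn (i.2 k).-1 (2 ^ i.1 - 2))%:R / 2 ^+ i.1)
  (fun k => (minn (i.2 k).-1 (2 ^ i.1 - 2)).+1%:R / 2 ^+ i.1) x; rewrite ger0_norm. Qed.

Let gfun_hoelder i : exists2 Z, 0 <= Z &
  forall x y, `|gfun i x - gfun i y| <= Z * edistR x y `^ alpha.
Proof.
exists (\sum_k ramp_const P X alpha k ((minn (i.2 k).-1 (2 ^ i.1 - 2))%:R / 2 ^+ i.1)
   ((minn (i.2 k).-1 (2 ^ i.1 - 2)).+1%:R / 2 ^+ i.1)).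
  by apply: sumr_ge0 => k _; exact: ramp_const_ge0.
move=> x y; apply: (phi_hoelder mX modulus0) => // k.
by rewrite ltr_pM2r ?invr_gt0 ?exprn_gt0// ltr_nat.
Qed.

Let YC : exists C : gidx -> R, forall n i, (\int[P]_w (`|Y n i w| ^+ 2)%:E <= (C i)%:E)%E.
Proof.
suff /choice[C HC] : forall i, exists c : R, forall n, (\int[P]_w (`|Y n i w| ^+ 2)%:E <= c%:E)%E.
  by exists C => n i; exact: HC.
move=> i; have [Z Z0 HZ] := gfun_hoelder i.
exact: (second_moment (bgfun i) (gfun1 i) Z0 HZ).
Qed.

Let centered (t : seq (gidx * R)) (z : 'I_d -> R) : R :=
  \sum_(p <- t) p.2 * (gfun p.1 z - expectR P (fun w => gfun p.1 (X 0%N w))).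

Let lincomb_emp t n w : lincomb t (fun i => Y n i w) =
  (Num.sqrt n%:R)^-1 * \sum_(1 <= i < n.+1) centered t (X i w).
Proof.
rewrite /lincomb /Y /emp /centered exchange_big big_distrr /=.
by apply: eq_bigr => p _; rewrite mulrCA big_distrr.
Qed.

Let centered_in_Holder t : in_Holder alpha (centered t).
Proof.
suff [M [Z [Z0 HM HZ]]] : exists M Z, [/\ 0 <= Z, forall x, `|centered t x| <= M &
    forall x y, `|centered t x - centered t y| <= Z * edistR x y `^ alpha].
  split; first by exists M.
  by exists Z => x y _; apply: ler_div_junk => //; exact: powR_ge0.
rewrite /centered; elim: t => [|[i c] t [M [Z [Z0 HM HZ]]]].
  exists 0, 0; split => // [x|x y]; rewrite !big_nil ?subrr normr0 ?mul0r//.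
have [Zi Zi0 HZi] := gfun_hoelder i.
pose E := expectR P (fun w => gfun i (X 0%N w)).
exists (`|c| * (1 + `|E|) + M), (`|c| * Zi + Z); split.
- by rewrite addr_ge0// mulr_ge0.
- move=> x; rewrite big_cons /=; apply: le_trans (ler_normD _ _) _; apply: lerD => //.
  rewrite normrM; apply: ler_wpM2l => //; apply: le_trans (ler_normB _ _) _.
  by apply: lerD.
- move=> x y; rewrite !big_cons /= opprD addrACA mulrDl; apply: le_trans (ler_normD _ _) _.
  apply: lerD => //; rewrite -mulrBr opprB addrA subrK normrM -mulrA; exact: ler_wpM2l.
Qed.

Let centered_mean t : expectR P (fun w => centered t (X 0%N w)) = 0.
Proof.
rewrite /centered expectR_sum => [|p]; last first.
  by apply: bmeasZ; apply: bmeasB => //; exact: bmeas_cst.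
rewrite big1// => p _; rewrite expectRZ; last by apply: bmeasB => //; exact: bmeas_cst.
by rewrite expectRB//; [rewrite expectR_cst subrr mulr0|exact: bmeas_cst].
Qed.

Let clt_lincomb t : exists2 v : R, 0 <= v &
  cvg_dist_normal P (fun n w => lincomb t (fun i => Y n i w)) v.
Proof.
have [v v0 Hv] := clt (centered_in_Holder t) (centered_mean t); exists v => // g gM cg.
rewrite (_ : (fun n => _) = (fun n => expectR P (fun w =>
    g ((Num.sqrt n%:R)^-1 * \sum_(1 <= i < n.+1) centered t (X i w))))); first exact: Hv.
apply/funext => n; congr expectR; apply/funext => w; by rewrite lincomb_emp.
Qed.

Let fdlip_lincomb t L M (h : R -> R) : blip L M h ->
  exists s L', fdlip s L' M (fun x : gidx -> R => h (lincomb t x)).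
Proof.
move=> [L0 hL hM]; exists (map fst t), (L * \sum_(p <- t) `|p.2|).
have S0 : 0 <= \sum_(p <- t) `|p.2| by apply: sumr_ge0.
split => [|x y|x]; [exact: mulr_ge0| |exact: hM].
apply: le_trans (hL _ _) _; rewrite -mulrA; apply: ler_wpM2l => //.
rewrite /lincomb -sumrB; apply: le_trans (ler_norm_sum _ _ _) _.
rewrite big_map; elim: t S0 => [|[i c] t IH] S0; first by rewrite !big_nil mul0r.
have T0 : 0 <= \sum_(p <- t) `|p.2| by apply: sumr_ge0.
have D0 : 0 <= \sum_(p <- t) `|x p.1 - y p.1| by apply: sumr_ge0.
have aux (f g a b e : R) : a <= b * e -> 0 <= b -> 0 <= e -> 0 <= f -> 0 <= g ->
    f * g + a <= (f + b) * (g + e).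
  move=> abe b0 e0 f0 g0; rewrite mulrDl !mulrDr.
  by have := mulr_ge0 f0 e0; have := mulr_ge0 b0 g0; lra.
by rewrite !big_cons /= -mulrBr normrM; apply: aux => //; exact: IH.
Qed.

(** V realizes the limits along an ultrafilter U finer than [\oo]. Cramer-Wold gives limits along
    all n; they are also limits along U, so the two coincide, and the one-dimensional central limit
    theorem identifies the linear combinations. *)
Lemma limit_field : exists (Q : probability (measurableTypeR R) R) (V : gidx -> R -> R),
  [/\ forall i, measurable_fun setT (V i : measurableTypeR R -> R),
    forall s L M h, fdlip s L M h ->
      expectR P (fun w => h (fun i => emp P X n (gfun i) w)) @[n --> \oo] -->
      expectR Q (fun w => h (fun i => V i w)) &
    forall t, exists2 v, 0 <= v & forall L M h, blip L M h ->
      expectR Q (fun w => h (lincomb t (fun i => V i w))) = normal_expect v h].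
Proof.
have [C HC] := YC; have [U [UU UF]] := @ultraFilterLemma nat \oo _.
pose V := limit_var P U Y.
have cv s L M h : fdlip s L M h ->
    expectR P (fun w => h (fun i => Y n i w)) @[n --> \oo] -->
    expectR (uniform_prob (@ltr01 R)) (fun w => h (fun i => V i w)).
  move=> fh; have cU := cvg_expectR_limit_var UU mY HC fh.
  have c0 : cvg (expectR P (fun w => h (fun i => Y n i w)) @[n --> \oo]).
    apply: (cramer_wold mY HC) fh => t b; have [v v0 Hv] := clt_lincomb t.
    apply/cvg_ex; exists (normal_expect v (fun x => cos (x + b))).
    apply: (Hv (fun x => cos (x + b))).
      by exists 1 => x; rewrite ler_norml cos_geN1 cos_le1.
    move=> x; apply: continuous_comp; last exact: continuous_cos.
    by apply: cvgD => //; exact: cvg_cst.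
  have UP : ProperFilter U by case: UU.
  have cU' : expectR P (fun w => h (fun i => Y n i w)) @[n --> U] -->
      lim (expectR P (fun w => h (fun i => Y n i w)) @[n --> \oo]).
    by move=> B /c0; exact: UF.
  by rewrite (cvg_unique (@Rhausdorff R) cU cU').
exists (uniform_prob (@ltr01 R)), V; split => //; first exact: measurable_limit_var.
move=> t; have [v v0 Hv] := clt_lincomb t; exists v => // L M h hh.
have [s [L' fh]] := fdlip_lincomb t hh.
apply: (cvg_unique (@Rhausdorff R) (cv _ _ _ _ fh)).
apply: (Hv h); last exact: blip_continuous hh.
by have [_ _ hM] := hh; exists M.
Qed.

End limit_field.

Lemma cvg_le_near_ge {R : realType} (u : nat -> R) (l c : R) (N : nat) :
  u n @[n --> \oo] --> l -> (forall n, (N <= n)%N -> c <= u n) -> c <= l.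
Proof.
move=> ul uc; rewrite -(cvg_lim (@Rhausdorff R) ul).
by apply: limr_ge; [apply/cvg_ex; exists l|exists N].
Qed.

Lemma maxn_near (u v : nat) : (v <= u.+1)%N -> (u <= maxn u v <= u.+1)%N.
Proof. by move=> vu; rewrite leq_maxl geq_max leqnSn. Qed.

(** * Construction and continuity of the limit process *)

Section gaussian_limit.
Context {R : realType} {d : nat} {dO : measure_display} {O : measurableType dO}.
Variables (P : probability O R) (X : nat -> O -> 'I_d -> R).
Hypothesis mX : forall i k, measurable_fun setT (fun w => X i w k).
Local Notation F := (dist_fun P X).
Hypothesis modulus0 : forall e : R, 0 < e -> exists2 y, 0 < y & modulus_cont F y <= e.
Variables (A x y : R) (p : nat).
Hypothesis A0 : 0 <= A.
Hypothesis x01 : 0 < x < 1.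
Hypothesis y01 : 0 < y < 1.
Hypothesis tail : forall K e l f n, 1 <= K -> 0 < e -> is_link P X l f -> (1 <= n)%N ->
  4 ^+ l <= K * n%:R ->
  fine (P [set w | e * x ^+ l < `|emp P X n f w|]) <=
  A * K ^+ p / e ^+ (2 * p) * y ^+ l / (2 ^+ d) ^+ l.
Context {dW : measure_display} {OW : measurableType dW}.
Variables (Q : probability OW R) (V : @gidx d -> OW -> R).
Hypothesis mV : forall i, measurable_fun setT (V i).
Hypothesis cvgV : forall s L M h, fdlip s L M h ->
  expectR P (fun w => h (fun i => emp P X n (gfun P X i) w)) @[n --> \oo] -->
  expectR Q (fun w => h (fun i => V i w)).
Hypothesis gaussV : forall t, exists2 v, 0 <= v & forall L M h, blip L M h ->
  expectR Q (fun w => h (lincomb t (fun i => V i w))) = normal_expect v h.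

Local Notation gfun := (gfun P X).
Local Notation lev := (lev P X).

Let bgfun i j : bmeas (fun w => gfun i (X j w)).
Proof. exact: low_bmeas. Qed.

Let mE (Z : OW -> R) (e : R) : measurable_fun setT Z -> measurable [set w | e < `|Z w|].
Proof. exact: measurable_gt_norm. Qed.

Let ramp_down01 k (r z : R) : 0 <= ramp_down k r z <= 1.
Proof.
by rewrite /ramp_down le_max lexx ge_max ler01 /= ge_min lexx.
Qed.

(** An indicator is no admissible test, so the bound passes to the limit through a function that is
    1 up to x^l / 2 and 0 after x^l; halving the threshold costs the power of 2^-1. With l fixed,
    4^l <= n eventually, so K = 1 is enough. *)
Lemma limit_link_tail l i j : is_link P X l (fun z => gfun i z - gfun j z) ->
  fine (Q [set w | x ^+ l < `|V i w - V j w|]) <=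
  A / 2^-1 ^+ (2 * p) * y ^+ l / (2 ^+ d) ^+ l.
Proof.
move=> lk; have [x0 _] := andP x01.
set b := (X in _ <= X).
pose c := x ^+ l; have c0 : 0 < c by rewrite exprn_gt0.
have [k kc] : exists k : nat, 1 <= k%:R * (c / 2).
  exists (Num.bound (c / 2)^-1); rewrite -ler_pdivrMr ?divr_gt0// mul1r ltW//.
  by apply: archi_boundP; rewrite invr_ge0 divr_ge0// ltW.
pose h (z : gidx -> R) := ramp_down k (c / 2) `|z i - z j|.
have fh : fdlip [:: i; j] k%:R 1 h.
  have [L0 hL hM] := ramp_down_blip k (c / 2); split => [//|z z'|z]; last exact: hM.
  apply: le_trans (hL _ _) _; apply: ler_wpM2l => //.
  rewrite !big_cons big_nil addr0; apply: le_trans (ler_dist_dist _ _) _.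
  have -> : z i - z j - (z' i - z' j) = (z i - z' i) - (z j - z' j) by ring.
  exact: ler_normB.
have h_hi z : c < `|z i - z j| -> h z = 0.
  move=> cz; rewrite /h /ramp_down max_l// ge_min; apply/orP; right.
  rewrite subr_le0; apply: le_trans kc _; apply: ler_wpM2l => //; lra.
have h_lo z : ~~ (c / 2 < `|z i - z j|) -> h z = 1.
  rewrite -leNgt => cz; rewrite /h /ramp_down min_l ?max_r//.
  rewrite -[leLHS]subr0 lerD2l lerN2; apply: mulr_ge0_le0 => //; lra.
have bV := bmeas_fdlip mV fh.
have mB : measurable [set w | c < `|V i w - V j w|].
  by apply: mE; exact: measurable_funB.
suff lb : 1 - b <= expectR Q (fun w => h (fun i => V i w)).
  rewrite -expectR_indic//.
  apply: (@le_trans _ _ (1 - expectR Q (fun w => h (fun i => V i w)))); last by lra.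
  rewrite -[X in X - _](expectR_cst Q) -expectRB//; last exact: bmeas_cst.
  apply: le_expectR; first exact: bmeas_indic.
    by apply: bmeasB => //; exact: bmeas_cst.
  move=> w; rewrite indicE; have [cw|cw] := boolP (w \in _).
    by rewrite inE /= in cw; rewrite h_hi// subr0.
  by rewrite subr_ge0; have /andP[_ ->] := ramp_down01 k (c / 2) `|V i w - V j w|.
apply: (cvg_le_near_ge (N := (4 ^ l)%N) (cvgV fh)) => n ln.
have n1 : (1 <= n)%N by apply: leq_trans ln; rewrite expn_gt0.
pose B := [set w | 2^-1 * x ^+ l < `|emp P X n (fun z => gfun i z - gfun j z) w|].
have bE := bmeas_emp P n (fun i => bmeas_link mX modulus0 i lk).
have mB' : measurable B by apply: measurable_gt_norm; have [] := bE.
have PB : fine (P B) <= b.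
  have h2 : 0 < 2^-1 :> R by rewrite invr_gt0.
  have l4 : 4 ^+ l <= 1 * n%:R :> R by rewrite mul1r -natrX ler_nat.
  have := tail (lexx 1) h2 lk n1 l4; by rewrite expr1n mulr1.
have bY : bmeas (fun w => h (fun i => emp P X n (gfun i) w)).
  apply: bmeas_fdlip fh => i'; by have [] := bmeas_emp P n (bgfun i').
apply: (@le_trans _ _ (1 - fine (P B))); first by lra.
rewrite -expectR_indic// -[X in X - _](expectR_cst P) -expectRB//; last first.
- exact: bmeas_indic.
- exact: bmeas_cst.
apply: le_expectR => //; first by apply: bmeasB; [exact: bmeas_cst|exact: bmeas_indic].
move=> w; rewrite indicE; have [cw|cw] := boolP (w \in B).
  rewrite subrr.
  by have /andP[] := ramp_down01 k (c / 2) `|emp P X n (gfun i) w - emp P X n (gfun j) w|.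
rewrite subr0 h_lo//; apply/negP => H; move/negP: cw; apply; rewrite inE /B /=.
by rewrite empB// mulrC.
Qed.

Let lkT l := ({ffun 'I_d -> 'I_(2 ^ l.+1).+1} * {ffun 'I_d -> bool} * bool)%type.

(** One finite type indexes the links of level l: a cell, the set of coordinates to shift by one,
    and a flag forcing a refinement. A shift that leaves the grid is also turned into a refinement,
    so that every index gives a link. *)
Let lkpair l (u : lkT l) : gidx * gidx :=
  let m := u.1.1 in let s := u.1.2 in
  if ~~ u.2 && [forall k, (m k + s k <= 2 ^ l)%N]
  then (cell l (fun k => m k : nat), cell l (fun k => m k + s k)%N)
  else (cell l.+1 (fun k => m k : nat), cell l (fun k => (m k)./2)).

Let lkpairP l (u : lkT l) :
  is_link P X l (fun z => gfun (lkpair u).1 z - gfun (lkpair u).2 z).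
Proof.
rewrite /lkpair; case: ifPn => [/andP[_ /forallP h]|_] /=; rewrite !gfun_cell.
  apply: link_neighbor => k; first exact: h.
  by have := leq_b1 (u.1.2 k); move: (nat_of_bool _) (nat_of_ord _) => s m; lia.
by apply: link_refine => k; rewrite -ltnS.
Qed.

Let bad l : set OW := [set w | exists u : lkT l, x ^+ l < `|V (lkpair u).1 w - V (lkpair u).2 w|].

Let badP : exists2 K, 0 <= K & forall l, measurable (bad l) /\ fine (Q (bad l)) <= K * y ^+ l.
Proof.
have [y0 _] := andP y01.
pose D := A / 2^-1 ^+ (2 * p); have D0 : 0 <= D.
  by rewrite /D mulr_ge0// invr_ge0 exprn_ge0// invr_ge0.
exists (3 ^+ d * 2 ^+ d * 2 * D); first by rewrite !mulr_ge0 ?exprn_ge0.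
move=> l.
have mU (u : lkT l) : measurable [set w | x ^+ l < `|V (lkpair u).1 w - V (lkpair u).2 w|].
  by apply: mE; exact: measurable_funB.
have [mB PB] := union_bound_fin mU (fun u => limit_link_tail (lkpairP u)).
split=> //; apply: le_trans PB _; rewrite -/D.
have z0 : 0 < (2 ^+ d) ^+ l :> R by rewrite !exprn_gt0.
have -> : #|{: lkT l}|%:R = #|{ffun 'I_d -> 'I_(2 ^ l.+1).+1}|%:R * (2 ^+ d) * 2 :> R.
  by rewrite !card_prod card_bool [#|{ffun 'I_d -> bool}|]card_ffun card_bool card_ord !natrM natrX.
have c2 : 0 <= 2 ^+ d * 2 * (D * y ^+ l / (2 ^+ d) ^+ l) :> R.
  by rewrite !mulr_ge0 ?invr_ge0 ?exprn_ge0// ltW.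
apply: (@le_trans _ _ (3 ^+ d * (2 ^+ d) ^+ l * (2 ^+ d * 2 * (D * y ^+ l / (2 ^+ d) ^+ l)))).
  have := ler_wpM2r c2 (level_card_le d l); rewrite !mulrA; apply.
rewrite le_eqVlt; apply/orP; left; apply/eqP.
move: ((2 ^+ d) ^+ l) z0 => z z0; rewrite -!mulrA; congr (_ * _).
rewrite mulrC -!mulrA mulVf ?mulr1//; last by rewrite gt_eqF.
Qed.

Let good := ~` lim_sup_set bad.

Let mlim : measurable (lim_sup_set bad).
Proof.
have [K _ HK] := badP; apply: bigcap_measurable => // n _.
by apply: bigcup_measurable => l _; have [] := HK l.
Qed.

Let mgood : measurable good.
Proof. exact: measurableC. Qed.

Let Qgood : Q good = 1%E.
Proof.
have [K K0 HK] := badP.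
have Q0 : Q (lim_sup_set bad) = 0%E.
  by apply: (borel_cantelli_geometric K0 y01) => l; have [] := HK l.
by rewrite /good probability_setC// Q0 sube0.
Qed.

Let goodP w : good w -> exists N, forall l, (N <= l)%N -> ~ bad l w.
Proof.
rewrite /good /lim_sup_set /= => H; apply: contrapT => H'; apply: H => N _.
apply: contrapT => H; apply: H'; exists N => l Nl bl; apply: H; exists l => //.
Qed.

Let refine_le l w t : ~ bad l w ->
  `|V (cell l.+1 (lev l.+1 t)) w - V (cell l (lev l t)) w| <= x ^+ l.
Proof.
move=> nb; rewrite leNgt; apply/negP => h; apply: nb.
exists ([ffun k => inord (lev l.+1 t k)], [ffun=> false], true).
rewrite /lkpair /=.
have E k : nat_of_ord ([ffun k => inord (lev l.+1 t k)] k : 'I_(2 ^ l.+1).+1) = lev l.+1 t k.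
  by rewrite ffunE inordK// ltnS lev_le.
rewrite (_ : (fun k => _) = lev l.+1 t); last by apply/funext => k; rewrite E.
rewrite (_ : (fun k => _./2) = lev l t)//; apply/funext => k.
by rewrite (lev_half P X l) E.
Qed.

Let neighbor_le l w (m m' : 'I_d -> nat) : ~ bad l w -> (forall k, m' k <= 2 ^ l)%N ->
  (forall k, m k <= m' k <= (m k).+1)%N ->
  `|V (cell l m) w - V (cell l m') w| <= x ^+ l.
Proof.
move=> nb ml mm'; rewrite leNgt; apply/negP => h; apply: nb.
exists ([ffun k => inord (m k)], [ffun k => m k != m' k], false).
have mk k : (m k < (2 ^ l.+1).+1)%N.
  have := ml k; have /andP[+ _] := mm' k; rewrite expnS ltnS => h1 h2.
  by apply: leq_trans (leq_trans h1 h2) _; rewrite leq_pmull.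
have E' k : (m k + (m k != m' k) = m' k)%N by have := mm' k; case: eqVneq => /=; lia.
rewrite /lkpair /= ifT; last first.
  by apply/forallP => k; rewrite !ffunE (inordK (mk k)) E'.
rewrite (_ : (fun k => _) = m); last by apply/funext => k; rewrite ffunE inordK.
rewrite (_ : (fun k => _ + _)%N = m')//.
by apply/funext => k; rewrite !ffunE inordK// E'.
Qed.

(** The value 0 off [good] makes every path continuous and every coordinate measurable. *)
Definition limit_path (t : 'I_d -> \bar R) (w : OW) : R :=
  if w \in good then lim (V (cell q (lev q t)) w @[q --> \oo]) else 0.

Lemma limit_path_cvg w : w \in good -> exists N, forall t,
  V (cell q (lev q t)) w @[q --> \oo] --> limit_path t w /\
  forall q, (N <= q)%N -> `|limit_path t w - V (cell q (lev q t)) w| <= x ^+ q / (1 - x).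
Proof.
move=> gw; have [N HN] : exists N, forall l, (N <= l)%N -> ~ bad l w.
  by apply: goodP; rewrite inE in gw.
exists N => t.
have [|l ul ln] := @geometric_cauchy_cvg R (fun q => V (cell q (lev q t)) w) N 1 x ler01 x01.
  by move=> n Nn; rewrite mul1r; apply: refine_le; exact: HN.
rewrite /limit_path gw (cvg_lim (@Rhausdorff R) ul); split => // q Nq.
by have := ln q Nq; rewrite mul1r.
Qed.

Lemma measurable_limit_path t : measurable_fun setT (limit_path t).
Proof.
apply: (@measurable_fun_cvg _ _ _ setT (fun q w => V (cell q (lev q t)) w * \1_good w)).
  move=> q; apply: measurable_funM => //; exact: measurable_indic.
move=> w _; rewrite indicE; have [gw|gw] := boolP (w \in good).
  have [N HN] := limit_path_cvg gw; have [h _] := HN t.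
  by under eq_fun do rewrite mulr1.
rewrite /limit_path (negbTE gw) /=; under eq_fun do rewrite mulr0.
exact: cvg_cst.
Qed.

Lemma limit_path_uniform : exists G : set OW, [/\ measurable G, Q G = 1%E,
  (forall w, G w -> exists N, forall q, (N <= q)%N -> forall t,
     `|limit_path t w - V (cell q (lev q t)) w| <= x ^+ q / (1 - x)) &
  forall w, ~ G w -> forall t, limit_path t w = 0].
Proof.
exists good; split => // [w gw|w gw t].
  have [N HN] := limit_path_cvg (mem_set gw).
  by exists N => q Nq t; have [_] := HN t; apply.
by rewrite /limit_path memNset.
Qed.

Lemma limit_path_gaussian m (ts : 'I_m -> 'I_d -> \bar R) (a : 'I_m -> R) :
  exists2 v : R, 0 <= v & forall B : set R, measurable B ->
    Q [set w | B (\sum_(j < m) a j * limit_path (ts j) w)] = normal_law v B.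
Proof.
pose t q := [seq (cell q (lev q (ts j)), a j) | j <- enum 'I_m].
have tE q w : lincomb (t q) (fun i => V i w) = \sum_(j < m) a j * V (cell q (lev q (ts j))) w.
  by rewrite /lincomb big_map big_enum.
have /choice[v Hv] : forall q, exists v, 0 <= v /\ forall L M h, blip L M h ->
    expectR Q (fun w => h (lincomb (t q) (fun i => V i w))) = normal_expect v h.
  by move=> q; have [v v0 Hv] := gaussV (t q); exists v.
apply: (@normal_limit R _ _ Q (fun q w => lincomb (t q) (fun i => V i w)) _ v).
- move=> q; rewrite (_ : (fun w => _) = fun w => \sum_(j < m) a j * V (cell q (lev q (ts j))) w).
    by apply: measurable_sum => j; apply: measurable_funM.
  by apply/funext => w; rewrite tE.
- by apply: measurable_sum => j; apply: measurable_funM => //; exact: measurable_limit_path.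
- by move=> q; have [] := Hv q.
- by move=> q; have [_] := Hv q.
- exists (~` good); split; first exact: measurableC.
    by rewrite probability_setC// Qgood subee.
  move=> w /= H gw; apply: H; under eq_fun do rewrite tE.
  apply: cvg_rsum => j; apply: cvgMr.
  by have [N HN] := limit_path_cvg (mem_set gw); have [] := HN (ts j).
Qed.

Lemma limit_path_continuous w t (e : R) : 0 < e -> exists2 delta : R, 0 < delta &
  forall s, edistE s t < delta -> `|limit_path s w - limit_path t w| < e.
Proof.
move=> e0; have [gw|gw] := boolP (w \in good); last first.
  by exists 1 => // s _; rewrite /limit_path (negbTE gw) subrr normr0.
have [N HN] := limit_path_cvg gw.
have [N' HN'] : exists N, forall l, (N <= l)%N -> ~ bad l w.
  by apply: goodP; rewrite inE in gw.
have [x0 x1] := andP x01.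
(* Two distances to level q and two neighbour links will each be at most e / 5, which leaves a
   strict inequality. *)
have ex0 : 0 < (1 - x) * e / 5 by rewrite divr_gt0// mulr_gt0// subr_gt0.
have [M HM] := expr_small x01 ex0.
pose q := maxn N (maxn N' M).
have qN : (N <= q)%N by rewrite leq_maxl.
have qN' : (N' <= q)%N by rewrite /q maxnCA leq_maxl.
have qM : (M <= q)%N by rewrite /q !leq_max leqnn !orbT.
have h0 : 0 < (2 ^+ q)^-1 :> R by rewrite invr_gt0 exprn_gt0.
have /choice[delta Hd] : forall k : 'I_d, exists dl : R, 0 < dl /\
    forall s, `|contract s - contract (t k)| < dl ->
      `|marg P X k s - marg P X k (t k)| < (2 ^+ q)^-1.
  by move=> k; have [dl dl0 H] := marg_continuous mX modulus0 k (t k) h0; exists dl.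
exists (\big[Num.min/1]_(k < d) delta k).
  by apply: lt_bigmin => // k _; have [] := Hd k.
(* The point s may be above t in some coordinates and below it in others, while neighbour links only
   shift upwards; the cell of the coordinatewise maxima is reached from both. *)
move=> s sd; pose m k := maxn (lev q s k) (lev q t k).
have close k : `|marg P X k (s k) - marg P X k (t k)| < (2 ^+ q)^-1.
  have [_] := Hd k; apply; apply: le_lt_trans (lt_le_trans sd _).
    exact: (le_bigmax _ (fun k => `|contract (s k) - contract (t k)|)).
  exact: bigmin_le.
have near_lev k : (lev q s k <= (lev q t k).+1)%N /\ (lev q t k <= (lev q s k).+1)%N.
  have := close k; rewrite ltr_norml => /andP[c1 c2].
  have /andP[s1 s2] := lev_itv P X q s k; have /andP[t1 t2] := lev_itv P X q t k.
  have N0 : 0 < 2 ^+ q :> R by rewrite exprn_gt0.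
  have NN : 2 ^+ q * (2 ^+ q)^-1 = 1 :> R by rewrite mulfV// gt_eqF.
  have e1 : 2 ^+ q * (- (2 ^+ q)^-1) < 2 ^+ q * (marg P X k (s k) - marg P X k (t k)).
    by rewrite ltr_pM2l.
  have e2 : 2 ^+ q * (marg P X k (s k) - marg P X k (t k)) < 2 ^+ q * (2 ^+ q)^-1.
    by rewrite ltr_pM2l.
  rewrite mulrN NN mulrBr in e1; rewrite NN mulrBr in e2.
  by split; rewrite -ltnS -(ltr_nat R) -[_.+2]addn1 natrD; lra.
have mq k : (m k <= 2 ^ q)%N by rewrite geq_max !lev_le.
have sm : `|V (cell q (lev q s)) w - V (cell q m) w| <= x ^+ q.
  by apply: neighbor_le (HN' _ qN') mq _ => k; apply: maxn_near; have [] := near_lev k.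
have tm : `|V (cell q (lev q t)) w - V (cell q m) w| <= x ^+ q.
  by apply: neighbor_le (HN' _ qN') mq _ => k; rewrite /m maxnC; apply: maxn_near; have [] := near_lev k.
have [_ /(_ q qN) hs] := HN s; have [_ /(_ q qN) ht] := HN t.
have xq := HM q qM.
have xx : x ^+ q <= x ^+ q / (1 - x).
  rewrite ler_pdivlMr ?subr_gt0// -[leRHS]mulr1; apply: ler_wpM2l; last lra.
  by rewrite exprn_ge0// ltW.
have xe : x ^+ q / (1 - x) <= e / 5.
  rewrite ler_pdivrMr ?subr_gt0//; apply: le_trans xq _.
  by rewrite le_eqVlt; apply/orP; left; apply/eqP; ring.
move: hs ht sm tm; set a := limit_path s w; set b := limit_path t w.
move: (V _ w) (V _ w) (V _ w) => u v z.
by rewrite !ler_norml ltr_norml => /andP[? ?] /andP[? ?] /andP[? ?] /andP[? ?];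
  apply/andP; split; lra.
Qed.

End gaussian_limit.

(** * Cadlag paths and weak convergence *)

Section cadlag_paths.
Context {R : realType} {d : nat}.
Implicit Types (x y : ('I_d -> \bar R) -> R) (t : 'I_d -> \bar R).

Definition quadrant_lim x t rho (L : R) := forall e : R, 0 < e -> exists2 delta : R, 0 < delta &
  forall s, quadrant t rho s -> edistE s t < delta -> `|x s - L| < e.

Lemma cadlagP x : (forall t rho, exists L, quadrant_lim x t rho L) ->
  (forall t, quadrant_lim x t (fun=> true) (x t)) -> cadlag x.
Proof. by move=> H1 H2 t; split => [rho|]; [exact: H1|exact: H2]. Qed.

Lemma quadrant_lim_cst t rho (c : R) : quadrant_lim (fun=> c) t rho c.
Proof. by move=> e e0; exists 1 => // s _ _; rewrite subrr normr0. Qed.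

Lemma quadrant_limD x y t rho (a b : R) : quadrant_lim x t rho a -> quadrant_lim y t rho b ->
  quadrant_lim (fun s => x s + y s) t rho (a + b).
Proof.
move=> xa yb e e0; have e2 : 0 < e / 2 by rewrite divr_gt0.
have [dx dx0 Hx] := xa _ e2; have [dy dy0 Hy] := yb _ e2.
exists (Num.min dx dy); first by rewrite lt_min dx0.
move=> s qs; rewrite lt_min => /andP[sx sy]; rewrite opprD addrACA.
by apply: le_lt_trans (ler_normD _ _) _; rewrite [ltRHS]splitr ltrD ?Hx ?Hy.
Qed.

Lemma quadrant_limZ c x t rho (a : R) : quadrant_lim x t rho a ->
  quadrant_lim (fun s => c * x s) t rho (c * a).
Proof.
move=> xa e e0; have c0 : 0 < `|c| + 1 by rewrite ltr_wpDl.
have [dx dx0 Hx] := xa _ (divr_gt0 e0 c0); exists dx => // s qs sx.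
rewrite -mulrBr normrM; have := Hx s qs sx; rewrite ltr_pdivlMr//; apply: le_lt_trans.
by rewrite [leRHS]mulrDr mulr1 [leLHS]mulrC lerDl.
Qed.

Lemma quadrant_lim_sum (I : Type) (r : seq I) (x : I -> ('I_d -> \bar R) -> R) t rho (a : I -> R) :
  (forall i, quadrant_lim (x i) t rho (a i)) ->
  quadrant_lim (fun s => \sum_(i <- r) x i s) t rho (\sum_(i <- r) a i).
Proof.
move=> xa; elim: r => [|i r IH].
  rewrite big_nil (_ : (fun s => _) = fun=> 0); first exact: quadrant_lim_cst.
  by apply/funext => s; rewrite big_nil.
rewrite big_cons (_ : (fun s => _) = fun s => x i s + \sum_(j <- r) x j s).
  exact: quadrant_limD.
by apply/funext => s; rewrite big_cons.
Qed.

Lemma quadrant_lim_continuous x t rho : (forall e : R, 0 < e -> exists2 delta : R, 0 < delta &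
    forall s, edistE s t < delta -> `|x s - x t| < e) -> quadrant_lim x t rho (x t).
Proof. by move=> xt e e0; have [dl dl0 H] := xt e e0; exists dl => // s _; exact: H. Qed.

Lemma continuous_cadlag x : (forall t (e : R), 0 < e -> exists2 delta : R, 0 < delta &
    forall s, edistE s t < delta -> `|x s - x t| < e) -> cadlag x.
Proof.
move=> xc; apply: cadlagP => [t rho|t]; last first.
  by apply: quadrant_lim_continuous; exact: xc.
by exists (x t); apply: quadrant_lim_continuous; exact: xc.
Qed.

Lemma coord_le_edistE (s t : 'I_d -> \bar R) k :
  `|contract (s k) - contract (t k)| <= edistE s t.
Proof. exact: (le_bigmax _ (fun k => `|contract (s k) - contract (t k)|)). Qed.

Lemma coordwise_delta (B : 'I_d -> R -> Prop) :
  (forall k, exists2 delta, 0 < delta & B k delta) ->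
  (forall k a b, a <= b -> B k b -> B k a) ->
  exists2 delta, 0 < delta & forall k, B k delta.
Proof.
move=> HB Bmono.
have /choice[delta Hd] : forall k, exists dl, 0 < dl /\ B k dl.
  by move=> k; have [dl] := HB k; exists dl.
exists (\big[Num.min/1]_(k < d) delta k).
  by apply: lt_bigmin => // k _; have [] := Hd k.
by move=> k; have [_] := Hd k; apply: Bmono; exact: bigmin_le.
Qed.

(** Near t, within one quadrant, each comparison of z k with s k is constant: on the right it agrees
    with z k <= t k, strictly on the left with z k < t k. *)
Lemma quadrant_lim_indic (z : 'I_d -> R) t rho :
  quadrant_lim (fun s => if [forall k, ((z k)%:E <= s k)%E] then 1 else 0) t rho
    (if [forall k, if rho k then ((z k)%:E <= t k)%E else ((z k)%:E < t k)%E] then 1 else 0).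
Proof.
move=> e e0.
have between (a b c : R) : `|a - b| < `|c - b| -> (b < c -> a < c) /\ (c < b -> c < a).
  move=> h; split => bc; move: h.
    by rewrite [ltRHS]gtr0_norm ?subr_gt0// ltr_norml => /andP[_]; lra.
  by rewrite [ltRHS]distrC [ltRHS]gtr0_norm ?subr_gt0// ltr_norml => /andP[+ _]; lra.
pose same k (s : \bar R) := if rho k then ((z k)%:E <= s)%E = ((z k)%:E <= t k)%E
  else ((z k)%:E <= s)%E = ((z k)%:E < t k)%E.
have [|k a b ab H s qs sa|delta delta0 H] := @coordwise_delta (fun k dl => forall s : \bar R,
    (if rho k then (t k <= s)%E else (s < t k)%E) ->
    `|contract s - contract (t k)| < dl -> same k s).
(* If z k = t k the quadrant decides the comparison; otherwise s k must stay on the side of z k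
   where t k lies. *)
- move=> k; exists (if (z k)%:E == t k then 1 else `|contract (z k)%:E - contract (t k)|).
    case: eqVneq => // zt; rewrite normr_gt0 subr_eq0; apply: contra_neq zt.
    exact: contract_inj.
  move=> s qs sd; rewrite /same; move: qs; case: ifPn => rk qs.
    have [zt|tz] := leP (z k)%:E (t k); first by rewrite (le_trans zt qs).
    apply/negbTE; rewrite -ltNge; move: sd; rewrite gt_eqF//.
    by move=> /between[h _]; rewrite -lt_contract h// lt_contract.
  have [tz|zt] := leP (t k) (z k)%:E.
    by apply/negbTE; rewrite -ltNge (lt_le_trans qs).
  apply/ltW; move: sd; rewrite lt_eqF//.
  by move=> /between[_ h]; rewrite -lt_contract h// lt_contract.
- by apply: H => //; exact: lt_le_trans ab.
exists delta => // s qs sd.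
rewrite (_ : [forall k, _] = [forall k, if rho k then ((z k)%:E <= t k)%E else ((z k)%:E < t k)%E]).
  by rewrite subrr normr0.
apply: eq_forallb => k; have := H k (s k) (qs k) (le_lt_trans (coord_le_edistE s t k) sd).
by rewrite /same; case: (rho k).
Qed.

Lemma skorokhod_le x y (e : R) : 0 <= e -> (forall t, `|x t - y t| <= e) ->
  skorokhod_dist x y <= e.
Proof.
move=> e0 xy; apply: ge_inf.
  exists 0 => z [l [_ [_ H]]]; exact: le_trans (H (fun=> -oo%E)).
exists (fun _ => id); split; [|split].
- move=> k; split => [//|]; split => [u|t e1 e10]; first by exists u.
  by exists e1.
- by move=> k t; rewrite subrr normr0.
- by move=> t; exact: xy.
Qed.

End cadlag_paths.

Section cadlag_emp_process.
Context {R : realType} {d : nat} {dO : measure_display} {O : measurableType dO}.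
Variables (P : probability O R) (X : nat -> O -> 'I_d -> R).
Hypothesis mX : forall i k, measurable_fun setT (fun w => X i w k).
Local Notation F := (dist_fun P X).
Hypothesis modulus0 : forall e : R, 0 < e -> exists2 y, 0 < y & modulus_cont F y <= e.

Let ind k (s : \bar R) (w : O) : R := (((X 0%N w k)%:E <= s)%E)%:R.

Let indE k s : ind k s = \1_(below X k s).
Proof.
apply/funext => w; rewrite /ind indicE; congr (_%:R); congr nat_of_bool.
by apply/idP/idP => [h|]; [apply/mem_set|rewrite inE].
Qed.

Let bind k s : bmeas (ind k s).
Proof. by rewrite indE; apply: bmeas_indic; exact: measurable_below. Qed.

Let Eind k s : expectR P (ind k s) = marg P X k s.
Proof. by rewrite indE expectR_indic//; exact: measurable_below. Qed.

Let dist_marg k (s t : \bar R) :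
  expectR P (fun w => `|ind k s w - ind k t w|) = `|marg P X k s - marg P X k t|.
Proof.
wlog st : s t / (s <= t)%E => [H|].
  have [|/ltW ts] := leP s t; first exact: H.
  rewrite distrC -(H t s ts); congr expectR; apply/funext => w; exact: distrC.
rewrite distrC [RHS]ger0_norm ?subr_ge0 ?le_marg// -!Eind -expectRB//.
congr expectR; apply/funext => w; rewrite distrC ger0_norm// subr_ge0 /ind ler_nat.
by case: (boolP (_ <= s)%E) => // h; rewrite (le_trans h st).
Qed.

(** The distribution function is the mean of a product of indicators, and products in [0, 1] differ
    by at most the sum of the differences of their factors. Continuity at infinite points is thus
    inherited from the marginals. *)
Lemma dist_funE_close (s t : 'I_d -> \bar R) :
  `|dist_funE P X s - dist_funE P X t| <= \sum_k `|marg P X k (s k) - marg P X k (t k)|.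
Proof.
have E (u : 'I_d -> \bar R) : dist_funE P X u = expectR P (fun w => \prod_k ind k (u k) w).
  rewrite /dist_funE -expectR_indic; last exact: measurable_below_all.
  congr expectR; apply/funext => w; rewrite indicE.
  have [h|h] := boolP (w \in _).
    rewrite inE /= in h; rewrite big1// => k _; by rewrite /ind h.
  have [k hk] : exists k, ~~ ((X 0%N w k)%:E <= u k)%E.
    apply: contrapT => H; move/negP: h; apply; rewrite inE /= => k.
    by apply: contrapT => /negP h; apply: H; exists k.
  by rewrite (bigD1 k)//= /ind (negbTE hk) mul0r.
have bprod (u : 'I_d -> \bar R) : bmeas (fun w => \prod_k ind k (u k) w).
  split; first by apply: measurable_prod => k _; have [] := bind k (u k).
  exists 1 => w; rewrite ger0_norm.
    by apply: prodr_ile1 => k _; rewrite /ind ler0n lern1 leq_b1.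
  by apply: prodr_ge0 => k _; rewrite /ind.
rewrite !E -expectRB//; apply: le_trans (normr_expectR_le P _) _; first exact: bmeasB.
under eq_bigr do rewrite -dist_marg.
rewrite -expectR_sum => [|k]; last by apply: bmeas_norm; exact: bmeasB.
apply: le_expectR.
- by apply: bmeas_norm; exact: bmeasB.
- by apply: bmeas_sum => k; apply: bmeas_norm; exact: bmeasB.
- move=> w; apply: ler_norm_prod_sub => k; by rewrite /ind ler0n lern1 leq_b1.
Qed.

Lemma dist_funE_continuous t (e : R) : 0 < e -> exists2 delta : R, 0 < delta &
  forall s, edistE s t < delta -> `|dist_funE P X s - dist_funE P X t| < e.
Proof.
move=> e0; have D0 : 0 < d%:R + 1 :> R by rewrite ltr_wpDl.
have [|k a b ab H s sa|delta delta0 H] := @coordwise_delta R d (fun k dl => forall s,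
    `|contract s - contract (t k)| < dl -> `|marg P X k s - marg P X k (t k)| < e / (d%:R + 1)).
- by move=> k; apply: marg_continuous => //; exact: divr_gt0.
- by apply: H; exact: lt_le_trans ab.
exists delta => // s sd; apply: le_lt_trans (dist_funE_close s t) _.
apply: (@le_lt_trans _ _ (\sum_(k < d) (e / (d%:R + 1)))).
  by apply: ler_sum => k _; apply: ltW; apply: H; exact: le_lt_trans (coord_le_edistE _ _ _) sd.
rewrite sumr_const card_ord -[ltLHS]mulr_natl mulrA ltr_pdivrMr// mulrC.
by rewrite ltr_pM2l// ltrDl.
Qed.

Lemma emp_process_cadlag n w : cadlag (emp_process P X n w).
Proof.
have term t rho i := quadrant_limD (quadrant_lim_indic (X i w) t rho)
  (quadrant_limZ (-1) (quadrant_lim_continuous rho (dist_funE_continuous t))).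
have total t rho := quadrant_limZ (Num.sqrt n%:R)^-1
  (quadrant_lim_sum (index_iota 1 n.+1) (term t rho)).
have E : (fun s => (Num.sqrt n%:R)^-1 * \sum_(i <- index_iota 1 n.+1)
    ((if [forall k, ((X i w k)%:E <= s k)%E] then 1 else 0) + -1 * dist_funE P X s)) =
    emp_process P X n w.
  apply/funext => s; rewrite /emp_process; congr (_ * _).
  by apply: eq_bigr => i _; rewrite mulN1r.
apply: cadlagP => [t rho|t].
  by have := total t rho; rewrite E => h; eexists; exact: h.
by have := total t (fun=> true); rewrite -[X in quadrant_lim _ _ _ X]/((fun s => _) t) E.
Qed.

End cadlag_emp_process.

(** * Lipschitz minorants of a test functional *)

Section envelope.
Context {R : realType} {d : nat}.
Implicit Types (x y : ('I_d -> \bar R) -> R).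
Implicit Types k e B : R.
Variables (g : (('I_d -> \bar R) -> R) -> R) (M : R).
Hypothesis gM : forall x, `|g x| <= M.

Definition envelope_set (k : R) x := [set z | exists y e,
  [/\ cadlag y, 0 <= e, forall t, `|x t - y t| <= e & z = g y + k * e]].

(* A minorant of g, Lipschitz for the uniform distance and also defined on paths
   that are not cadlag; the minimum with M bounds it there. *)
Definition envelope (k : R) x := Num.min M (inf (envelope_set k x)).

Let env_lb (k : R) x : 0 <= k -> lbound (envelope_set k x) (- M).
Proof.
move=> k0 _ [y [e [_ e0 _ ->]]]; have := gM y; rewrite ler_norml => /andP[h _].
by have := mulr_ge0 k0 e0; lra.
Qed.

Lemma envelope_bound k x : 0 <= k -> `|envelope k x| <= M.
Proof.
move=> k0; have M0 : 0 <= M := le_trans (normr_ge0 _) (gM x).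
rewrite ler_norml /envelope ge_min lexx /= andbT le_min; apply/andP; split; first lra.
have [[z Sz]|S0] := pselect (envelope_set k x !=set0); last first.
  rewrite (_ : envelope_set k x = set0) ?inf0; first lra.
  by apply/seteqP; split => // z Sz; apply: S0; exists z.
by apply: lb_le_inf; [exists z|exact: env_lb].
Qed.

Lemma envelope_le k x : 0 <= k -> cadlag x -> envelope k x <= g x.
Proof.
move=> k0 cx; rewrite /envelope ge_min; apply/orP; right; apply: ge_inf.
  by exists (- M); exact: env_lb.
by exists x, 0; split => // [t|]; rewrite ?subrr ?normr0// mulr0 addr0.
Qed.

(** A cadlag y within e of x is within e + delta of x'. Nonemptiness at x excludes the default value
    0 of the infimum. *)
Lemma envelope_lip k x x' (delta : R) : 0 <= k -> 0 <= delta -> envelope_set k x !=set0 ->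
  (forall t, `|x t - x' t| <= delta) -> envelope k x' <= envelope k x + k * delta.
Proof.
move=> k0 d0 S0 xx'; rewrite /envelope -[Num.min M (inf _) + _]addrC -lerBlDl le_min.
apply/andP; split.
  rewrite lerBlDl ge_min; apply/orP; left; rewrite lerDr; exact: mulr_ge0.
apply: lb_le_inf => // z [y [e [cy e0 xy ->]]].
rewrite lerBlDl ge_min; apply/orP; right; apply: ge_inf.
  by exists (- M); exact: env_lb.
exists y, (e + delta); split => //; [exact: addr_ge0| |by ring].
move=> t; have -> : x' t - y t = (x t - y t) - (x t - x' t) by ring.
by apply: le_trans (ler_normB _ _) _; apply: lerD.
Qed.

Lemma envelope_set_cadlag k x : cadlag x -> envelope_set k x !=set0.
Proof.
by move=> cx; exists (g x + k * 0), x, 0; split => // t; rewrite subrr normr0.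
Qed.

Lemma envelope_set_bounded k x B : 0 <= B -> (forall t, `|x t| <= B) -> envelope_set k x !=set0.
Proof.
move=> B0 xB; exists (g (fun=> 0) + k * B), (fun=> 0), B; split => //; last first.
  by move=> t; rewrite subr0.
by apply: continuous_cadlag => t e e0; exists 1 => // s _; rewrite subrr normr0.
Qed.

(** If y is uniformly within delta of x, it is so for the Skorokhod distance, and continuity bounds
    g y; farther away the penalty exceeds the oscillation 2 M of g. *)
Lemma envelope_close x e : cadlag x -> 0 < e ->
  (forall e : R, 0 < e -> exists2 delta : R, 0 < delta &
     forall y, cadlag y -> skorokhod_dist x y < delta -> `|g x - g y| < e) ->
  exists K : nat, forall k : nat, (K <= k)%N -> g x - e <= envelope k%:R x.
Proof.
move=> cx e0 cg; have [delta d0 H] := cg e e0.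
have M0 : 0 <= M := le_trans (normr_ge0 _) (gM x).
exists (Num.bound (2 * M / delta)) => k Kk.
have kM : 2 * M <= k%:R * delta.
  rewrite -ler_pdivrMr//; apply: ltW; apply: lt_le_trans (archi_boundP _) _.
    by rewrite divr_ge0// ?mulr_ge0// ltW.
  by rewrite ler_nat.
have := gM x; rewrite ler_norml => /andP[gx gx'].
rewrite /envelope le_min; apply/andP; split; first lra.
apply: lb_le_inf; first exact: envelope_set_cadlag.
move=> z [y [r [cy r0 xy ->]]]; have kr : 0 <= k%:R * r by rewrite mulr_ge0.
have [rd|dr] := ltP r delta.
  have := H y cy (le_lt_trans (skorokhod_le r0 xy) rd).
  by rewrite ltr_norml => /andP[_ h]; lra.
have := gM y; rewrite ler_norml => /andP[gy _].
have : k%:R * delta <= k%:R * r by apply: ler_wpM2l.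
by lra.
Qed.

Lemma envelope_cvg x : cadlag x ->
  (forall e : R, 0 < e -> exists2 delta : R, 0 < delta &
     forall y, cadlag y -> skorokhod_dist x y < delta -> `|g x - g y| < e) ->
  envelope k%:R x @[k --> \oo] --> g x.
Proof.
move=> cx cg; apply/cvgrPdist_le => e e0; have [K HK] := envelope_close cx e0 cg.
exists K => // k Kk; have h := envelope_le (ler0n R k) cx; have := HK k Kk.
by move=> h'; rewrite ger0_norm; lra.
Qed.

End envelope.

(** * Weak convergence for the Skorokhod distance *)

Section weak_convergence.
Context {R : realType} {d : nat} {dO : measure_display} {O : measurableType dO}.
Variables (P : probability O R) (X : nat -> O -> 'I_d -> R).
Hypothesis mX : forall i k, measurable_fun setT (fun w => X i w k).
Local Notation F := (dist_fun P X).
Hypothesis modulus0 : forall e : R, 0 < e -> exists2 y, 0 < y & modulus_cont F y <= e.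
Local Notation gfun := (gfun P X).
Local Notation lev := (lev P X).
Hypothesis approx : forall eps eta : R, 0 < eps -> 0 < eta ->
  exists q0, forall q, (q0 <= q)%N -> exists n0, forall n, (n0 <= n)%N -> exists B : set O,
  [/\ measurable B, fine (P B) <= eta & forall w, ~ B w -> forall t,
    `|emp_process P X n w t - emp P X n (low P X q (lev q t)) w| <= eps].
Context {dW : measure_display} {OW : measurableType dW}.
Variables (Q : probability OW R) (V : @gidx d -> OW -> R).
Hypothesis mV : forall i, measurable_fun setT (V i).
Hypothesis cvgV : forall s L M h, fdlip s L M h ->
  expectR P (fun w => h (fun i => emp P X n (gfun i) w)) @[n --> \oo] -->
  expectR Q (fun w => h (fun i => V i w)).
Variables (W : ('I_d -> \bar R) -> OW -> R) (G : set OW) (a : nat -> R).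
Hypothesis mG : measurable G.
Hypothesis G1 : Q G = 1%E.
Hypothesis a0 : a q @[q --> \oo] --> 0.
Hypothesis WV : forall w, G w -> exists N, forall q, (N <= q)%N -> forall t,
  `|W t w - V (cell q (lev q t)) w| <= a q.
Hypothesis W0 : forall w, ~ G w -> forall t, W t w = 0.
Hypothesis Wc : forall w, cadlag (fun t => W t w).

Let grid_path q (z : @gidx d -> R) t := z (cell q (lev q t)).

Let cells q : seq (@gidx d) :=
  [seq cell q (fun k => nat_of_ord (m k)) | m : {ffun 'I_d -> 'I_(2 ^ q).+1}].

Let cell_in q t : cell q (lev q t) \in cells q.
Proof.
apply/mapP; exists [ffun k => inord (lev q t k)]; first by rewrite mem_enum.
congr cell; apply/funext => k; by rewrite ffunE inordK// ltnS lev_le.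
Qed.

Let grid_path_le q (z z' : @gidx d -> R) t :
  `|grid_path q z t - grid_path q z' t| <= \sum_(i <- cells q) `|z i - z' i|.
Proof. by rewrite (big_rem _ (cell_in q t))/= lerDl sumr_ge0. Qed.

Section test_function.
Variables (g : (('I_d -> \bar R) -> R) -> R) (M : R).
Hypothesis gM : forall x, `|g x| <= M.
Hypothesis gc : forall x, cadlag x -> forall e : R, 0 < e -> exists2 delta : R, 0 < delta &
  forall y, cadlag y -> skorokhod_dist x y < delta -> `|g x - g y| < e.

Let M0 : 0 <= M := le_trans (normr_ge0 _) (gM (fun=> 0)).

Let h (k : R) q z := envelope g M k (grid_path q z).

Let h_bounded k q z : exists z0, envelope_set g k (grid_path q z) z0.
Proof.
apply: (@envelope_set_bounded R d g k _ (\sum_(i <- cells q) `|z i|)).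
  exact: sumr_ge0.
move=> t; have := grid_path_le q z (fun=> 0) t; rewrite /grid_path subr0.
by under eq_bigr do rewrite subr0.
Qed.

(** A path of level q takes its values among the finitely many entries of z listed by [cells q],
    which turns the uniform Lipschitz bound into one on finitely many coordinates: the class of
    tests for which limits are known. *)
Let fdlip_h k q : 0 <= k -> fdlip (cells q) k M (h k q).
Proof.
move=> k0; split => // [z z'|z]; last exact: envelope_bound.
have D0 : 0 <= \sum_(i <- cells q) `|z i - z' i| by apply: sumr_ge0.
have H := envelope_lip gM k0 D0 (h_bounded k q z) (grid_path_le q z z').
have D0' : 0 <= \sum_(i <- cells q) `|z' i - z i| by apply: sumr_ge0.
have H' := envelope_lip gM k0 D0' (h_bounded k q z') (grid_path_le q z' z).
have E : \sum_(i <- cells q) `|z' i - z i| = \sum_(i <- cells q) `|z i - z' i|.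
  by apply: eq_bigr => i _; rewrite distrC.
rewrite E in H'; rewrite /h ler_norml; apply/andP; split; lra.
Qed.

Let hV_cvg (k : R) w : 0 <= k -> G w ->
  h k q (fun i => V i w) @[q --> \oo] --> envelope g M k (fun t => W t w).
Proof.
move=> k0 Gw; have [N HN] := WV Gw; apply/cvgrPdist_le => e e0.
have k1 : 0 < k + 1 by rewrite ltr_wpDl.
have /cvgrPdist_le/(_ _ (divr_gt0 e0 k1))[N' _ HN'] := a0.
exists (maxn N N') => // q; rewrite /= geq_max => /andP[qN qN'].
have aq : `|a q| <= e / (k + 1) by have := HN' q qN'; rewrite /= sub0r normrN.
have aW t : `|W t w - grid_path q (fun i => V i w) t| <= `|a q|.
  by apply: le_trans (HN q qN t) _; exact: ler_norm.
have aW' t : `|grid_path q (fun i => V i w) t - W t w| <= `|a q| by rewrite distrC.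
have H1 := envelope_lip gM k0 (normr_ge0 _) (envelope_set_cadlag g k (Wc w)) aW.
have H2 := envelope_lip gM k0 (normr_ge0 _) (h_bounded k q _) aW'.
have ka : k * `|a q| <= e.
  rewrite ler_pdivlMr// mulrDr mulr1 in aq.
  by rewrite mulrC; have := normr_ge0 (a q); lra.
by rewrite /h ler_norml; apply/andP; split; lra.
Qed.

Let envelope_meas (k : R) : 0 <= k ->
  measurable_fun setT (fun w => envelope g M k (fun t => W t w)).
Proof.
(* On G the envelope is a limit of functions of finitely many [V i]; off G the path is 0 and the
   envelope constant. *)
move=> k0; apply: (@measurable_fun_cvg _ _ _ setT
   (fun q w => h k q (fun i => V i w) * \1_G w + envelope g M k (fun=> 0) * \1_(~` G) w)).
  move=> q; have [mh _] := bmeas_fdlip mV (fdlip_h q k0).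
  apply: measurable_funD; apply: measurable_funM => //; apply: measurable_indic => //.
  exact: measurableC.
move=> w _; rewrite !indicE in_setC; have [Gw|Gw] := boolP (w \in G) => /=.
  under eq_fun do rewrite mulr1 mulr0 addr0.
  by apply: hV_cvg => //; rewrite inE in Gw.
under eq_fun do rewrite mulr0 mulr1 add0r.
rewrite (_ : (fun t => W t w) = fun=> 0); first exact: cvg_cst.
by apply/funext => t; rewrite W0// => Gw'; move/negP: Gw; apply; rewrite inE.
Qed.

(** Measurability of g along W is derived: every path of W is cadlag, so the measurable envelopes
    converge to g at every w. *)
Lemma bmeas_test : bmeas (fun w => g (fun t => W t w)).
Proof.
split; last by exists M.
apply: (@measurable_fun_cvg _ _ _ setT (fun k w => envelope g M k%:R (fun t => W t w))).
  by move=> k; exact: envelope_meas.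
by move=> w _; apply: envelope_cvg => //; exact: gc.
Qed.

(** The lower bound for g along U_n goes through a measurable minorant L: the envelope of the
    level-q path, less k eps for the approximation off B, less 2 M on B. *)
Lemma lower_approx (e : R) : 0 < e -> exists n0, forall n, (n0 <= n)%N ->
  exists L : O -> R, [/\ bmeas L, forall w, L w <= g (emp_process P X n w) &
    expectR Q (fun w => g (fun t => W t w)) - e <= expectR P L].
Proof.
move=> e0; set E0 := expectR Q _; have e5 : 0 < e / 5 by rewrite divr_gt0.
have [k Hk] : exists k : nat, E0 - e / 5 <= expectR Q (fun w => envelope g M k%:R (fun t => W t w)).
  have c : expectR Q (fun w => envelope g M k%:R (fun t => W t w)) @[k --> \oo] --> E0.
    apply: (@expectR_cvg _ _ _ Q _ _ M).
    - by move=> k; exact: envelope_meas.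
    - by have [] := bmeas_test.
    - by move=> k w; exact: envelope_bound.
    - by apply: aeW => w; apply: envelope_cvg => //; exact: gc.
  have /cvgrPdist_le/(_ _ e5)[N _ HN] := c; exists N.
  by have := HN N (leqnn N); rewrite /= ler_norml => /andP[_]; lra.
have k0 : 0 <= k%:R :> R by [].
(* The five errors of e / 5 are: from g to its envelope, from W to level q, from Q to n, k eps off
   B, and 2 M eta for B. *)
pose eps := e / 5 / (k%:R + 1); pose eta := e / 5 / (2 * M + 1).
have k1 : 0 < k%:R + 1 :> R by rewrite ltr_wpDl.
have M1 : 0 < 2 * M + 1 by rewrite ltr_wpDl// mulr_ge0.
have eps0 : 0 < eps by rewrite divr_gt0.
have eta0 : 0 < eta by rewrite divr_gt0.
have keps : k%:R * eps <= e / 5.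
  rewrite /eps mulrCA -[leRHS]mulr1; apply: ler_wpM2l; first exact: ltW.
  by rewrite ler_pdivrMr// mul1r lerDl.
have Meta : 2 * M * eta <= e / 5.
  rewrite /eta mulrCA -[leRHS]mulr1; apply: ler_wpM2l; first exact: ltW.
  by rewrite ler_pdivrMr// mul1r lerDl.
have [q0 Hq0] := approx eps0 eta0.
have [q q0q Hq] : exists2 q, (q0 <= q)%N &
    E0 - e / 5 - e / 5 <= expectR Q (fun w => h k%:R q (fun i => V i w)).
  have c : expectR Q (fun w => h k%:R q (fun i => V i w)) @[q --> \oo] -->
      expectR Q (fun w => envelope g M k%:R (fun t => W t w)).
    apply: (@expectR_cvg _ _ _ Q _ _ M).
    - by move=> q; have [] := bmeas_fdlip mV (fdlip_h q k0).
    - exact: envelope_meas.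
    - by move=> q w; exact: envelope_bound.
    - exists (~` G); split; first exact: measurableC.
        by rewrite probability_setC// G1 subee.
      by move=> w /= H Gw; apply: H; exact: hV_cvg.
  have /cvgrPdist_le/(_ _ e5)[N _ HN] := c; exists (maxn q0 N); first exact: leq_maxl.
  by have := HN (maxn q0 N) (leq_maxr _ _); rewrite /= ler_norml => /andP[_]; lra.
have [n0 Hn0] := Hq0 q q0q.
have /cvgrPdist_le/(_ _ e5)[n1 _ Hn1] := cvgV (fdlip_h q k0).
exists (maxn n0 n1) => n; rewrite geq_max => /andP[n0n n1n].
have [B [mB PB HB]] := Hn0 n n0n.
pose Y i w := emp P X n (gfun i) w.
have mY i : measurable_fun setT (Y i).
  by have [] := bmeas_emp P n (fun j => low_bmeas mX modulus0 i.1 (fun k => i.2 k) j).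
have bh : bmeas (fun w => h k%:R q (fun i => Y i w)) by exact: (bmeas_fdlip mY (fdlip_h q k0)).
have bB : bmeas (\1_B : O -> R) by exact: bmeas_indic.
exists (fun w => h k%:R q (fun i => Y i w) - (k%:R * eps + 2 * M * \1_B w)); split.
- by apply: bmeasB => //; apply: bmeasD; [exact: bmeas_cst|exact: bmeasZ].
- move=> w; rewrite indicE; have kp : 0 <= k%:R * eps by rewrite mulr_ge0// ltW.
  have [Bw|Bw] := boolP (w \in B) => /=.
    have := envelope_bound gM (grid_path q (fun i => Y i w)) k0.
    rewrite -/(h _ _ _) ler_norml => /andP[_ h1].
    by have := gM (emp_process P X n w); rewrite ler_norml mulr1 => /andP[h2 _]; lra.
  have nB : ~ B w by move=> Bw'; move/negP: Bw; apply; rewrite inE.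
  have cU := emp_process_cadlag mX modulus0 n w.
  have close t : `|emp_process P X n w t - grid_path q (fun i => Y i w) t| <= eps.
    by rewrite /grid_path /Y gfun_cell; exact: HB.
  have := envelope_lip gM k0 (ltW eps0) (envelope_set_cadlag g k%:R cU) close.
  by have := envelope_le gM k0 cU; rewrite -/(h _ _ _) mulr0 addr0; lra.
- rewrite expectRB//; last by apply: bmeasD; [exact: bmeas_cst|exact: bmeasZ].
  rewrite expectRD//; [|exact: bmeas_cst|exact: bmeasZ].
  rewrite expectR_cst expectRZ// expectR_indic//.
  have MPB : 2 * M * fine (P B) <= 2 * M * eta by apply: ler_wpM2l; rewrite ?mulr_ge0.
  have := Hn1 n n1n; rewrite /= ler_norml => /andP[_ h1].
  move: h1 Hq Meta keps MPB; rewrite /Y.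
  move: (expectR P _) (expectR Q _) => u v.
  by lra.
Qed.

End test_function.

Lemma weak_convergence : cvg_dist_D P (emp_process P X) Q (fun w t => W t w).
Proof.
move=> g [M gM] gc; apply/cvgrPdist_le => e e0.
have [n1 H1] := lower_approx gM gc e0.
have gM' x : `|(fun x => - g x) x| <= M by rewrite normrN.
have gc' x : cadlag x -> forall e : R, 0 < e -> exists2 delta : R, 0 < delta &
    forall y, cadlag y -> skorokhod_dist x y < delta ->
      `|(fun x => - g x) x - (fun x => - g x) y| < e.
  move=> cx e1 e10; have [dl dl0 H] := gc x cx e1 e10; exists dl => // y cy xy.
  by rewrite /= -opprD normrN; exact: H.
have [n2 H2] := lower_approx gM' gc' e0.
rewrite expectRN in H2; last exact: bmeas_test gM gc.
exists (maxn n1 n2) => // n; rewrite /= geq_max => /andP[nn1 nn2].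
have [L [bL Lg EL]] := H1 n nn1; have [U [bU Ug EU]] := H2 n nn2.
have bU' : bmeas (fun w => - U w) by exact: bmeasN.
(* The middle term may fail to be measurable; both bounds are. *)
have LgU w : L w <= g (emp_process P X n w) <= - U w by rewrite Lg lerNr Ug.
have := @expectR_between _ _ _ P _ _ _ bL bU' LgU.
rewrite expectRN// => /andP[h1 h2].
by rewrite ler_norml; apply/andP; split; lra.
Qed.

End weak_convergence.

Theorem theorem3 (R : realType) (d : nat) (alpha : R)
  (dO : measure_display) (O : measurableType dO) (P : probability O R)
  (X : nat -> O -> 'I_d -> R) :
  0 < alpha <= 1 ->
  (forall (i : nat) (k : 'I_d), measurable_fun setT (fun w => X i w k)) ->
  strictly_stationary P X ->
  continuous_Rd (dist_fun P X) ->
  (* (i) CLT for Hoelder functions *)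
  (forall f : ('I_d -> R) -> R, in_Holder alpha f ->
     expectR P (fun w => f (X 0%N w)) = 0 ->
     exists2 sigma2 : R, 0 <= sigma2 &
       cvg_dist_normal P
         (fun n w => (Num.sqrt n%:R)^-1 * \sum_(1 <= i < n.+1) f (X i w)) sigma2) ->
  (* (ii) modulus_cont of continuity and moment bound *)
  (exists (beta gamma r : R) (p : nat) (kappa : nat -> R) (lambda z0 : R)
          (Phi : R -> R),
     (0 < beta /\ 1 < gamma /\ 1 <= r /\ r * d%:R < p%:R /\
      (forall i : nat, (1 <= i <= p)%N -> 0 < kappa i) /\
      1 < lambda /\ 0 < z0) /\
     (* Phi : R_0^+ -> R_0^+ invertible and increasing *)
     [/\ (forall x, 0 <= x -> 0 <= Phi x),
         (forall x y, 0 <= x -> x <= y -> Phi x <= Phi y) &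
         (forall y, 0 <= y -> exists! x, 0 <= x /\ Phi x = y)] /\
     (forall y, 0 < y ->
        modulus_cont (dist_fun P X) y <= beta * (Phi (y `^ (- alpha))) `^ (- gamma)) /\
     (forall i : nat, (1 <= i <= p)%N ->
        kappa i < gamma * (i%:R / r + 2 * (p%:R - i%:R) - d%:R)) /\
     (forall z, z0 <= z -> Phi (2 * z) <= lambda * Phi z) /\
     exists2 C : R, 0 < C &
       forall f : ('I_d -> R) -> R, in_Holder alpha f -> sup_norm f <= 1 ->
       forall n : nat, (1 <= n)%N ->
         let m := expectR P (fun w => f (X 0%N w)) in
         (\int[P]_w ((`| \sum_(1 <= i < n.+1) (f (X i w) - m) | ^+ (2 * p))%:E) <=
          (C * \sum_(1 <= i < p.+1)
                 (n%:R ^+ i * (Lr_norm P r (fun w => f (X 0%N w) - m)) ^+ i *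
                  (Phi (holder_norm alpha (fun x => f x - m))) `^ (kappa i)))%:E)%E) ->
  exists (dW : measure_display) (OW : measurableType dW) (Q : probability OW R)
         (W : ('I_d -> \bar R) -> OW -> R),
    [/\ centered_gaussian_process Q W,
        as_continuous_paths Q W &
        cvg_dist_D P (emp_process P X) Q (fun w t => W t w)].
Proof.
move=> alpha01 mX _ _ clt [beta [gamma [r [p [kappa [lambda [z0 [Phi hyps]]]]]]]].
have [[beta0 [gamma1 [r1 [rdp [kappa0 [lambda1 z00]]]]]]
  [[Phi_ge0 Phi_mono Phi_bij] [modulus_Phi [kappa_lt [Phi_double [C C0 moment]]]]]] := hyps.
have p0 : (0 < p)%N.
  by rewrite -(ltr_nat R); apply: le_lt_trans rdp; rewrite mulr_ge0// (le_trans ler01).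
have modulus0 := modulus_to0 alpha01 beta0 gamma1 Phi_ge0 Phi_mono Phi_bij modulus_Phi.
have [A [x [y [A0 x01 y01 tail]]]] := link_prob mX alpha01 p0 beta0 gamma1 r1 kappa0
  kappa_lt lambda1 z00 Phi_ge0 Phi_mono Phi_bij modulus_Phi Phi_double C0 moment.
have [Q [V [mV cvgV gaussV]]] := limit_field mX modulus0 alpha01 clt
  (fun f Z => emp_second_moment C0 moment p0).
have [G [mG G1 GW W0]] := limit_path_uniform mX modulus0 A0 x01 y01 tail mV cvgV.
have Wc := limit_path_continuous mX modulus0 A0 x01 y01 V.
exists _, (measurableTypeR R), Q, (limit_path P X x V); split.
- split; first exact: (measurable_limit_path mX modulus0 A0 x01 y01 tail mV cvgV).
  exact: (limit_path_gaussian mX modulus0 A0 x01 y01 tail mV cvgV gaussV).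
(* The event is the whole space: [limit_path] vanishes where the construction fails, so all paths
   are continuous. *)
- by exists setT; split; [exact: measurableT|exact: probability_setT|move=> w _; exact: Wc].
- apply: (@weak_convergence _ _ _ _ P X mX modulus0 (emp_approx mX modulus0 A0 x01 y01 tail)
    _ _ Q V mV cvgV (limit_path P X x V) G (fun q => x ^+ q / (1 - x)) mG G1) => //.
    have [x0 x1] := andP x01.
    rewrite -[X in _ --> X](mul0r (1 - x)^-1); apply: cvgMl; apply: cvg_expr.
    by rewrite ger0_norm// ltW.
  by move=> w; apply: continuous_cadlag; exact: Wc.
Qed.
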